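(* Consider a factor graph with variables $\{1,\dots,n\}$, continuous state space $\Omega=[a,b]^n$, set of factors $\Phi$, distribution $\pi(x)\propto\exp\left(\sum_{\phi\in\Phi}\phi(x)\right)$, factor bounds $M_\phi$ and local maximum energy $L$. Then the PGDA Markov chain with minibatch size parameter $\lambda>0$ and polynomial degrees $m$ and $k$ is reversible and has stationary distribution $\pi$. Moreover, let $\bar\gamma$ denote its spectral gap and let $\gamma$ denote the spectral gap of plain Gibbs sampling. Assume $\rho>1$ is some constant such that every factor function $\phi$, treated as a function of any single variable $x_i$, is analytically continuable to the Bernstein ellipse with radius parameter $\rho$ shifted and scaled so that its foci are at $a$ and $b$, such that it satisfies $|\phi(z)|\le M_\phi$ anywhere in that ellipse. Then, if $\lambda\log 2\ge 4L$, and if $m$ is set large enough that $4\rho^{-m/2}\le\sqrt{\rho}-1$, it holds that $$\bar\gamma\ \ge\ \left(1-4\sqrt{F}\right)\exp\left(-\frac{4L^2}{\lambda}\right)\cdot\gamma,\qquad\text{where}\qquad F=\frac{4\exp(8L)\,\rho^{-k/2}}{\sqrt{\rho}-1}+\exp\left(\frac{16L\,\rho^{-m/2}}{\sqrt{\rho}-1}\right)-1 .$$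
   Context: Factor graph. $a<b$ are reals, $\Omega=[a,b]^n$, and $\Phi$ is a finite set of functions $\phi:\Omega\to\mathbb{R}$. The distribution $\pi$ has density $\pi(x)=\frac1Z\exp\left(\sum_{\phi\in\Phi}\phi(x)\right)$ on $\Omega$. $A[i]\subseteq\Phi$ is the set of factors that depend on variable $i$. For each $\phi$, $M_\phi=\sup_{x\in\Omega}\phi(x)-\inf_{x\in\Omega}\phi(x)$, assumed finite and positive, and (by adding a constant to each factor, which does not change $\pi$) it is assumed that $0\le\phi(x)\le M_\phi$ for all $x\in\Omega$. The local maximum energy is $L=\max_{i\in\{1,\dots,n\}}\sum_{\phi\in A[i]}M_\phi$. For $x\in\Omega$ and $v\in[a,b]$, $x^{i\to v}$ denotes $x$ with its $i$th coordinate $x(i)$ replaced by $v$. Plain Gibbs sampling. From state $x$: choose $i$ uniformly from $\{1,\dots,n\}$, sample $v$ from the density on $[a,b]$ proportional to $v\mapsto\exp\left(\sum_{\phi\in A[i]}\phi(x^{i\to v})\right)$, and move to $x^{i\to v}$. Chebyshev interpolant. The degree-$d$ Chebyshev interpolant on $[a,b]$ of a function $g$ is the polynomial of degree at most $d$ that agrees with $g$ at the $d+1$ Chebyshev points $\frac{a+b}{2}+\frac{b-a}{2}\cos(j\pi/d)$, $j=0,\dots,d$. Bernstein ellipse. The Bernstein ellipse with parameter $\rho>1$ is the open region of $\mathbb{C}$ bounded by the ellipse with foci $\pm1$ whose semimajor and semiminor axis lengths sum to $\rho$; its shifted-and-scaled version with foci $a,b$ is its image under $z\mapsto\frac{a+b}{2}+\frac{b-a}{2}z$.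 PGDA (Poisson-Gibbs with double Chebyshev approximation), with parameters $\lambda>0$ and degrees $m,k$. From state $x$: choose $i$ uniformly from $\{1,\dots,n\}$; independently for each $\phi\in A[i]$ sample $s_\phi\sim\mathrm{Poisson}\left(\frac{\lambda M_\phi}{L}+\phi(x)\right)$; set $U_v=\sum_{\phi\in A[i]}s_\phi\log\left(1+\frac{L}{\lambda M_\phi}\phi(x^{i\to v})\right)$ for $v\in[a,b]$; let $\tilde U_v$ be the degree-$m$ Chebyshev interpolant on $[a,b]$ of $v\mapsto U_v$; let $\tilde f$ be the degree-$k$ Chebyshev interpolant on $[a,b]$ of $v\mapsto\exp(\tilde U_v)$; compute the polynomial $\tilde F(v)=\left(\int_a^b\tilde f(y)\,dy\right)^{-1}\int_a^v\tilde f(y)\,dy$; sample $u$ uniformly from $[0,1]$ and solve the root-finding problem $\tilde F(v)=u$ for $v$; finally, with probability $\min(1,p)$, where $p=\frac{\exp(U_v)\,\tilde f(x(i))}{\exp(U_{x(i)})\,\tilde f(v)}$, move to $x^{i\to v}$, and otherwise stay at $x$. The $s_\phi$ are freshly resampled at every step, so this is a Markov chain on $\Omega$. Spectral gap. The gap between the largest and second-largest eigenvalues of the transition operator; for a Markov kernel $P$ on $\Omega$ reversible with respect to $\pi$ it is $$\inf\left\{\tfrac12\int_\Omega\int_\Omega(f(x)-f(y))^2\,P(x,dy)\,\pi(dx)\ :\ f\in L^2(\pi),\ \int f\,d\pi=0,\ \int f^2\,d\pi=1\right\}.$$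
   Formalization: If for some minibatch the equation F̃(v)=u does not have exactly one root in [a,b] for every u in [0,1] (f̃ takes negative values, so the described move is undefined), PGDA is taken to stay at x. Factors are taken to be Borel measurable and n, m, k ≥ 1. *)

(* Defs.v *)
From HB Require Import structures.
From mathcomp Require Import all_boot all_order all_algebra.
From mathcomp Require Import all_classical all_reals all_analysis.
From mathcomp Require Import measurable_realfun.
From mathcomp Require Import complex.

Set Implicit Arguments.
Unset Strict Implicit.
Unset Printing Implicit Defensive.

Import Order.TTheory GRing.Theory Num.Theory.
Import numFieldNormedType.Exports.

Local Open Scope classical_set_scope.
Local Open Scope ring_scope.

Notation state R n := (n.-tuple (measurableTypeR R)).

Section density.
Context d (T : measurableType d) (R : realType).
Variable mu : {measure set T -> \bar R}.
Variables (D : set T) (mD : measurable D).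
Variables (f : T -> R) (mf : measurable_fun D f).
Hypothesis f_ge0 : forall x, D x -> 0 <= f x.

(* The unused proofs mD, mf and f_ge0 let the measure structure be inferred. *)
Definition density_measure of measurable D & measurable_fun D f
    & (forall x, D x -> 0 <= f x) : set T -> \bar R :=
  fun B => (\int[mu]_(x in D `&` B) (f x)%:E)%E.

Local Notation dm := (density_measure mD mf f_ge0).

Let dm0 : dm set0 = 0%E.
Proof. by rewrite /density_measure setI0 integral_set0. Qed.

Let dm_ge0 B : (0 <= dm B)%E.
Proof. by apply: integral_ge0 => x [Dx _]; rewrite lee_fin f_ge0. Qed.

Let dm_sigma_additive : semi_sigma_additive dm.
Proof.
move=> /= F mF tF mUF; rewrite /density_measure; apply: cvg_toP.
  apply: ereal_nondecreasing_is_cvgn => p q pq.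
  apply: lee_sum_nneg_natr => // k _ _.
  by apply: integral_ge0 => x [Dx _]; rewrite lee_fin f_ge0.
rewrite setI_bigcupr ge0_integral_bigcup//=.
- by move=> k; exact: measurableI.
- apply/measurable_EFinP; apply: measurable_funS mf => //.
  by move=> x [k _ []].
- by move=> x [k _ [Dx _]]; rewrite lee_fin f_ge0.
- apply/trivIsetP => i j _ _ ij; rewrite setIACA setIid.
  by move/trivIsetP : tF => /(_ i j Logic.I Logic.I ij) ->; rewrite setI0.
Qed.

HB.instance Definition _ := isMeasure.Build _ _ _ dm
  dm0 dm_ge0 dm_sigma_additive.

End density.

Section lebesgue_tuple.
Context (R : realType).

Definition state_cons n (p : measurableTypeR R * state R n) : state R n.+1 :=
  [the n.+1.-tuple (measurableTypeR R) of p.1 :: p.2].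

Lemma measurable_state_cons n :
  measurable_fun [set: measurableTypeR R * state R n] (@state_cons n).
Proof. exact (measurable_cons measurable_fst measurable_snd). Qed.

Definition lebesgue_cons n
    (m : {sigma_finite_measure set (state R n) -> \bar R}) :
    set (state R n.+1) -> \bar R :=
  pushforward (lebesgue_measure \x m)%E (@state_cons n).

Section lebesgue_cons_measure.
Context n (m : {sigma_finite_measure set (state R n) -> \bar R}).

Let lc0 : lebesgue_cons m set0 = 0%E.
Proof. by rewrite /lebesgue_cons /pushforward preimage_set0 measure0. Qed.

Let lc_ge0 A : (0 <= lebesgue_cons m A)%E.
Proof. by rewrite /lebesgue_cons /pushforward measure_ge0. Qed.

Let lc_sigma_additive : semi_sigma_additive (lebesgue_cons m).
Proof.
move=> F mF tF mUF; rewrite /lebesgue_cons /pushforward preimage_bigcup.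
have mpre A : measurable A -> measurable (@state_cons n @^-1` A).
  by move=> mA; rewrite -[X in measurable X]setTI; exact: measurable_state_cons.
apply: measure_semi_sigma_additive.
- by move=> k; exact: mpre.
- apply/trivIsetP => /= i j _ _ ij; rewrite -preimage_setI.
  by move/trivIsetP : tF => /(_ _ _ _ _ ij) ->//; rewrite preimage_set0.
- by rewrite -preimage_bigcup; exact: mpre.
Qed.

HB.instance Definition _ := isMeasure.Build _ _ _ (lebesgue_cons m)
  lc0 lc_ge0 lc_sigma_additive.

Let lc_sigma_finite : sigma_finite setT (lebesgue_cons m).
Proof.
have /sigma_finiteP[F [TF ndF Foo]] := sigma_finiteT (@lebesgue_measure R).
have /sigma_finiteP[H [TH ndH Hoo]] := sigma_finiteT m.
pose uncons (t : state R n.+1) : measurableTypeR R * state R n :=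
  (thead t, [tuple of behead t]).
have consK : cancel (@state_cons n) uncons.
  move=> [x t]; rewrite /uncons /state_cons/= theadE; congr pair.
  exact: val_inj.
have munc : measurable_fun setT uncons.
  apply/measurable_fun_pair; first exact: measurable_tnth.
  exact: measurable_behead.
exists (fun k => uncons @^-1` (F k `*` H k)).
  apply/seteqP; split => // t _.
  have [p _ Fp] : (\bigcup_k F k) (uncons t).1 by rewrite -TF.
  have [q _ Hq] : (\bigcup_k H k) (uncons t).2 by rewrite -TH.
  exists (maxn p q) => //; split => /=.
  - by move: Fp; exact/subsetPset/ndF/leq_maxl.
  - by move: Hq; exact/subsetPset/ndH/leq_maxr.
move=> k; have [mFk Fkoo] := Foo k; have [mHk Hkoo] := Hoo k; split.
  by rewrite -[X in measurable X]setTI; apply: munc => //; exact: measurableX.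
rewrite /lebesgue_cons /pushforward.
rewrite (_ : @state_cons n @^-1` _ = F k `*` H k); last first.
  by apply/funext => p; rewrite -[in RHS](consK p).
by rewrite product_measure1E// lte_mul_pinfty// ge0_fin_numE.
Qed.

HB.instance Definition _ := Measure_isSigmaFinite.Build _ _ _ (lebesgue_cons m)
  lc_sigma_finite.

End lebesgue_cons_measure.

Fixpoint lebesgue_tuple n : {sigma_finite_measure set (state R n) -> \bar R} :=
  match n with
  | 0 => dirac ([tuple] : state R 0)
  | n.+1 => lebesgue_cons (lebesgue_tuple n)
  end.

End lebesgue_tuple.

Section box.
Context (R : realType) (n : nat).
Implicit Types (x y : state R n) (i : 'I_n) (D : set (state R n)).

Definition box (a b : R) : set (state R n) :=
  [set x | forall i, a <= tnth x i <= b].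

Definition update x i (v : R) : state R n :=
  [tuple if l == i then v else tnth x l | l < n].

Definition osc D (g : state R n -> R) : R := sup (g @` D) - inf (g @` D).

Definition depends_on D (g : state R n -> R) i : Prop :=
  exists x y, [/\ D x, D y, (forall l, l != i -> tnth x l = tnth y l)
                & g x <> g y].

Lemma measurable_box a b : measurable (box a b).
Proof.
rewrite (_ : box a b =
    \bigcap_(i in [set: 'I_n]) ((@tnth n R ^~ i) @^-1` `[a, b])); last first.
  apply/seteqP; split => x xab i => [_|]; first by rewrite /= in_itv/=.
  by have /= := xab i Logic.I; rewrite in_itv.
apply: fin_bigcap_measurable => // i _.
by rewrite -[X in measurable X]setTI; exact: measurable_tnth.
Qed.

End box.

(* Factors are indexed by a finite type J.  They are total functions on R^n;
   only their values on the box are constrained or ever used. *)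
Record factor_graph (R : realType) (n : nat) (J : finType) := FactorGraph {
  lo : R;
  hi : R;
  lo_lt_hi : lo < hi;
  factor_fun : J -> state R n -> R;
  factor_measurable : forall j, measurable_fun (box lo hi) (factor_fun j);
  factor_osc_gt0 : forall j, 0 < osc (box lo hi) (factor_fun j);
  factor_bounds : forall j x, box lo hi x ->
    0 <= factor_fun j x <= osc (box lo hi) (factor_fun j) }.

Section factor_graph_theory.
Context (R : realType) (n : nat) (J : finType) (G : factor_graph R n J).
Implicit Types (x : state R n) (i : 'I_n) (v : R) (B : set (state R n)).

Local Notation a := (lo G).
Local Notation b := (hi G).
Local Notation phi := (factor_fun G).
Local Notation mu := (@lebesgue_measure R).

Definition Omega : set (state R n) := box a b.

Definition Mphi (j : J) : R := osc Omega (phi j).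

Definition adjacent i : {set J} := [set j | `[< depends_on Omega (phi j) i >]].

(* The sums are nonnegative, so for 0 < n the default value 0 is harmless. *)
Definition Lmax : R := \big[Num.max/0]_(i < n) \sum_(j in adjacent i) Mphi j.

Definition partition_function : R :=
  \int[lebesgue_tuple R n]_(x in Omega) expR (\sum_j phi j x).

Definition target_pdf x : R :=
  partition_function^-1 * expR (\sum_j phi j x).

Lemma measurable_target_pdf : measurable_fun Omega target_pdf.
Proof.
apply: measurable_funM => //; apply: measurableT_comp => //.
by apply: measurable_sum => j; exact: factor_measurable.
Qed.

Lemma target_pdf_ge0 x : Omega x -> 0 <= target_pdf x.
Proof.
move=> _; rewrite mulr_ge0 ?expR_ge0// invr_ge0.
by apply: Rintegral_ge0 => y _; exact: expR_ge0.
Qed.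

Definition target : {measure set (state R n) -> \bar R} :=
  density_measure (lebesgue_tuple R n)
    (measurable_box a b) measurable_target_pdf target_pdf_ge0.

Definition gibbs_weight x i v : R :=
  expR (\sum_(j in adjacent i) phi j (update x i v)).

Definition gibbs_step x B : \bar R :=
  (\sum_(i < n) (n%:R^-1)%:E *
     (((\int[mu]_(v in `[a, b]) gibbs_weight x i v)^-1)%:E *
      \int[mu]_(v in `[a, b] `&` (update x i) @^-1` B)
        (gibbs_weight x i v)%:E))%E.

End factor_graph_theory.

Section chebyshev.
Context (R : realType) (a b : R).

Definition cheb_point (d j : nat) : R :=
  (a + b) / 2 + (b - a) / 2 * cos (j%:R * pi / d%:R).

Definition cheb_interp (d : nat) (g : R -> R) : {poly R} :=
  \sum_(j < d.+1) g (cheb_point d j) *: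
    \prod_(l < d.+1 | l != j)
      ((cheb_point d j - cheb_point d l)^-1 *: ('X - (cheb_point d l)%:P)).

Lemma cheb_point_inj d : a < b -> (0 < d)%N ->
  {in [pred j | (j <= d)%N] &, injective (cheb_point d)}.
Proof.
move=> ab d0 j l; rewrite !inE => jd ld /addrI.
have ba0 : (b - a) / 2 != 0.
  by rewrite gt_eqF// divr_gt0// subr_gt0.
move=> /(mulfI ba0)/cos_inj.
have bnd k : (k <= d)%N -> k%:R * pi / d%:R \in `[0, pi : R].
  move=> kd; rewrite in_itv/= divr_ge0 ?mulr_ge0 ?pi_ge0//=.
  by rewrite ler_pdivrMr ?ltr0n// mulrC ler_wpM2l ?pi_ge0// ler_nat.
have d0' : d%:R^-1 != 0 :> R by rewrite invr_eq0 pnatr_eq0 -lt0n.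
move=> /(_ (bnd _ jd) (bnd _ ld))/(mulIf d0').
by move=> /(mulIf (lt0r_neq0 (pi_gt0 R)))/eqP; rewrite eqr_nat => /eqP.
Qed.

Lemma size_cheb_interp d g : (size (cheb_interp d g) <= d.+1)%N.
Proof.
apply: (leq_trans (size_sum _ _ _)); apply/bigmax_leqP => j _.
apply: (leq_trans (size_scale_leq _ _)).
rewrite scaler_prod; apply: (leq_trans (size_scale_leq _ _)).
rewrite -big_filter size_prod_XsubC size_filter -sum1_count sum1_card.
by rewrite cardC1 card_ord.
Qed.

Lemma cheb_interpE d g (j : nat) : a < b -> (0 < d)%N -> (j <= d)%N ->
  (cheb_interp d g).[cheb_point d j] = g (cheb_point d j).
Proof.
move=> ab d0; rewrite -ltnS => jd; pose j' := Ordinal jd.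
have neqj (l : 'I_d.+1) : l != j' ->
    cheb_point d j - cheb_point d l != 0.
  rewrite subr_eq0; apply: contra => /eqP e.
  apply/eqP/val_inj/esym; apply: (cheb_point_inj ab d0) e.
    by rewrite inE -ltnS.
  by rewrite inE -ltnS.
have self : (\prod_(l < d.+1 | l != j')
    ((cheb_point d j - cheb_point d l)^-1 *: ('X - (cheb_point d l)%:P))).[
      cheb_point d j] = 1.
  rewrite horner_prod; apply: big1 => l lj.
  by rewrite hornerZ hornerXsubC mulVf// neqj.
have other (l : 'I_d.+1) : l != j' -> (\prod_(l' < d.+1 | l' != l)
    ((cheb_point d l - cheb_point d l')^-1 *: ('X - (cheb_point d l')%:P))).[
      cheb_point d j] = 0.
  move=> lj; rewrite horner_prod (bigD1 j') 1?eq_sym//=.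
  by rewrite hornerZ hornerXsubC subrr mulr0 mul0r.
rewrite /cheb_interp horner_sum (bigD1 j')//= hornerZ self mulr1.
suff -> : \sum_(l < d.+1 | l != j') (g (cheb_point d l) *:
    \prod_(l' < d.+1 | l' != l) ((cheb_point d l - cheb_point d l')^-1 *:
      ('X - (cheb_point d l')%:P))).[cheb_point d j] = 0 by rewrite addr0.
by apply: big1 => l lj; rewrite hornerZ other// mulr0.
Qed.

End chebyshev.

Section pgda.
Context (R : realType) (n : nat) (J : finType) (G : factor_graph R n J).
Context (lambda : R) (m k : nat).
Implicit Types (x : state R n) (i : 'I_n) (s : {ffun J -> nat}) (v u : R).
Implicit Types (B : set (state R n)).

Local Notation a := (lo G).
Local Notation b := (hi G).
Local Notation phi := (factor_fun G).
Local Notation mu := (@lebesgue_measure R).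

Definition poisson_rate x (j : J) : R := lambda * Mphi G j / Lmax G + phi j x.

Definition U x i s v : R :=
  \sum_(j in adjacent G i)
    (s j)%:R * ln (1 + Lmax G / (lambda * Mphi G j) * phi j (update x i v)).

Definition U_interp x i s : {poly R} := cheb_interp a b m (U x i s).

Definition f_interp x i s : {poly R} :=
  cheb_interp a b k (fun v => expR (U_interp x i s).[v]).

Definition F_interp x i s v : R :=
  (\int[mu]_(y in `[a, b]) (f_interp x i s).[y])^-1 *
  \int[mu]_(y in `[a, v]) (f_interp x i s).[y].

Definition is_root x i s u v : Prop := v \in `[a, b] /\ F_interp x i s v = u.

Definition root_problem_well_posed x i s : Prop :=
  forall u, 0 <= u <= 1 -> exists! v, is_root x i s u v.

Definition proposal x i s u : R := xget a [set v | is_root x i s u v].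

Definition accept x i s v : R :=
  Num.min 1
    (expR (U x i s v) * (f_interp x i s).[tnth x i] /
     (expR (U x i s (tnth x i)) * (f_interp x i s).[v])).

(* A sampled v is determined, with the intended density, exactly when F_interp
   is a bijective distribution function on [a, b].  This fails for the
   minibatches s for which the interpolant f_interp takes negative values on
   [a, b]; for these the chain stays put.  The event depends on i, on s and on
   the coordinates of x other than i only, so staying put preserves detailed
   balance, whereas picking one root among several would not. *)
Definition minibatch_step x i s B : \bar R :=
  if `[< root_problem_well_posed x i s >] then
    (\int[uniform_prob (@ltr01 R)]_u
       (accept x i s (proposal x i s u) *
          \1_B (update x i (proposal x i s u)) +
        (1 - accept x i s (proposal x i s u)) * \1_B x)%:E)%E
  else \d_x B.

(* Only the s_j with j in adjacent G i are sampled; the others are set to 0, so that s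
   ranges over the functions from that set to nat. *)
Definition minibatches i : set {ffun J -> nat} :=
  [set s | forall j, j \notin adjacent G i -> s j = 0%N].

Definition pgda_step x B : \bar R :=
  (\sum_(i < n) (n%:R^-1)%:E *
     \esum_(s in minibatches i)
       ((\prod_(j in adjacent G i) poisson_pmf (poisson_rate x j) (s j))%:E *
        minibatch_step x i s B))%E.

End pgda.

Section markov.
Context d (T : measurableType d) (R : realType).
Variables (mu : {measure set T -> \bar R}) (P : T -> {measure set T -> \bar R}).

Definition reversible : Prop := forall B C, measurable B -> measurable C ->
  (\int[mu]_(x in B) P x C = \int[mu]_(x in C) P x B)%E.

Definition stationary : Prop := forall B, measurable B ->
  (\int[mu]_x P x B = mu B)%E.

Definition dirichlet_form (f : T -> R) : \bar R :=
  ((2^-1)%:E * \int[mu]_x \int[P x]_y (((f x - f y) ^+ 2)%:E))%E.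

Definition spectral_gap : \bar R :=
  ereal_inf [set dirichlet_form f | f in
    [set f | [/\ f \in Lfun mu 2%:E, (\int[mu]_x (f x)%:E = 0)%E
               & (\int[mu]_x ((f x) ^+ 2)%:E = 1)%E]]].

End markov.

Section analyticity.
Context (R : realType).
Let C : numClosedFieldType := R[i].

Definition analytic_on (D : set C) (g : C -> C) : Prop :=
  forall z0, D z0 -> exists (c : nat -> C) (r : R), 0 < r /\
    forall z, `|z - z0| < r%:C%C ->
      series (fun j => c j * (z - z0) ^+ j) @ \oo --> g z.

(* If the semiaxes satisfy p + q = rho and the foci are +-1, then
   p ^ 2 - q ^ 2 = 1, so that the major axis is 2 p = rho + rho^-1. *)
Definition bernstein_ellipse (rho : R) : set C :=
  [set z | `|z - 1| + `|z + 1| < (rho + rho^-1)%:C%C].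

Definition scaled_bernstein_ellipse (a b rho : R) : set C :=
  [set ((a + b) / 2)%:C%C + ((b - a) / 2)%:C%C * z
  | z in bernstein_ellipse rho].

Definition analytically_continuable (a b rho bound : R) (g : R -> R) : Prop :=
  exists h : C -> C,
    [/\ analytic_on (scaled_bernstein_ellipse a b rho) h,
        (forall v, v \in `[a, b] -> h v%:C%C = (g v)%:C%C)
      & forall z, scaled_bernstein_ellipse a b rho z -> `|h z| <= bound%:C%C].

End analyticity.

(* Main.v *)
(* A chain which redraws one coordinate x(i) with density psi_i(x, .), or else
   stays put, is reversible with respect to the density f as soon as
   f(x) psi_i(x, v) is symmetric under exchanging x(i) and v, and its spectral
   gap is at least c times that of another such chain if psi_i dominates
   c times the other density.

   For PGDA, f~(a) > 0 because a is a Chebyshev node, so F~ is invertible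
   exactly when f~ >= 0 on [a, b], and then v has density f~ / I with I the
   integral of f~.  As exp(phi(x)) Poisson(lambda M / L + phi(x))(s) equals
   Poisson(lambda M / L)(s) (1 + L phi(x) / (lambda M)) ^ s, the flow from x to
   x^{i -> v} is, up to factors which do not involve x(i), the average over s
   with independent Poisson(lambda M / L) coordinates of
     g_s = min(exp(U_{x(i)}) f~(v), exp(U_v) f~(x(i))) / I,
   which is symmetric.

   For the gap, Chebyshev interpolation of a function analytic and bounded by V
   in the Bernstein ellipse of parameter rho has error at most
   4 V rho^-d / (rho - 1) on [a, b]; on the ellipse of parameter sqrt(rho) the
   interpolant exceeds V by at most the analogous bound with sqrt(rho).
   Applying this twice, |f~ - exp(U)| <= delta_s exp(U), where delta_s is
   exponential in the size of s.  Hence, if delta_s < 1 / 2,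
   g_s >= (1 - 2 delta_s) exp(U_{x(i)} + U_v) / J_s, where J_s is the integral of
   exp(U).  An AM-GM bound linear in J_s and delta_s can be averaged by means of
   the Poisson moment generating function. *)
Require Import Defs.
From HB Require Import structures.
From mathcomp Require Import all_boot all_order all_algebra.
From mathcomp Require Import all_classical all_reals all_analysis.
From mathcomp Require Import measurable_realfun.
From mathcomp Require Import complex ring lra.

Set Implicit Arguments.
Unset Strict Implicit.
Unset Printing Implicit Defensive.

Import Order.TTheory GRing.Theory Num.Theory.
Import numFieldNormedType.Exports.

Local Open Scope classical_set_scope.
Local Open Scope ring_scope.

(** * Strict differentiability and power series *)

(** Contour integrals are replaced by means over N equally spaced points of a circle. Strict
    differentiability makes such means asymptotically independent of the radius, a discrete Cauchy
    theorem ([cmean_cst]). On N equally spaced points the geometric expansion of the Cauchy kernel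
    is finite and exact, so truncated Laurent sums with coefficients at most V / S^k come out
    directly.

    Logarithm and exponential are never continued to the complex plane. They are replaced by Taylor
    polynomials, and the limit is taken after interpolation, which reads only finitely many values
    on the segment.

    The second interpolation needs a bound on the first interpolant off the segment, which is lost
    towards the ellipse of parameter rho; stopping at sqrt(rho) keeps it, at the price of the
    exponents m / 2 and k / 2.

    Put t = L / lambda, which is at most 1 / 4. The constants 8 L, 16 L and 4 L^2 / lambda come from
    elementary inequalities in t. The averaging argument yields the factor 1 - 4 F, from which 1 - 4
    sqrt(F) follows at the very end. *)

Section complex_modulus.
Context {R : realType}.
Local Notation C := R[i].
Implicit Types (z w : C) (x y : R).

(** The norm of [R[i]] is itself an element of [R[i]], where the order is partial. Its real part
    turns all estimates into inequalities between reals. *)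
Definition nrm z : R := complex.Re `|z|.

Lemma nrmE z : `|z| = (nrm z)%:C%C.
Proof. by rewrite /nrm normc_def. Qed.

Lemma nrm_ge0 z : 0 <= nrm z.
Proof. by rewrite -lecR -nrmE normr_ge0. Qed.

Lemma nrm0 : nrm 0 = 0.
Proof. by apply: complexI; rewrite -nrmE normr0. Qed.

Lemma nrm1 : nrm 1 = 1.
Proof. by apply: complexI; rewrite -nrmE normr1. Qed.

Lemma nrm_eq0 z : (nrm z == 0) = (z == 0).
Proof.
apply/eqP/eqP => [h|->]; last exact: nrm0.
by apply/eqP; rewrite -normr_eq0 nrmE h.
Qed.

Lemma nrm_gt0 z : (0 < nrm z) = (z != 0).
Proof. by rewrite lt_neqAle nrm_ge0 andbT eq_sym nrm_eq0. Qed.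

Lemma nrmM z w : nrm (z * w) = nrm z * nrm w.
Proof. by apply: complexI; rewrite rmorphM/= -!nrmE normrM. Qed.

Lemma nrmX z n : nrm (z ^+ n) = nrm z ^+ n.
Proof. by apply: complexI; rewrite rmorphXn/= -!nrmE normrX. Qed.

Lemma nrmV z : nrm z^-1 = (nrm z)^-1.
Proof. by apply: complexI; rewrite fmorphV/= -!nrmE normfV. Qed.

Lemma nrmN z : nrm (- z) = nrm z.
Proof. by rewrite /nrm normrN. Qed.

Lemma nrmB z w : nrm (z - w) = nrm (w - z).
Proof. by rewrite -nrmN opprB. Qed.

Lemma nrmD z w : nrm (z + w) <= nrm z + nrm w.
Proof. by rewrite -lecR rmorphD/= -!nrmE ler_normD. Qed.

Lemma nrm_real x : nrm x%:C%C = `|x|.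
Proof. by rewrite /nrm normc_def/= expr0n/= addr0 sqrtr_sqr. Qed.

Lemma nrm_nat n : nrm n%:R = n%:R.
Proof. by rewrite -(rmorph_nat (real_complex R)) nrm_real normr_nat. Qed.

Lemma nrm_sum I (r : seq I) (P : pred I) (F : I -> C) :
  nrm (\sum_(i <- r | P i) F i) <= \sum_(i <- r | P i) nrm (F i).
Proof.
elim/big_ind2: _ => [|z1 x1 z2 x2 h1 h2|//]; first by rewrite nrm0.
by apply: (le_trans (nrmD _ _)); exact: lerD.
Qed.

Lemma nrm_Complex x y : nrm (Complex x y) <= `|x| + `|y|.
Proof.
have -> : Complex x y = x%:C%C + 'i%C * y%:C%C by rewrite [LHS]complexE.
apply: (le_trans (nrmD _ _)); rewrite nrmM !nrm_real lerD2l.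
suff -> : nrm 'i%C = 1 :> R by rewrite mul1r.
by rewrite /nrm normc_def/= expr0n/= add0r expr1n sqrtr1.
Qed.

Lemma nrm_subr z w : nrm z - nrm w <= nrm (z - w).
Proof. by rewrite lerBlDr; have := nrmD (z - w) w; rewrite subrK. Qed.

Lemma nrm_tri (y x z : C) : nrm (x - z) <= nrm (x - y) + nrm (y - z).
Proof. by have := nrmD (x - y) (y - z); rewrite addrA subrK. Qed.

End complex_modulus.

Section strict_differentiability.
Context {R : realType}.
Local Notation C := R[i].
Implicit Types (g h : C -> C) (z w : C).

(** Strict differentiability: both end points of the increment move. The estimate at z then serves
    all centres near z with the same e, which is what the compactness argument in [uniform_sdiff]
    needs; pointwise differentiability would call for a Goursat argument. *)
Definition sdiff_with g z c := forall e : R, 0 < e -> exists2 d : R, 0 < d &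
  forall u v, nrm (u - z) < d -> nrm (v - z) < d ->
    nrm (g u - g v - c * (u - v)) <= e * nrm (u - v).

Definition sdiff g z := exists c, sdiff_with g z c.

Lemma sdiff_near g h z (d : R) : 0 < d ->
  (forall u, nrm (u - z) < d -> g u = h u) -> sdiff h z -> sdiff g z.
Proof.
move=> d0 gh [c hc]; exists c => e /hc[d' d'0 H].
exists (Num.min d d'); first by rewrite lt_min d0.
by move=> u v; rewrite !lt_min => /andP[ud ud'] /andP[vd vd']; rewrite !gh ?H.
Qed.

Lemma sdiff_cst (c : C) z : sdiff (fun=> c) z.
Proof.
exists 0 => e e0; exists 1 => // u v _ _.
by rewrite subrr mul0r subr0 nrm0 mulr_ge0 ?nrm_ge0 ?ltW.
Qed.

Lemma sdiff_id z : sdiff id z.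
Proof.
exists 1 => e e0; exists 1 => // u v _ _.
by rewrite mul1r subrr nrm0 mulr_ge0 ?nrm_ge0 ?ltW.
Qed.

Lemma sdiffD g h z : sdiff g z -> sdiff h z -> sdiff (g \+ h) z.
Proof.
move=> [c hc] [c' hc']; exists (c + c') => e e0.
have e20 : 0 < e / 2 by rewrite divr_gt0.
have [d d0 H] := hc _ e20; have [d' d'0 H'] := hc' _ e20.
exists (Num.min d d'); first by rewrite lt_min d0.
move=> u v; rewrite !lt_min => /andP[ud ud'] /andP[vd vd'] /=.
have -> : g u + h u - (g v + h v) - (c + c') * (u - v) =
  (g u - g v - c * (u - v)) + (h u - h v - c' * (u - v)) by ring.
by apply: (le_trans (nrmD _ _)); have := H u v ud vd; have := H' u v ud' vd'; lra.
Qed.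

Lemma sdiff_lip g z : sdiff g z -> exists2 K : R, 0 < K & exists2 d : R, 0 < d &
  forall u v, nrm (u - z) < d -> nrm (v - z) < d ->
    nrm (g u - g v) <= K * nrm (u - v).
Proof.
move=> [c hc]; exists (nrm c + 1); first by rewrite ltr_wpDl ?nrm_ge0.
have [d d0 H] := hc 1 ltr01; exists d => // u v ud vd.
have := H u v ud vd; rewrite mul1r => h.
have -> : g u - g v = (g u - g v - c * (u - v)) + c * (u - v) by ring.
by apply: (le_trans (nrmD _ _)); rewrite nrmM mulrDl mul1r addrC lerD.
Qed.

Lemma sdiff_continuous g z (e : R) : sdiff g z -> 0 < e -> exists2 d : R, 0 < d &
  forall u, nrm (u - z) < d -> nrm (g u - g z) < e.
Proof.
move=> /sdiff_lip[K K0 [d d0 H]] e0.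
exists (Num.min d (e / K)); first by rewrite lt_min d0 divr_gt0.
move=> u; rewrite lt_min => /andP[ud]; rewrite ltr_pdivlMr// mulrC => ue.
by apply: le_lt_trans ue; apply: H => //; rewrite subrr nrm0.
Qed.

Lemma sdiff_comp g h z : sdiff h z -> sdiff g (h z) -> sdiff (g \o h) z.
Proof.
move=> sh [c hc]; have [K K0 [d1 d10 L]] := sdiff_lip sh; case: (sh) => c' hc'.
exists (c * c') => e e0.
have K20 : 0 < e / (2 * K) by rewrite divr_gt0// mulr_gt0.
have c0 : 0 < nrm c + 1 by rewrite ltr_wpDl ?nrm_ge0.
have c20 : 0 < e / (2 * (nrm c + 1)) by rewrite divr_gt0// mulr_gt0.
have [d2 d20 H2] := hc _ K20.
have [d3 d30 H3] := sdiff_continuous sh d20.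
have [d4 d40 H4] := hc' _ c20.
exists (Num.min d1 (Num.min d3 d4)); first by rewrite !lt_min d10 d30.
move=> u v; rewrite !lt_min => /and3P[u1 u2 u3] /and3P[v1 v2 v3] /=.
have -> : g (h u) - g (h v) - c * c' * (u - v) = (g (h u) - g (h v) - c * (h u - h v))
  + c * (h u - h v - c' * (u - v)) by ring.
apply: (le_trans (nrmD _ _)); rewrite nrmM.
have b1 : nrm (g (h u) - g (h v) - c * (h u - h v)) <= e / (2 * K) * (K * nrm (u - v)).
  apply: (le_trans (H2 _ _ (H3 _ u2) (H3 _ v2))).
  by apply: ler_wpM2l; [exact: ltW | exact: L].
have b2 : nrm c * nrm (h u - h v - c' * (u - v)) <=
    (nrm c + 1) * (e / (2 * (nrm c + 1)) * nrm (u - v)).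
  by apply: ler_pM; rewrite ?nrm_ge0// ?lerDl// H4.
apply: (le_trans (lerD b1 b2)); rewrite le_eqVlt; apply/orP; left; apply/eqP.
by field; rewrite (lt0r_neq0 K0) (lt0r_neq0 c0).
Qed.

Lemma sdiff_scale c z : sdiff ( *%R c) z.
Proof.
exists c => e e0; exists 1 => // u v _ _.
by rewrite -mulrBr subrr nrm0 mulr_ge0 ?nrm_ge0 ?ltW.
Qed.

Lemma sdiff_sqr z : sdiff (fun w => w ^+ 2) z.
Proof.
exists (2 * z) => e e0; exists (e / 2); first by rewrite divr_gt0.
move=> u v ud vd; rewrite (_ : _ - _ = ((u - z) + (v - z)) * (u - v)); last by ring.
rewrite nrmM ler_wpM2r ?nrm_ge0// (le_trans (nrmD _ _))// (splitr e).
by rewrite lerD// ltW.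
Qed.

(* By polarization, 2 * (g * h) = (g + h) ^ 2 - (g ^ 2 + h ^ 2). *)
Lemma sdiffM g h z : sdiff g z -> sdiff h z -> sdiff (g \* h) z.
Proof.
move=> sg sh; have sq f : sdiff f z -> sdiff (fun w => f w ^+ 2) z.
  by move=> sf; apply: (@sdiff_comp (fun w => w ^+ 2)) => //; exact: sdiff_sqr.
have sZ c f : sdiff f z -> sdiff (fun w => c * f w) z.
  by move=> sf; apply: (@sdiff_comp ( *%R c)) => //; exact: sdiff_scale.
have -> : g \* h = fun w => 2^-1 * ((g w + h w) ^+ 2 + -1 * (g w ^+ 2 + h w ^+ 2)).
  by apply/funext => w /=; field.
apply: (sZ); apply: sdiffD; first by apply: (sq); exact: sdiffD.
by apply: (sZ); apply: sdiffD; exact: sq.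
Qed.

Lemma sdiffV z : z != 0 -> sdiff (fun w => w^-1) z.
Proof.
move=> z0; exists (- (z ^+ 2)^-1) => e e0.
have a0 : 0 < nrm z by rewrite nrm_gt0.
set a := nrm z in a0.
(* Since |u| and |v| are at least a / 2 and |v| is at most 3 a / 2, the numerator below is at most 5
   a d / 2 and the denominator at least a^4 / 4. With d <= e a^3 / 12 it remains that 5 / 24 <= 1 /
   4. *)
pose d := Num.min (a / 2) (e * a ^+ 3 / 12).
have d0 : 0 < d by rewrite lt_min !divr_gt0// mulr_gt0// exprn_gt0.
have da : d <= a / 2 by rewrite ge_min lexx.
have de : d <= e * a ^+ 3 / 12 by rewrite ge_min lexx orbT.
exists d => // u v ud vd.
have hu : a / 2 <= nrm u.
  by have := nrm_subr z (z - u); rewrite subKr nrmB; move: ud da; rewrite /a; lra.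
have hv : a / 2 <= nrm v.
  by have := nrm_subr z (z - v); rewrite subKr nrmB; move: vd da; rewrite /a; lra.
have u0 : u != 0 by rewrite -nrm_gt0 (lt_le_trans _ hu)// divr_gt0.
have v0 : v != 0 by rewrite -nrm_gt0 (lt_le_trans _ hv)// divr_gt0.
have -> : u^-1 - v^-1 - - (z ^+ 2)^-1 * (u - v) =
  ((u - z) * v + z * (v - z)) * (u * v * z ^+ 2)^-1 * (u - v).
  by field; rewrite u0 v0 z0.
rewrite nrmM ler_wpM2r ?nrm_ge0// nrmM nrmV ler_pdivrMr; last first.
  by rewrite nrm_gt0 !mulf_neq0 ?expf_neq0.
apply: (le_trans (nrmD _ _)); rewrite !nrmM -/a -expr2.
have nv : nrm v <= 3 / 2 * a.
  by have := nrm_subr v z; rewrite -/a; move: vd da; lra.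
apply: (@le_trans _ _ (d * (3 / 2 * a) + a * d)).
  apply: lerD; first by apply: ler_pM; rewrite ?nrm_ge0// ltW.
  by rewrite ler_wpM2l// ltW.
apply: (@le_trans _ _ (e * (a / 2 * (a / 2) * a ^+ 2))); last first.
  rewrite ler_wpM2l ?(ltW e0)// ler_wpM2r ?sqr_ge0//.
  by apply: ler_pM => //; rewrite divr_ge0// ltW.
rewrite [leLHS](_ : _ = d * (5 / 2 * a)); last by field.
apply: (@le_trans _ _ (e * a ^+ 3 / 12 * (5 / 2 * a))).
  by rewrite ler_wpM2r// mulr_ge0// ltW.
have : 0 <= e * a ^+ 4 by rewrite mulr_ge0// ?exprn_ge0// ltW.
rewrite (_ : e * a ^+ 3 / 12 * (5 / 2 * a) = e * a ^+ 4 * (5 / 24)); last by field.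
rewrite (_ : e * (a / 2 * (a / 2) * a ^+ 2) = e * a ^+ 4 * (1 / 4)); last by field.
lra.
Qed.

End strict_differentiability.

Section power_series.
Context {R : realType}.
Local Notation C := R[i].
Implicit Types (g h f : C -> C) (z w x y : C).

Definition is_pseries (c : nat -> C) f z0 (r : R) := forall z, nrm (z - z0) < r ->
  forall e : R, 0 < e -> exists N, forall n, (N <= n)%N ->
    nrm (\sum_(j < n) c j * (z - z0) ^+ j - f z) < e.

Lemma nrm_subXX x y n (d : R) : nrm x <= d -> nrm y <= d ->
  nrm (x ^+ n.+1 - y ^+ n.+1) <= n.+1%:R * d ^+ n * nrm (x - y).
Proof.
move=> xd yd; have d0 : 0 <= d := le_trans (nrm_ge0 _) xd.
rewrite subrXX nrmM mulrC ler_wpM2r ?nrm_ge0//.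
apply: (le_trans (nrm_sum _ _ _)).
apply: (@le_trans _ _ (\sum_(i < n.+1) d ^+ n)); last first.
  by rewrite sumr_const card_ord mulr_natl.
apply: ler_sum => i _; rewrite nrmM !nrmX.
apply: (@le_trans _ _ (d ^+ (n.+1.-1 - i) * d ^+ i)).
  by apply: ler_pM; rewrite ?exprn_ge0 ?nrm_ge0// lerXn2r ?nnegrE ?nrm_ge0.
by rewrite -exprD /= subnK// -ltnS.
Qed.

(** The induction needs the exact partial sum; its limit 6 reappears in the choice of d in
    [pseries_sdiff_with]. *)
Lemma sum_arith_geo (n : nat) : \sum_(j < n) (j.+2%:R / 2 ^+ j : R) <= 6.
Proof.
suff -> : \sum_(j < n) (j.+2%:R / 2 ^+ j : R) = 6 - (2 * n%:R + 6) / 2 ^+ n.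
  by rewrite gerBl divr_ge0 ?exprn_ge0 ?addr_ge0 ?mulr_ge0.
elim: n => [|n IH]; first by rewrite big_ord0 expr0 mulr0 add0r divr1 subrr.
rewrite big_ord_recr/= IH exprS -addn2 natrD -[n.+1]addn1 natrD.
by field; rewrite expf_neq0// pnatr_eq0.
Qed.

(** The point z0 + r / 2 lies in the disc of convergence. There a term is the difference of two
    consecutive partial sums, hence at most 2 from some index on; the finitely many earlier terms
    are added to the bound. *)
Lemma pseries_bounded c f z0 (r : R) : 0 < r -> is_pseries c f z0 r ->
  exists2 B : R, 0 < B & forall j, nrm (c j) * (r / 2) ^+ j <= B.
Proof.
move=> r0 H.
have nr : nrm ((z0 + (r / 2)%:C%C) - z0) = r / 2.
  by rewrite addrC addKr nrm_real ger0_norm// divr_ge0// ltW.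
have [|N HN] := H (z0 + (r / 2)%:C%C) _ 1 ltr01.
  by rewrite nr ltr_pdivrMr// mulr_natr mulr2n ltrDl.
have te j : nrm (c j) * (r / 2) ^+ j = nrm (c j * (z0 + (r / 2)%:C%C - z0) ^+ j).
  by rewrite nrmM nrmX nr.
exists (2 + \sum_(j < N) nrm (c j) * (r / 2) ^+ j).
  rewrite ltr_wpDr// sumr_ge0// => j _.
  by rewrite mulr_ge0 ?nrm_ge0// exprn_ge0// divr_ge0// ltW.
have nn j : 0 <= nrm (c j) * (r / 2) ^+ j.
  by rewrite mulr_ge0 ?nrm_ge0// exprn_ge0// divr_ge0// ltW.
move=> j; have [jN|Nj] := ltnP j N.
  rewrite (bigD1 (Ordinal jN))//= addrCA lerDl addr_ge0// sumr_ge0//.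
rewrite ler_wpDr ?sumr_ge0// te.
have h1 := HN j Nj; have h2 := HN j.+1 (leq_trans Nj (leqnSn _)).
move: h2; rewrite big_ord_recr/= => h2.
set t := c j * _ in h2 *; set S := \sum_(i < j) _ in h1 h2.
set F := f _ in h1 h2.
have -> : t = (S + t - F) - (S - F) by ring.
apply: (le_trans (nrmD _ _)); rewrite nrmN; lra.
Qed.

Lemma pseries_sdiff_with c f z0 (r : R) : 0 < r -> is_pseries c f z0 r ->
  sdiff_with f z0 (c 1%N).
Proof.
move=> r0 H e e0; have [B B0 HB] := pseries_bounded r0 H.
set p := r / 2 in HB; have p0 : 0 < p by rewrite divr_gt0.
(* With |c j| <= B / p^j and d <= p / 2, the term of degree j + 2 contributes at most B d / p^2
   times (j + 2) / 2^j times |u - v|, and these sum to 6 B d / p^2 at most. *)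
pose d := Num.min (p / 2) (e * p ^+ 2 / (6 * B)).
have d0 : 0 < d by rewrite lt_min !divr_gt0// ?mulr_gt0// ?exprn_gt0.
have dp : d <= p / 2 by rewrite ge_min lexx.
have de : d <= e * p ^+ 2 / (6 * B) by rewrite ge_min lexx orbT.
exists d => // u v ud vd.
have ur : nrm (u - z0) < r by move: ud dp; rewrite /p; lra.
have vr : nrm (v - z0) < r by move: vd dp; rewrite /p; lra.
(* Only partial sums can be compared term by term; the slack h absorbs the truncation errors at u
   and at v. *)
apply/ler_addgt0Pr => h h0.
have h20 : 0 < h / 2 by rewrite divr_gt0.
have [N1 H1] := H u ur _ h20; have [N2 H2] := H v vr _ h20.
pose n := (maxn N1 N2).
have hu := H1 n.+2 (leq_trans (leq_maxl N1 N2) (leq_addl 2 _)).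
have hv := H2 n.+2 (leq_trans (leq_maxr N1 N2) (leq_addl 2 _)).
set x := u - z0 in hu ud *; set y := v - z0 in hv vd *.
have xy : u - v = x - y by rewrite /x /y; ring.
set Su := \sum_(j < _) _ in hu; set Sv := \sum_(j < _) _ in hv.
have -> : f u - f v - c 1%N * (u - v) =
  (Su - Sv - c 1%N * (x - y)) + (Sv - f v) - (Su - f u) by rewrite xy; ring.
apply: (le_trans (nrmD _ _)); rewrite nrmN.
have := nrmD (Su - Sv - c 1%N * (x - y)) (Sv - f v).
suff : nrm (Su - Sv - c 1%N * (x - y)) <= e * nrm (x - y) by rewrite xy; lra.
have -> : Su - Sv - c 1%N * (x - y) =
    \sum_(j < n) c j.+2 * (x ^+ j.+2 - y ^+ j.+2).
  rewrite /Su /Sv !big_ord_recl /= !expr0 !expr1.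
  under [RHS]eq_bigr do rewrite mulrBr.
  rewrite sumrB /bump /= add1n; set X := \sum_(i < n) _; set Y := \sum_(i < n) _.
  by ring.
apply: (le_trans (nrm_sum _ _ _)).
apply: (@le_trans _ _ (\sum_(j < n) (B / p ^+ 2 * d * nrm (x - y)) * (j.+2%:R / 2 ^+ j))).
  apply: ler_sum => j _; rewrite nrmM.
  have := nrm_subXX j.+1 (ltW ud) (ltW vd) => hj.
  apply: (le_trans (ler_wpM2l (nrm_ge0 _) hj)).
  have cj : nrm (c j.+2) <= B / p ^+ j.+2.
    by rewrite ler_pdivlMr ?exprn_gt0.
  have dj : d ^+ j <= (p / 2) ^+ j.
    by rewrite lerXn2r ?nnegrE// ltW// divr_gt0.
  apply: (@le_trans _ _ (B / p ^+ j.+2 * (j.+2%:R * (d * (p / 2) ^+ j) * nrm (x - y)))).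
    apply: ler_pM; rewrite ?nrm_ge0 ?mulr_ge0 ?nrm_ge0 ?exprn_ge0// ?(ltW d0)//.
    rewrite ler_wpM2r ?nrm_ge0// ler_wpM2l// exprS ler_wpM2l// ltW//.
  rewrite le_eqVlt; apply/orP; left; apply/eqP.
  have pj : p ^+ j != 0 by rewrite expf_neq0// lt0r_neq0.
  have tj : (2 : R) ^+ j != 0 by rewrite expf_neq0// pnatr_eq0.
  rewrite (_ : p ^+ j.+2 = p ^+ 2 * p ^+ j); last by rewrite -exprD.
  rewrite (_ : (p / 2) ^+ j = p ^+ j / 2 ^+ j); last by rewrite expr_div_n.
  move: (p ^+ j) (2 ^+ j) (j.+2%:R : R) pj tj => pj tj t2 pj0 tj0; field.
  by rewrite pj0 tj0 lt0r_neq0.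
rewrite -mulr_sumr.
apply: (@le_trans _ _ (B / p ^+ 2 * d * nrm (x - y) * 6)).
  rewrite ler_wpM2l ?sum_arith_geo// !mulr_ge0 ?nrm_ge0//; first exact: ltW.
    by rewrite invr_ge0 exprn_ge0// ltW.
  exact: ltW.
rewrite mulrAC ler_wpM2r ?nrm_ge0//.
apply: (@le_trans _ _ (B / p ^+ 2 * (e * p ^+ 2 / (6 * B)) * 6)).
  by rewrite ler_wpM2r// ler_wpM2l// divr_ge0 ?exprn_ge0// ltW.
rewrite le_eqVlt; apply/orP; left; apply/eqP; field.
by rewrite (lt0r_neq0 p0) (lt0r_neq0 B0).
Qed.

Lemma pseries_center c f z0 (r : R) : 0 < r -> is_pseries c f z0 r -> f z0 = c 0%N.
Proof.
move=> r0 H; apply/eqP; rewrite -subr_eq0 -nrm_eq0 eq_le nrm_ge0 andbT.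
apply/ler_addgt0Pr => e e0; rewrite add0r.
have [|N HN] := H z0 _ e e0; first by rewrite subrr nrm0.
have := HN N.+1 (leqnSn _); rewrite big_ord_recl big1 => [|j _].
  by rewrite expr0 mulr1 addr0 nrmB => /ltW.
by rewrite subrr expr0n/= mulr0.
Qed.

Definition diffquot f z0 (c : C) w : C :=
  if w == z0 then c else (f w - f z0) / (w - z0).

(** Subtracting c 0 and dividing by z - z0 shifts the coefficients, and at the centre the new
    constant term c 1 is the value prescribed in [diffquot]. *)
Lemma pseries_diffquot c f z0 (r : R) : 0 < r -> is_pseries c f z0 r ->
  is_pseries (fun j => c j.+1) (diffquot f z0 (c 1%N)) z0 r.
Proof.
move=> r0 H z zr e e0; rewrite /diffquot; case: eqVneq => [->|zz0].
  exists 1%N => -[//|n _].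
  rewrite big_ord_recl big1 => [|j _]; first by rewrite expr0 mulr1 addr0 subrr nrm0.
  by rewrite subrr expr0n/= mulr0.
have y0 : z - z0 != 0 by rewrite subr_eq0.
have [N HN] := H z zr (e * nrm (z - z0)) (mulr_gt0 e0 (etrans (nrm_gt0 _) y0)).
exists N => n Nn; have := HN n.+1 (leq_trans Nn (leqnSn _)).
rewrite -(ltr_pdivrMr _ _ (etrans (nrm_gt0 _) y0)) -nrmV -nrmM.
rewrite (pseries_center r0 H) big_ord_recl expr0 mulr1.
congr (nrm _ < _); rewrite mulrBl mulrDl mulr_suml.
rewrite (eq_bigr (fun j : 'I_n => c j.+1 * (z - z0) ^+ j)) => [|j _].
  by rewrite mulrBl; ring.
by rewrite lift0 exprS; field.
Qed.

End power_series.

(** * Laurent expansion in an annulus *)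

Section circle_means.
Context {R : realType}.
Local Notation C := R[i].
Implicit Types (g h f G : C -> C) (z w u v : C) (t r : R).

Definition cis t : C := Complex (cos t) (sin t).

Lemma cisD s t : cis (s + t) = cis s * cis t.
Proof.
by rewrite /cis cosD sinD; apply/eqP; rewrite eq_complex/= (addrC (sin s * _)) !eqxx.
Qed.

Lemma cis0 : cis 0 = 1.
Proof. by rewrite /cis cos0 sin0. Qed.

Lemma cisX t n : cis t ^+ n = cis (n%:R * t).
Proof.
elim: n => [|n IH]; first by rewrite mul0r cis0.
by rewrite exprS IH -cisD -{1}[t]mul1r -mulrDl nat1r.
Qed.

Lemma nrm_cis t : nrm (cis t) = 1.
Proof. by rewrite /nrm normc_def/= cos2Dsin2 sqrtr1. Qed.

Lemma cis_neq0 t : cis t != 0.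
Proof. by rewrite -nrm_gt0 nrm_cis. Qed.

Lemma cis_inv t : (cis t)^-1 = cis (- t).
Proof. by apply: (mulfI (cis_neq0 t)); rewrite mulfV ?cis_neq0// -cisD subrr cis0. Qed.

Lemma cis2pi : cis (2 * pi) = 1.
Proof. by rewrite mulr_natl /cis cos2pi sin2pi. Qed.

Lemma cis_lip0 (e : R) : 0 < e -> exists2 d : R, 0 < d &
  forall t, `|t| < d -> nrm (cis t - 1) < e.
Proof.
move=> e0; have e20 : 0 < e / 2 by rewrite divr_gt0.
have /cvgrPdist_lt/(_ _ e20) := @continuous_cos R 0.
have /cvgrPdist_lt/(_ _ e20) := @continuous_sin R 0.
rewrite !near_nbhs => -/nbhs_ballP[d1/= d10 H1] /nbhs_ballP[d2/= d20 H2].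
exists (Num.min d1 d2); first by rewrite lt_min d10.
move=> t; rewrite lt_min => /andP[t1 t2].
have h1 : `|sin 0 - sin t| < e / 2 by apply: H1; rewrite /ball/= sub0r normrN.
have h2 : `|cos 0 - cos t| < e / 2 by apply: H2; rewrite /ball/= sub0r normrN.
have -> : cis t - 1 = Complex (cos t - cos 0) (sin t - sin 0).
  by rewrite sin0 cos0 subr0; apply/eqP; rewrite eq_complex/= subr0 !eqxx.
apply: (le_lt_trans (nrm_Complex _ _)).
by rewrite (splitr e) ltrD// distrC.
Qed.

Definition uroot (N : nat) : C := cis (2 * pi / N%:R).

Lemma uroot_expr N : (0 < N)%N -> uroot N ^+ N = 1.
Proof. by move=> N0; rewrite cisX mulrC divfK ?pnatr_eq0 -?lt0n// cis2pi. Qed.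

Lemma nrm_uroot N : nrm (uroot N) = 1. Proof. exact: nrm_cis. Qed.

Lemma uroot_neq0 N : uroot N != 0. Proof. exact: cis_neq0. Qed.

Lemma uroot_neq1 N k : (0 < k < N)%N -> uroot N ^+ k != 1.
Proof.
move=> /andP[k0 kN]; rewrite cisX /cis eq_complex/= negb_and; apply/orP; left.
have N0' : (0 < N)%N by exact: leq_ltn_trans kN.
have N0 : 0 < N%:R :> R by rewrite ltr0n.
have -> : k%:R * (2 * pi / N%:R) = (k%:R * pi / N%:R) *+ 2 :> R by field; rewrite gt_eqF.
rewrite cos_mulr2n cos2sin2 mulrnBl.
have : 0 < sin (k%:R * pi / N%:R) :> R.
  apply: sin_gt0_pi; rewrite divr_gt0 ?mulr_gt0 ?pi_gt0 ?ltr0n//=.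
  by rewrite ltr_pdivrMr// mulrC ltr_pM2l ?pi_gt0// ltr_nat.
move=> s0; rewrite lt_eqF//.
have : 0 < sin (k%:R * pi / N%:R) ^+ 2 :> R by rewrite exprn_gt0.
lra.
Qed.

Lemma sum_uroot N k : (0 < k < N)%N -> \sum_(j < N) (uroot N ^+ k) ^+ j = 0.
Proof.
move=> kN; have N0 : (0 < N)%N by case/andP: kN => _; exact: leq_ltn_trans.
apply/eqP; have := subrX1 (uroot N ^+ k) N; rewrite exprAC uroot_expr// expr1n subrr.
by move=> /esym/eqP; rewrite mulf_eq0 subr_eq0 (negbTE (uroot_neq1 kN)).
Qed.

(** Riemann sum for the mean of G over the circle of radius r, that is for the contour integral of
    G(w) / (2 pi i w). *)
Definition cmean G r N : C := N%:R^-1 * \sum_(j < N) G (r%:C%C * uroot N ^+ j).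

Lemma nrm_cmean G r N (M : R) : (0 < N)%N ->
  (forall j : 'I_N, nrm (G (r%:C%C * uroot N ^+ j)) <= M) -> nrm (cmean G r N) <= M.
Proof.
move=> N0 H; rewrite /cmean nrmM nrmV nrm_nat ler_pdivrMl ?ltr0n//.
apply: (le_trans (nrm_sum _ _ _)); apply: (le_trans (ler_sum _ (fun j _ => H j))).
by rewrite sumr_const card_ord mulr_natl.
Qed.

(** Polar coordinates make the closed annulus a compact rectangle. A centre within d / 2 of z0
    inherits the derivative and the error bound of z0 on discs of radius below d / 2, so compactness
    yields one radius for all centres. *)
Lemma uniform_sdiff G (r1 r2 : R) : 0 < r1 ->
  (forall w, r1 <= nrm w <= r2 -> sdiff G w) ->
  forall e : R, 0 < e -> exists2 d : R, 0 < d & forall r t, r1 <= r <= r2 ->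
    0 <= t <= 2 * pi -> exists c, forall u v, nrm (u - r%:C%C * cis t) < d ->
      nrm (v - r%:C%C * cis t) < d ->
      nrm (G u - G v - c * (u - v)) <= e * nrm (u - v).
Proof.
move=> r10 HG e e0.
have cptK := compact_setX (@segment_compact R r1 r2) (@segment_compact R 0 (2 * pi)).
pose P (d : R) (p : R * R) := exists c, forall u v, nrm (u - p.1%:C%C * cis p.2) < d ->
      nrm (v - p.1%:C%C * cis p.2) < d ->
      nrm (G u - G v - c * (u - v)) <= e * nrm (u - v).
have FF : Filter (0 : R)^'+ by typeclasses eauto.
move/compact_near_coveringP : cptK => /(_ _ (0 : R)^'+ P FF)/= H.
have {H} : \forall d \near 0^'+, `[r1, r2] `*` `[0, 2 * pi] `<=` P d.
  apply: H => -[r0 t0] [/=]; rewrite !in_itv/= => rr tt.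
  have [|c /(_ e e0)[d d0 Hd]] := HG (r0%:C%C * cis t0).
    rewrite nrmM nrm_cis nrm_real mulr1 ger0_norm//.
    by case/andP : rr => + _; apply: le_trans; exact: ltW.
  have d40 : 0 < d / 4 by rewrite divr_gt0.
  have c1 : (fun p : R * R => p.1 * cos p.2) @ (r0, t0) --> r0 * cos t0.
    apply: cvgM; first exact: cvg_fst.
    by apply: (cvg_comp _ _ (@cvg_snd _ _ _ _ _)); exact: continuous_cos.
  have c2 : (fun p : R * R => p.1 * sin p.2) @ (r0, t0) --> r0 * sin t0.
    apply: cvgM; first exact: cvg_fst.
    by apply: (cvg_comp _ _ (@cvg_snd _ _ _ _ _)); exact: continuous_sin.
  have nbp : \forall p \near ((r0, t0) : R * R),
      nrm (p.1%:C%C * cis p.2 - r0%:C%C * cis t0) < d / 2.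
    move/cvgrPdist_lt : c1 => /(_ _ d40) c1.
    move/cvgrPdist_lt : c2 => /(_ _ d40) c2.
    near=> p.
    have h1 : `|r0 * cos t0 - p.1 * cos p.2| < d / 4 by near: p; exact: c1.
    have h2 : `|r0 * sin t0 - p.1 * sin p.2| < d / 4 by near: p; exact: c2.
    have -> : p.1%:C%C * cis p.2 - r0%:C%C * cis t0 =
        Complex (p.1 * cos p.2 - r0 * cos t0) (p.1 * sin p.2 - r0 * sin t0).
      by apply/eqP; rewrite eq_complex/= !mul0r !subr0 !addr0 !eqxx.
    apply: (le_lt_trans (nrm_Complex _ _)).
    by rewrite (distrC (_ * cos _)) (distrC (_ * sin _)); lra.
  have nbd : \forall d' \near (0 : R)^'+, d' < d / 2.
    by apply: nbhs_right_lt; rewrite divr_gt0.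
  exists ([set p : R * R | nrm (p.1%:C%C * cis p.2 - r0%:C%C * cis t0) < d / 2],
          [set d' : R | d' < d / 2]) => //= -[p d'] /= [hp hd'].
  exists c => u v hu hv; apply: Hd.
    by have := nrm_tri (p.1%:C%C * cis p.2) u (r0%:C%C * cis t0); lra.
  by have := nrm_tri (p.1%:C%C * cis p.2) v (r0%:C%C * cis t0); lra.
move=> H; have H' : \forall d \near (0 : R)^'+, 0 < d by exact: nbhs_right_gt.
have /filter_ex[d [Hd d0]] := @filterI _ _ FF _ _ H H'.
exists d => // r t rr tt; apply: (Hd (r, t)); split => /=; by rewrite in_itv.
Unshelve. all: by end_near. Qed.

(** Infinitesimal Cauchy theorem. Dilating w by q and rotating it by the root of unity om change G
    by c (q - 1) w and c (om - 1) w to first order, with the same c. In (om - 1)(G(q w) - G(w)) - (q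
    - 1)(G(om w) - G(w)) the linear parts cancel, and the rotation increments telescope to 0 around
    the circle. *)
Lemma cmean_step G (r q e : R) N : (1 < N)%N -> 0 < r -> 1 <= q ->
  (forall j : 'I_N, let w := r%:C%C * uroot N ^+ j in
    exists c, nrm (G (q%:C%C * w) - G w - c * (q%:C%C * w - w)) <= e * nrm (q%:C%C * w - w)
    /\ nrm (G (uroot N * w) - G w - c * (uroot N * w - w)) <= e * nrm (uroot N * w - w)) ->
  nrm (cmean G (q * r) N - cmean G r N) <= 2 * e * (q - 1) * r.
Proof.
move=> N1 r0 q1 H; have N0 : (0 < N)%N := ltnW N1.
set om := uroot N in H *.
have om1 : om - 1 != 0 by rewrite subr_eq0 -(expr1 om) uroot_neq1.
have omp : 0 < nrm (om - 1) by rewrite nrm_gt0.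
have tele : \sum_(j < N) (G (r%:C%C * om ^+ j.+1) - G (r%:C%C * om ^+ j)) = 0.
  rewrite -(big_mkord xpredT (fun j => G (r%:C%C * om ^+ j.+1) - G (r%:C%C * om ^+ j))).
  by rewrite (telescope_sumr (fun j => G (r%:C%C * om ^+ j)))// uroot_expr// expr0 subrr.
rewrite /cmean -mulrBr nrmM nrmV nrm_nat ler_pdivrMl ?ltr0n// -sumrB.
rewrite -(ler_pM2l omp) -nrmM mulr_sumr.
have -> : \sum_(j < N) (om - 1) * (G ((q * r)%:C%C * om ^+ j) - G (r%:C%C * om ^+ j)) =
  \sum_(j < N) ((om - 1) * (G ((q * r)%:C%C * om ^+ j) - G (r%:C%C * om ^+ j))
     - (q%:C%C - 1) * (G (r%:C%C * om ^+ j.+1) - G (r%:C%C * om ^+ j))).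
  by rewrite [RHS]sumrB -[X in _ = _ - X]mulr_sumr tele mulr0 subr0.
apply: (le_trans (nrm_sum _ _ _)).
apply: (@le_trans _ _ (\sum_(j < N) nrm (om - 1) * (2 * e * (q - 1) * r))); last first.
  by rewrite sumr_const card_ord -mulr_natl le_eqVlt; apply/orP; left; apply/eqP; ring.
apply: ler_sum => j _; have [c [h1 h2]] := H j.
move: h1 h2; rewrite rmorphM/= -[q%:C%C * _ * _]mulrA exprS (mulrCA r%:C%C om).
set w := r%:C%C * om ^+ j => h1 h2.
have nw : nrm w = r by rewrite nrmM nrmX nrm_uroot expr1n mulr1 nrm_real gtr0_norm.
have n1 : nrm (q%:C%C * w - w) = (q - 1) * r.
  rewrite -{2}[w]mul1r -mulrBl nrmM nw -(rmorph1 (real_complex R)) -rmorphB/= nrm_real.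
  by rewrite ger0_norm// subr_ge0.
have n2 : nrm (om * w - w) = nrm (om - 1) * r.
  by rewrite -{2}[w]mul1r -mulrBl nrmM nw.
have nq : nrm (q%:C%C - 1) = q - 1.
  by rewrite -(rmorph1 (real_complex R)) -rmorphB/= nrm_real ger0_norm// subr_ge0.
have -> : (om - 1) * (G (q%:C%C * w) - G w) - (q%:C%C - 1) * (G (om * w) - G w) =
  (om - 1) * (G (q%:C%C * w) - G w - c * (q%:C%C * w - w))
  - (q%:C%C - 1) * (G (om * w) - G w - c * (om * w - w)) by ring.
apply: (le_trans (nrmD _ _)); rewrite nrmN !nrmM.
move: h1 h2; rewrite n1 n2 nq => h1 h2.
have a1 := ler_wpM2l (ltW omp) h1.
have q0 : 0 <= q - 1 by rewrite subr_ge0.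
have a2 := ler_wpM2l q0 h2.
by apply: (le_trans (lerD a1 a2)); rewrite le_eqVlt; apply/orP; left; apply/eqP; ring.
Qed.

(** The radius goes from r1 to r2 in N dilations by q = (r2 / r1)^(1/N). One of them costs 2 e' (q -
    1) r2, and N (q - 1) stays below K, so the total is of order e' however large N is. *)
Lemma cmean_cst G (r1 r2 : R) : 0 < r1 -> r1 <= r2 ->
  (forall w, r1 <= nrm w <= r2 -> sdiff G w) ->
  forall e : R, 0 < e -> exists N0, forall N, (N0 <= N)%N ->
    nrm (cmean G r2 N - cmean G r1 N) <= e.
Proof.
move=> r10 r12 HG e e0.
have r20 : 0 < r2 := lt_le_trans r10 r12.
pose l := ln (r2 / r1).
have l0 : 0 <= l by rewrite ln_ge0// ler_pdivlMr// mul1r.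
pose K := l * expR l.
have K0 : 0 <= K by rewrite mulr_ge0// expR_ge0.
have [e' e'E] : exists e', e' = e / (2 * r2 * (K + 1)) by eexists.
have e'0 : 0 < e' by rewrite e'E divr_gt0// !mulr_gt0// ltr_wpDl.
have [d d0 Hd] := uniform_sdiff r10 HG e'0.
have [d1 d10 Hd1] := cis_lip0 (divr_gt0 d0 r20).
(* [N1] keeps the displacement by one rotation below d, [N2] that by one dilation. *)
have [N1 HN1] : exists N1 : nat, 2 * pi / d1 < N1%:R :> R.
  by exists (Num.truncn (2 * pi / d1)).+1; exact: truncnS_gt.
have [N2 HN2] : exists N2 : nat, K * r2 / d < N2%:R :> R.
  by exists (Num.truncn (K * r2 / d)).+1; exact: truncnS_gt.
exists (maxn 2 (maxn N1 N2)) => N; rewrite !geq_max => /and3P[N2' NN1 NN2].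
have N0 : (0 < N)%N := ltnW N2'.
have NR : 0 < N%:R :> R by rewrite ltr0n.
pose q := expR (l / N%:R).
have q1 : 1 <= q by rewrite -expR0 ler_expR divr_ge0.
(* From exp(-y) >= 1 - y with y = l / N follows q - 1 <= q y, and q <= exp(l). *)
have qK : q - 1 <= K / N%:R.
  have : q * (1 - l / N%:R) <= 1.
    have := expR_ge1Dx (- (l / N%:R)); rewrite expRN -/q => h.
    by rewrite mulrC -ler_pdivlMr ?expR_gt0// mul1r.
  rewrite mulrBr mulr1 => h.
  apply: (@le_trans _ _ (q * (l / N%:R))); first lra.
  rewrite /K mulrC mulrAC ler_wpM2r ?invr_ge0// ler_wpM2l//.
  by rewrite ler_expR ler_pdivrMr// ler_peMr// ler1n.
have qN : q ^+ N * r1 = r2.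
  rewrite -expRM_natl (mulrC N%:R) divfK ?gt_eqF// lnK ?posrE ?divr_gt0//.
  by rewrite divfK// gt_eqF.
have qa a : (a <= N)%N -> r1 <= q ^+ a * r1 <= r2.
  move=> aN; apply/andP; split; first by rewrite ler_peMl ?(ltW r10)// exprn_ege1.
  by rewrite -qN ler_wpM2r ?(ltW r10)// ler_weXn2l.
have step a : (a < N)%N -> nrm (cmean G (q ^+ a.+1 * r1) N - cmean G (q ^+ a * r1) N)
    <= 2 * e' * (q - 1) * r2.
  move=> aN; rewrite exprS -mulrA.
  have /andP[ra ra'] := qa a (ltnW aN).
  have rp : 0 < q ^+ a * r1 := lt_le_trans r10 ra.
  apply: (@le_trans _ _ (2 * e' * (q - 1) * (q ^+ a * r1))); last first.
    by rewrite ler_wpM2l// !mulr_ge0 ?subr_ge0// ltW.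
  apply: cmean_step => // j w.
  have we : w = (q ^+ a * r1)%:C%C * cis (j%:R * (2 * pi / N%:R)) by rewrite /w cisX.
  have nw : nrm w = q ^+ a * r1.
    by rewrite we nrmM nrm_cis mulr1 nrm_real gtr0_norm.
  have [|c Hc] := Hd (q ^+ a * r1) (j%:R * (2 * pi / N%:R)) (qa _ (ltnW aN)).
    rewrite !mulr_ge0 ?invr_ge0 ?pi_ge0//= mulrCA ler_piMr ?mulr_ge0 ?pi_ge0//.
    by rewrite ler_pdivrMr// mul1r ler_nat ltnW.
  rewrite -we in Hc; exists c; split; apply: Hc; rewrite ?subrr ?nrm0//.
    rewrite -{2}[w]mul1r -mulrBl nrmM nw -(rmorph1 (real_complex R)) -rmorphB/= nrm_real.
    rewrite ger0_norm ?subr_ge0//.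
    apply: (@le_lt_trans _ _ (K / N%:R * r2)).
      by apply: ler_pM; rewrite ?subr_ge0// ltW.
    rewrite mulrAC ltr_pdivrMr// [d * _]mulrC -ltr_pdivrMr//; apply: (lt_le_trans HN2).
    by rewrite ler_nat.
  rewrite -{2}[w]mul1r -mulrBl nrmM nw.
  apply: (@le_lt_trans _ _ (nrm (uroot N - 1) * r2)); first by rewrite ler_wpM2l ?nrm_ge0.
  rewrite -ltr_pdivlMr//; apply: Hd1; rewrite ger0_norm ?divr_ge0 ?mulr_ge0 ?pi_ge0//.
  rewrite ltr_pdivrMr// [d1 * _]mulrC -ltr_pdivrMr//; apply: (lt_le_trans HN1).
  by rewrite ler_nat.
have tot a : (a <= N)%N -> nrm (cmean G (q ^+ a * r1) N - cmean G r1 N)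
    <= a%:R * (2 * e' * (q - 1) * r2).
  elim: a => [_|a IH aN]; first by rewrite expr0 mul1r subrr nrm0 mul0r.
  apply: (le_trans (nrm_tri (cmean G (q ^+ a * r1) N) _ _)).
  by rewrite -natr1 mulrDl mul1r addrC; apply: lerD; [exact: IH (ltnW aN)|exact: step].
have := tot N (leqnn _); rewrite qN => /le_trans; apply.
apply: (@le_trans _ _ (N%:R * (2 * e' * (K / N%:R) * r2))).
  by rewrite ler_wpM2l// ler_wpM2r ?(ltW r20)// ler_wpM2l// mulr_ge0// ltW.
have -> : N%:R * (2 * e' * (K / N%:R) * r2) = e * (K / (K + 1)).
  rewrite e'E; field; rewrite (gt_eqF NR) (gt_eqF r20)/= gt_eqF//.
  by rewrite ltr_wpDl.
by rewrite ler_piMr ?(ltW e0)// ler_pdivrMr ?ltr_wpDl// mul1r lerDl.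
Qed.

End circle_means.

(** * Holomorphic functions through difference quotients *)

Section holomorphic.
Context {R : realType}.
Local Notation C := R[i].
Implicit Types (D E : set C) (g h f : C -> C) (z w : C).

(* Besides g, its difference quotients are required to be strictly
   differentiable; unlike local power series this is visibly stable under
   products and compositions, and it removes the singularity of the Cauchy
   kernel. *)
Definition holo D g := forall z, D z -> sdiff g z /\
  exists k, (forall w, D w -> g w = g z + (w - z) * k w) /\
            (forall w, D w -> sdiff k w).

Lemma holo_sdiff D g z : holo D g -> D z -> sdiff g z.
Proof. by move=> /(_ z) + Dz => /(_ Dz)[]. Qed.

Lemma holo_cst D (c : C) : holo D (fun=> c).
Proof.
move=> z Dz; split; first exact: sdiff_cst.
by exists (fun=> 0); split => w Dw; rewrite ?mulr0 ?addr0//; exact: sdiff_cst.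
Qed.

Lemma holo_id D : holo D id.
Proof.
move=> z Dz; split; first exact: sdiff_id.
by exists (fun=> 1); split => w Dw; [rewrite mulr1 addrC subrK|exact: sdiff_cst].
Qed.

Lemma holoD D g h : holo D g -> holo D h -> holo D (g \+ h).
Proof.
move=> hg hh z Dz; have [sg [k [gk sk]]] := hg z Dz; have [sh [l [hl sl]]] := hh z Dz.
split; first exact: sdiffD.
exists (k \+ l); split => w Dw; last by apply: sdiffD; [exact: sk|exact: sl].
by rewrite /= gk// hl//; ring.
Qed.

Lemma holoM D g h : holo D g -> holo D h -> holo D (g \* h).
Proof.
move=> hg hh z Dz; have [sg [k [gk sk]]] := hg z Dz; have [sh [l [hl sl]]] := hh z Dz.
split; first exact: sdiffM.
exists ((k \* h) \+ ((fun=> g z) \* l)); split => w Dw.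
  by rewrite /= [g w]gk// [h w]hl//; ring.
apply: sdiffD; apply: sdiffM; [exact: sk|exact: holo_sdiff hh Dw|exact: sdiff_cst|exact: sl].
Qed.

Lemma holo_ext D g h : (forall w, g w = h w) -> holo D g -> holo D h.
Proof. by move=> /funext->. Qed.

Lemma holoX D g n : holo D g -> holo D (fun w => g w ^+ n).
Proof.
move=> hg; elim: n => [|n IH]; first exact: holo_cst.
by apply: (@holo_ext _ (g \* (fun w => g w ^+ n))) => [w|]; [rewrite exprS|exact: holoM].
Qed.

Lemma holoZ D (c : C) g : holo D g -> holo D (fun w => c * g w).
Proof. by move=> hg; apply: (@holoM _ (fun=> c) g) => //; exact: holo_cst. Qed.

Lemma holo_sum D I (r : seq I) (P : pred I) (F : I -> C -> C) :
  (forall i, P i -> holo D (F i)) -> holo D (fun w => \sum_(i <- r | P i) F i w).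
Proof.
move=> H; elim: r => [|i r IH].
  by apply: (@holo_ext _ (fun=> 0)) => [w|]; [rewrite big_nil|exact: holo_cst].
have [Pi|Pi] := boolP (P i).
  apply: (@holo_ext _ (F i \+ fun w => \sum_(i <- r | P i) F i w)) => [w|].
    by rewrite big_cons Pi.
  by apply: holoD => //; exact: H.
by apply: holo_ext IH => w; rewrite big_cons (negbTE Pi).
Qed.

Lemma holo_horner D (p : {poly C}) g : holo D g -> holo D (fun w => p.[g w]).
Proof.
move=> hg.
apply: (@holo_ext _ (fun w => \sum_(i < size p) p`_i * g w ^+ i)) => [w|].
  by rewrite horner_coef.
by apply: holo_sum => i _; apply: holoZ; exact: holoX.
Qed.

Lemma holo_comp D E g h : (forall w, D w -> E (h w)) ->
  holo E g -> holo D h -> holo D (g \o h).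
Proof.
move=> DE hg hh z Dz; have [sh [l [hl sl]]] := hh z Dz.
have [sg [k [gk sk]]] := hg _ (DE z Dz).
split; first exact: sdiff_comp.
exists ((k \o h) \* l); split => w Dw /=.
  by rewrite [g (h w)]gk; [rewrite {1}[h w]hl//; ring|exact: DE].
apply: sdiffM; last exact: sl.
by apply: sdiff_comp; [exact: holo_sdiff hh Dw|apply: sk; exact: DE].
Qed.

Lemma holoV D : (forall w, D w -> w != 0) -> holo D (fun w => w^-1).
Proof.
move=> D0 z Dz; have z0 := D0 z Dz; split; first exact: sdiffV.
exists (fun w => - z^-1 * w^-1); split => w Dw; have w0 := D0 w Dw.
  by field; rewrite z0 w0.
by apply: (@sdiffM _ (fun=> - z^-1)); [exact: sdiff_cst|exact: sdiffV].
Qed.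

(** The second factor is the difference quotient at z. Away from z it agrees locally with a genuine
    quotient; at z itself it is the shifted power series. *)
Lemma pseries_holo D h :
  (forall z0, D z0 -> exists (c : nat -> C) (r : R), 0 < r /\ is_pseries c h z0 r) ->
  holo D h.
Proof.
move=> H.
have sd z : D z -> sdiff h z.
  by move=> /H[c [r [r0 hc]]]; exists (c 1%N); exact: pseries_sdiff_with hc.
move=> z Dz; split; first exact: sd.
have [c [r [r0 hc]]] := H z Dz.
exists (diffquot h z (c 1%N)); split => w Dw.
  rewrite /diffquot; case: eqVneq => [->|wz]; first by rewrite subrr mul0r addr0.
  by field; rewrite subr_eq0.
have [->|wz] := eqVneq w z.
  exists (c 2%N); exact: pseries_sdiff_with (pseries_diffquot r0 hc).
apply: (@sdiff_near _ _ (fun u => (h u + - h z) * (u + - z)^-1) _ (nrm (w - z))).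
- by rewrite nrm_gt0 subr_eq0.
- move=> u uw; rewrite /diffquot; case: eqVneq => // uz.
  by move: uw; rewrite uz nrmB ltxx.
apply: (@sdiffM _ (fun u => h u + - h z) (fun u => (u + - z)^-1)).
  by apply: (@sdiffD _ h (fun=> - h z)); [exact: sd|exact: sdiff_cst].
apply: (@sdiff_comp _ (fun u => u^-1) (fun u => u + - z)).
  by apply: (@sdiffD _ id (fun=> - z)); [exact: sdiff_id|exact: sdiff_cst].
by apply: sdiffV; rewrite subr_eq0.
Qed.

Definition annulus (rho : R) : set C := [set z | rho^-1 < nrm z < rho].

Lemma annulus_neq0 rho z : 1 < rho -> annulus rho z -> z != 0.
Proof.
move=> r1 /andP[+ _]; rewrite -nrm_gt0; apply: lt_trans.
by rewrite invr_gt0 (lt_trans _ r1).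
Qed.

Lemma annulusV rho z : 1 < rho -> annulus rho z -> annulus rho z^-1.
Proof.
move=> r1 az; have z0 : 0 < nrm z by rewrite nrm_gt0 (annulus_neq0 r1).
have r0 : 0 < rho := lt_trans ltr01 r1.
move: az => /andP[h1 h2]; rewrite /annulus/= nrmV ltf_pV2 ?posrE// h2/=.
by rewrite -[ltRHS]invrK ltf_pV2 ?posrE ?invr_gt0.
Qed.

End holomorphic.

Lemma expr_small {R : realType} (s e : R) : 0 <= s < 1 -> 0 < e ->
  exists N0, forall N, (N0 <= N)%N -> s ^+ N <= e.
Proof.
move=> /andP[s0 s1] e0.
have /cvgrPdist_lt/(_ _ e0)[N0 _ H] : (s ^+ n @[n --> \oo] --> 0).
  by apply: cvg_expr; rewrite ger0_norm.
exists N0 => N /H/=; rewrite sub0r normrN ger0_norm ?exprn_ge0//.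
exact: ltW.
Qed.

Lemma sumr_geo_le {R : realType} (s : R) n : 0 <= s < 1 ->
  \sum_(i < n) s ^+ i <= (1 - s)^-1.
Proof.
move=> /andP[s0 s1]; rewrite -[leRHS]mul1r ler_pdivlMr ?subr_gt0//.
by rewrite mulrC -[1 - s]opprB mulNr -subrX1 opprB gerBl exprn_ge0.
Qed.

(** * Discrete Laurent expansion of a function invariant under inversion *)

Section laurent.
Context {R : realType}.
Local Notation C := R[i].
Variables (rho V : R) (g : C -> C).
Hypothesis rho1 : 1 < rho.
Hypothesis hg : holo (annulus rho) g.
Hypothesis gV : forall w, annulus rho w -> g w^-1 = g w.
Hypothesis gle : forall w, annulus rho w -> nrm (g w) <= V.
Variables (S : R) (z : C).
Hypothesis (Srho : S < rho) (z1 : 1 <= nrm z) (zS : nrm z < S).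

Let S1 : 1 < S := le_lt_trans z1 zS.
Let S0 : 0 < S := lt_trans ltr01 S1.
Let rho0 : 0 < rho := lt_trans ltr01 rho1.
Let z0 : z != 0. Proof. by rewrite -nrm_gt0 (lt_le_trans ltr01). Qed.

Let pt N j : C := S%:C%C * uroot N ^+ j.

(** Discretised Laurent coefficient on the circle of radius S. Since g is invariant under inversion,
    z^k and z^(-k) have the same coefficient, so the outer circle serves both halves of the
    series. *)
Definition laurent_coef N k : C := cmean (fun w => g w * w ^- k) S N.

Let nrm_pt N j : nrm (pt N j) = S.
Proof. by rewrite nrmM nrmX nrm_uroot expr1n mulr1 nrm_real gtr0_norm. Qed.

Let pt_neq0 N j : pt N j != 0.
Proof. by rewrite -nrm_gt0 nrm_pt. Qed.

Let pt_annulus N j : annulus rho (pt N j).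
Proof.
by rewrite /annulus/= nrm_pt Srho andbT (lt_trans _ S1)// invf_lt1.
Qed.

Let V0 : 0 <= V.
Proof. exact: le_trans (nrm_ge0 _) (gle (pt_annulus 0 0)). Qed.

Let z_annulus : annulus rho z.
Proof.
rewrite /annulus/= (lt_trans zS Srho) andbT (lt_le_trans _ z1)//.
by rewrite invf_lt1.
Qed.

Lemma nrm_laurent_coef N k : (0 < N)%N -> nrm (laurent_coef N k) <= V / S ^+ k.
Proof.
move=> N0; apply: nrm_cmean => // j; rewrite nrmM nrmV nrmX nrm_pt.
by rewrite ler_wpM2r ?invr_ge0 ?exprn_ge0 ?(ltW S0)// gle//; exact: pt_annulus.
Qed.

(** Inversion permutes the N-th roots of unity. This turns sums over the circle of radius 1 / S into
    sums over the points [pt]. *)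
Lemma sum_uroot_inv N (F : C -> C) : (0 < N)%N ->
  \sum_(j < N) F (uroot N ^+ j) = \sum_(j < N) F (uroot N ^- j).
Proof.
move=> N0; rewrite (reindex_inj rev_ord_inj)/=.
have e (j : 'I_N) : uroot N ^+ (N - j.+1) = uroot N ^- j.+1 :> C.
  apply: (mulIf (expf_neq0 j.+1 (uroot_neq0 N))).
  by rewrite -exprD subnK// uroot_expr// mulVf// expf_neq0// uroot_neq0.
under eq_bigr do rewrite e.
case: N N0 e => // N _ e; rewrite big_ord_recr [RHS]big_ord_recl/= addrC.
by congr (F _ + _); rewrite uroot_expr// expr0.
Qed.

Lemma sum_ptX N k : (0 < k < N)%N -> \sum_(j < N) pt N j ^- k = 0.
Proof.
move=> kN; have N0 : (0 < N)%N by case/andP: kN => _; exact: leq_ltn_trans.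
have := sum_uroot_inv (fun x => (S%:C%C * x^-1) ^- k) N0; rewrite /= => h.
have -> : \sum_(j < N) pt N j ^- k = \sum_(j < N) (S%:C%C * (uroot N ^+ j)^-1) ^- k.
  by rewrite h; apply: eq_bigr => j _; rewrite invrK.
transitivity (S%:C%C ^- k * \sum_(j < N) (uroot N ^+ k) ^+ j); last first.
  by rewrite sum_uroot ?mulr0.
rewrite mulr_sumr; apply: eq_bigr => j _.
by rewrite exprMn invfM exprVn invrK -!exprM mulnC.
Qed.

Let avg N (F : C -> C) : C := N%:R^-1 * \sum_(j < N) F (pt N j).

Let avg_sum N n (F : nat -> C -> C) :
  avg N (fun w => \sum_(k < n) F k w) = \sum_(k < n) avg N (F k).
Proof. by rewrite /avg exchange_big/= mulr_sumr. Qed.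

Let avg_ext N F H : (forall j : 'I_N, F (pt N j) = H (pt N j)) -> avg N F = avg N H.
Proof. by move=> FH; rewrite /avg; congr (_ * _); apply: eq_bigr => j _; exact: FH. Qed.

Let avgZ N c F : avg N (fun w => c * F w) = c * avg N F.
Proof. by rewrite /avg -mulr_sumr mulrCA. Qed.

Let avg1 N : (0 < N)%N -> avg N (fun=> 1) = 1.
Proof. by move=> N0; rewrite /avg sumr_const card_ord mulVf// pnatr_eq0 -lt0n. Qed.

Let ptX N j : (0 < N)%N -> pt N j ^+ N = S%:C%C ^+ N.
Proof.
by move=> N0; rewrite exprMn -exprM mulnC exprM uroot_expr// expr1n mulr1.
Qed.

Definition laurent_sum N : C :=
  laurent_coef N 0 + \sum_(k < N.-1) laurent_coef N k.+1 * (z ^+ k.+1 + z ^- k.+1).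

Let s := nrm z / S.
Let s01 : 0 <= s < 1.
Proof. by rewrite divr_ge0 ?nrm_ge0 ?(ltW S0)//= ltr_pdivrMr// mul1r. Qed.

Let Pp N := \sum_(k < N) laurent_coef N k * z ^+ k.
Let Pm N := \sum_(k < N) laurent_coef N k.+1 * z ^- k.+1.

Let laurent_sumE N : (0 < N)%N ->
  laurent_sum N = Pp N + Pm N - laurent_coef N N * z ^- N.
Proof.
case: N => // N _; rewrite /laurent_sum /Pp /Pm big_ord_recl big_ord_recr/=.
rewrite expr0 mulr1 -!addrA; congr (_ + _).
rewrite addrA [in RHS]addrA addrK -big_split/=.
by apply: eq_bigr => k _; rewrite mulrDr.
Qed.

Let Pp_le N : (0 < N)%N -> nrm (Pp N) <= V * (1 - s)^-1.
Proof.
move=> N0; apply: (le_trans (nrm_sum _ _ _)).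
apply: (@le_trans _ _ (\sum_(k < N) V * s ^+ k)); last first.
  by rewrite -mulr_sumr ler_wpM2l// sumr_geo_le.
apply: ler_sum => k _; rewrite nrmM nrmX expr_div_n.
rewrite [leRHS](_ : _ = V / S ^+ k * nrm z ^+ k); last by ring.
by rewrite ler_wpM2r ?exprn_ge0 ?nrm_ge0// nrm_laurent_coef.
Qed.

Let zV_le k : nrm z ^- k <= nrm z ^+ k.
Proof.
by apply: (@le_trans _ _ 1); rewrite ?exprn_ege1// invf_le1 ?exprn_gt0 ?exprn_ege1// (lt_le_trans ltr01).
Qed.

Let Pm_le N : (0 < N)%N -> nrm (Pm N) <= V * (1 - s)^-1.
Proof.
move=> N0; apply: (le_trans (nrm_sum _ _ _)).
apply: (@le_trans _ _ (\sum_(k < N) V * s ^+ k)); last first.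
  by rewrite -mulr_sumr ler_wpM2l// sumr_geo_le.
apply: ler_sum => k _; rewrite nrmM nrmV nrmX.
apply: (@le_trans _ _ (V / S ^+ k.+1 * nrm z ^+ k.+1)).
  by apply: ler_pM; rewrite ?invr_ge0 ?exprn_ge0 ?nrm_ge0// nrm_laurent_coef.
rewrite mulrAC -mulrA -expr_div_n ler_wpM2l// -/s.
by case/andP: s01 => a b; rewrite exprS ler_piMl ?exprn_ge0// ltW.
Qed.

Let eta N := (z / S%:C%C) ^+ N.
Let eta' N := (z * S%:C%C) ^- N.

Let nS : nrm S%:C%C = S. Proof. by rewrite nrm_real gtr0_norm. Qed.

Let eta_le N : nrm (eta N) = s ^+ N.
Proof. by rewrite nrmX nrmM nrmV nS. Qed.

Let eta'_le N : nrm (eta' N) <= s ^+ N.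
Proof.
rewrite nrmV nrmX nrmM nS exprMn invfM /s expr_div_n.
by rewrite ler_wpM2r ?zV_le// invr_ge0 exprn_ge0// ltW.
Qed.

Let SN0 : S%:C%C != 0 :> C. Proof. by rewrite -nrm_gt0 nS. Qed.

Let eta_neq1 N : (0 < N)%N -> 1 - eta N != 0.
Proof.
move=> N0; rewrite subr_eq0 eq_sym; apply/eqP => /(congr1 nrm); rewrite eta_le nrm1.
by case/andP: s01 => a b /eqP; rewrite lt_eqF// exprn_ilt1// -lt0n.
Qed.

Let eta'_neq1 N : (0 < N)%N -> 1 - eta' N != 0.
Proof.
move=> N0; rewrite subr_eq0 eq_sym; apply/eqP => /(congr1 nrm); rewrite nrm1.
apply/eqP; rewrite lt_eqF// (le_lt_trans (eta'_le N))//.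
by case/andP: s01 => a b; rewrite exprn_ilt1// -lt0n.
Qed.

(** Here w K(w) = (g(w) - g(z)) / (1 - z / w). All N points satisfy w^N = S^N, so the geometric sum
    of N powers of z / w inverts 1 - z / w up to the constant 1 - eta, without truncation error. In
    the part multiplied by g(z) only the power 0 has a nonzero mean. *)
Let outer N (K : C -> C) : (0 < N)%N ->
  (forall w, annulus rho w -> g w = g z + (w - z) * K w) ->
  cmean (fun w => w * K w) S N = (Pp N - g z) / (1 - eta N).
Proof.
move=> N0 hK.
have eK j : pt N j * K (pt N j) =
    (g (pt N j) - g z) * (\sum_(k < N) z ^+ k * pt N j ^- k) / (1 - eta N).
  have w0 := pt_neq0 N j; rewrite [g (pt N j)](hK _ (pt_annulus N j)).
  set w := pt N j in w0 *.
  have -> : \sum_(k < N) z ^+ k * w ^- k = \sum_(k < N) (z / w) ^+ k.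
    by apply: eq_bigr => k _; rewrite expr_div_n.
  apply: (mulIf (eta_neq1 N0)); rewrite divfK ?eta_neq1//.
  have -> : 1 - eta N = (1 - z / w) * \sum_(k < N) (z / w) ^+ k.
    rewrite -[1 - z / w]opprB mulNr -subrX1 opprB; congr (_ - _).
    by rewrite /eta !expr_div_n /w ptX.
  set T := \sum_(k < N) _; field; exact: w0.
rewrite -[LHS]/(avg N (fun w => w * K w)) (avg_ext (H := fun w => (1 - eta N)^-1 *
   (\sum_(k < N) (z ^+ k * (g w * w ^- k) + (- g z) * (z ^+ k * w ^- k))))); last first.
  move=> j; rewrite eK mulrC; congr (_ * _); rewrite mulr_sumr.
  by apply: eq_bigr => k _; ring.
rewrite avgZ mulrC; congr (_ / _).
rewrite (avg_sum _ _ (fun k w => z ^+ k * (g w * w ^- k) + (- g z) * (z ^+ k * w ^- k))) /avg.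
under eq_bigr => k _ do rewrite big_split/= mulrDr -!mulr_sumr.
rewrite big_split/=; congr (_ + _).
  by apply: eq_bigr => k _; rewrite /laurent_coef /cmean mulrCA mulrC.
rewrite -{2}[- g z]mulr1; case: N N0 {eK} => // N _.
rewrite big_ord_recl [X in _ + X]big1 => [|k _]; last first.
  by rewrite lift0 sum_ptX ?(mulr0, ltnS)// ltn_ord.
rewrite addr0 expr0 mul1r mulrCA; congr (_ * _).
under eq_bigr do rewrite expr0 invr1.
exact: avg1.
Qed.

(** The same on the circle of radius 1 / S, with powers of 1 / (z w) from 1 to N. Now only the power
    N has a nonzero mean, whence the term g(z) eta'. *)
Let inner N (K : C -> C) : (0 < N)%N ->
  (forall w, annulus rho w -> g w = g z + (w - z) * K w) ->
  cmean (fun w => w * K w) S^-1 N = - (Pm N - g z * eta' N) / (1 - eta' N).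
Proof.
move=> N0 hK.
have eK j : (pt N j)^-1 * K (pt N j)^-1 =
    - (g (pt N j) - g z) * (\sum_(k < N) z ^- k.+1 * pt N j ^- k.+1) / (1 - eta' N).
  have w0 := pt_neq0 N j.
  rewrite -[g (pt N j)](gV (pt_annulus N j)).
  rewrite [g _^-1](hK _ (annulusV rho1 (pt_annulus N j))).
  set w := pt N j in w0 *.
  have -> : \sum_(k < N) z ^- k.+1 * w ^- k.+1 = (z * w)^-1 * \sum_(k < N) (z * w)^-1 ^+ k.
    rewrite mulr_sumr; apply: eq_bigr => k _.
    by rewrite -(exprS (z * w)^-1) exprVn -invfM -exprMn.
  apply: (mulIf (eta'_neq1 N0)); rewrite divfK ?eta'_neq1//.
  have -> : 1 - eta' N = (1 - (z * w)^-1) * \sum_(k < N) (z * w)^-1 ^+ k.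
    rewrite -[1 - (z * w)^-1]opprB mulNr -subrX1 opprB; congr (_ - _).
    by rewrite exprVn /eta' [(z * w) ^+ N]exprMn /w ptX// -exprMn.
  set T := \sum_(k < N) _; field; by rewrite w0 z0.
have -> : cmean (fun w => w * K w) S^-1 N = avg N (fun w => w^-1 * K w^-1).
  rewrite /cmean /avg; congr (_ * _).
  rewrite (sum_uroot_inv (fun x => S^-1%:C%C * x * K (S^-1%:C%C * x)))//.
  by apply: eq_bigr => j _; rewrite /pt invfM fmorphV.
rewrite (avg_ext (H := fun w => - (1 - eta' N)^-1 *
   (\sum_(k < N) (z ^- k.+1 * (g w * w ^- k.+1) + (- g z) * (z ^- k.+1 * w ^- k.+1))))); last first.
  move=> j; rewrite eK; set A := \sum_(k < N) _; set B := \sum_(k < N) _.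
  have -> : B = (g (pt N j) - g z) * A.
    by rewrite mulr_sumr; apply: eq_bigr => k _; ring.
  by ring.
rewrite avgZ mulrC mulrN mulNr; congr (- (_ / _)).
rewrite (avg_sum _ _ (fun k w => z ^- k.+1 * (g w * w ^- k.+1) + (- g z) * (z ^- k.+1 * w ^- k.+1))) /avg.
under eq_bigr => k _ do rewrite big_split/= mulrDr -!mulr_sumr.
rewrite big_split/=; congr (_ + _).
  by apply: eq_bigr => k _; rewrite /laurent_coef /cmean mulrCA mulrC.
rewrite -mulNr; case: N N0 {eK} => // N N0.
rewrite big_ord_recr/= [X in X + _]big1 => [|k _]; last first.
  by rewrite sum_ptX ?(mulr0, ltnS)// ltn_ord.
rewrite add0r mulrCA; congr (_ * _).
under eq_bigr do rewrite ptX//.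
rewrite sumr_const card_ord -[_ *+ _]mulr_natr /eta' exprMn invfM.
by field; rewrite expf_neq0// expf_neq0//= pnatr_eq0.
Qed.

(** The function w K(w) has no singularity at z, so by [cmean_cst] its means over the circles of
    radii S and 1 / S differ by arbitrarily little. By [outer] and [inner] that difference is Pp +
    Pm - g(z) up to terms of order s^N. *)
Lemma laurent_cvg (e : R) : 0 < e -> exists N0, forall N, (N0 <= N)%N ->
  nrm (laurent_sum N - g z) <= e.
Proof.
move=> e0; have [sgz [K [hK sK]]] := hg z_annulus.
have e20 : 0 < e / 2 by rewrite divr_gt0.
pose B := V * (1 - s)^-1.
have B0 : 0 <= B.
  by rewrite mulr_ge0// invr_ge0 subr_ge0; case/andP: s01 => _ /ltW.
(* The corrections estimated below in [t1], [t2], [t3] and [hc] are at most 2 (B + V), 2 B, 2 V and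
   V times s^N. *)
have M0 : 0 < 4 * B + 5 * V + 1 by rewrite ltr_wpDl// addr_ge0// mulr_ge0.
have [N1 HN1] : exists N0, forall N, (N0 <= N)%N ->
    nrm (cmean (fun w => w * K w) S N - cmean (fun w => w * K w) S^-1 N) <= e / 2.
  apply: cmean_cst => //; first by rewrite invr_gt0.
    by apply: (@le_trans _ _ 1); rewrite ?(ltW S1)// invf_le1// ltW.
  move=> w /andP[w1 w2]; apply: (@sdiffM _ id K); first exact: sdiff_id.
  apply: sK; rewrite /annulus/= (le_lt_trans w2)// andbT (lt_le_trans _ w1)//.
  by rewrite ltf_pV2 ?posrE.
have [N2 HN2] := expr_small s01 (divr_gt0 e20 M0).
(* Once s^N <= 1 / 2, the inverses of 1 - eta and 1 - eta' have modulus at most 2. *)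
have [N3 HN3] := expr_small s01 (@divr_gt0 R 1 2 ltr01 (ltr0Sn _ _)).
exists (maxn 1 (maxn N1 (maxn N2 N3))) => N; rewrite !geq_max => /and4P[N0 h1 h2 h3].
have := HN1 N h1; rewrite outer// inner// => hD.
have hs := HN2 N h2; have hs' := HN3 N h3.
have hsM : s ^+ N * (4 * B + 5 * V) <= e / 2.
  move: hs; rewrite ler_pdivlMr// => hs; apply: (le_trans _ hs).
  by rewrite ler_wpM2l// ?lerDl// exprn_ge0//; case/andP: s01.
have hp := Pp_le N0; have hm := Pm_le N0; rewrite -/B in hp hm.
have hc : nrm (laurent_coef N N * z ^- N) <= V * s ^+ N.
  rewrite nrmM nrmV nrmX /s expr_div_n.
  rewrite [leRHS](_ : _ = V / S ^+ N * nrm z ^+ N); last by ring.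
  by apply: ler_pM; rewrite ?invr_ge0 ?exprn_ge0 ?nrm_ge0// nrm_laurent_coef.
have inv2 (y : C) : nrm y <= s ^+ N -> 1 - y != 0 -> nrm (1 - y)^-1 <= 2.
  move=> yh y1; rewrite nrmV -[leRHS]invrK lef_pV2 ?posrE ?nrm_gt0//.
  by have := nrm_subr 1 y; rewrite nrm1; lra.
have el : nrm (eta N) <= s ^+ N by rewrite eta_le.
have ha := inv2 _ el (eta_neq1 N0); have hb := inv2 _ (eta'_le N) (eta'_neq1 N0).
rewrite laurent_sumE//.
set D := (X in nrm X <= e / 2) in hD.
set sN := s ^+ N in hs hs' hsM hc inv2 *.
set a := (1 - eta N)^-1 in ha; set b := (1 - eta' N)^-1 in hb.
have -> : Pp N + Pm N - laurent_coef N N * z ^- N - g z =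
  D - eta N * a * (Pp N - g z) - eta' N * b * Pm N + b * g z * eta' N
  - laurent_coef N N * z ^- N.
  rewrite /D -/a -/b /a /b; move: (eta_neq1 N0) (eta'_neq1 N0).
  by move: (eta N) (eta' N) (laurent_coef N N * z ^- N) => x y c x1 y1; field; rewrite x1 y1.
have gz := gle z_annulus.
have nn0 : 0 <= sN by rewrite exprn_ge0//; case/andP: s01.
have t1 : nrm (eta N * a * (Pp N - g z)) <= sN * 2 * (B + V).
  rewrite !nrmM; apply: ler_pM; rewrite ?mulr_ge0 ?nrm_ge0//.
    by apply: ler_pM; rewrite ?nrm_ge0// eta_le.
  by apply: (le_trans (nrmD _ _)); rewrite nrmN lerD.
have t2 : nrm (eta' N * b * Pm N) <= sN * 2 * B.
  rewrite !nrmM; apply: ler_pM; rewrite ?mulr_ge0 ?nrm_ge0//.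
  by apply: ler_pM; rewrite ?nrm_ge0// eta'_le.
have t3 : nrm (b * g z * eta' N) <= 2 * V * sN.
  rewrite !nrmM; apply: ler_pM; rewrite ?mulr_ge0 ?nrm_ge0//.
    by apply: ler_pM; rewrite ?nrm_ge0.
apply: (le_trans (nrmD _ _)); rewrite nrmN.
have := nrmD (D - eta N * a * (Pp N - g z) - eta' N * b * Pm N) (b * g z * eta' N).
have := nrmD (D - eta N * a * (Pp N - g z)) (- (eta' N * b * Pm N)).
have := nrmD D (- (eta N * a * (Pp N - g z))).
by rewrite !nrmN; move: hsM t1 t2 t3 hc hD; lra.
Qed.

End laurent.

(** * Chebyshev interpolation of analytic functions *)

Section complex_limits.
Context {R : realType}.
Local Notation C := R[i].
Implicit Types (u v : nat -> C) (l : C).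

Definition ctends u l := forall e : R, 0 < e ->
  exists N0, forall N, (N0 <= N)%N -> nrm (u N - l) <= e.

Lemma ctends_cst l : ctends (fun=> l) l.
Proof. by move=> e e0; exists 0%N => N _; rewrite subrr nrm0 ltW. Qed.

Lemma ctendsD u v l l' : ctends u l -> ctends v l' -> ctends (fun N => u N + v N) (l + l').
Proof.
move=> hu hv e e0; have e20 : 0 < e / 2 by rewrite divr_gt0.
have [N1 H1] := hu _ e20; have [N2 H2] := hv _ e20.
exists (maxn N1 N2) => N; rewrite geq_max => /andP[/H1 h1 /H2 h2].
rewrite (_ : _ - _ = (u N - l) + (v N - l')); last by ring.
by apply: (le_trans (nrmD _ _)); lra.
Qed.

Lemma ctendsZ u l c : ctends u l -> ctends (fun N => u N * c) (l * c).
Proof.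
move=> hu e e0; have c0 : 0 < nrm c + 1 by rewrite ltr_wpDl ?nrm_ge0.
have [N0 H] := hu _ (divr_gt0 e0 c0); exists N0 => N /H h.
rewrite -mulrBl nrmM; apply: (@le_trans _ _ (e / (nrm c + 1) * (nrm c + 1))).
  by apply: ler_pM; rewrite ?nrm_ge0// lerDl.
by rewrite divfK// gt_eqF.
Qed.

Lemma ctends_sum I (r : seq I) (P : pred I) (F : I -> nat -> C) (L : I -> C) :
  (forall i, P i -> ctends (F i) (L i)) ->
  ctends (fun N => \sum_(i <- r | P i) F i N) (\sum_(i <- r | P i) L i).
Proof.
move=> H; elim: r => [|i r IH].
  rewrite big_nil (_ : (fun N => _) = fun=> 0); first exact: ctends_cst.
  by apply/funext => N; rewrite big_nil.
rewrite big_cons; have [Pi|Pi] := boolP (P i).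
  rewrite (_ : (fun N => _) = fun N => F i N + \sum_(i <- r | P i) F i N).
    by apply: ctendsD => //; exact: H.
  by apply/funext => N; rewrite big_cons Pi.
rewrite (_ : (fun N => _) = fun N => \sum_(i <- r | P i) F i N)//.
by apply/funext => N; rewrite big_cons (negbTE Pi).
Qed.

Lemma ctends_le u l (M : R) N1 : ctends u l ->
  (forall N, (N1 <= N)%N -> nrm (u N) <= M) -> nrm l <= M.
Proof.
move=> hu uM; apply/ler_addgt0Pr => e e0; have [N0 H] := hu e e0.
have h1 := H _ (leq_maxl N0 N1); have h2 := uM _ (leq_maxr N0 N1).
have := nrmD (u (maxn N0 N1)) (l - u (maxn N0 N1)); rewrite addrC subrK nrmB.
lra.
Qed.

End complex_limits.

(** * Chebyshev polynomials and aliasing on the nodes *)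

Section chebyshev_polynomials.
Context {R : realType}.
Local Notation C := R[i].
Implicit Types (z w : C) (p : {poly R}) (A B v t : R).

Fixpoint chebT n : {poly R} :=
  if n is n'.+1 then if n' is n''.+1 then 2%:R *: 'X * chebT n' - chebT n'' else 'X
  else 1.

Definition evalC p z : C := (map_poly (real_complex R) p).[z].

Lemma evalCD p q z : evalC (p + q) z = evalC p z + evalC q z.
Proof. by rewrite /evalC rmorphD hornerD. Qed.

Lemma evalCN p z : evalC (- p) z = - evalC p z.
Proof. by rewrite /evalC rmorphN hornerN. Qed.

Lemma evalCM p q z : evalC (p * q) z = evalC p z * evalC q z.
Proof. by rewrite /evalC rmorphM hornerM. Qed.

Lemma evalCZ c p z : evalC (c *: p) z = c%:C%C * evalC p z.
Proof. by rewrite /evalC map_polyZ hornerZ. Qed.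

Lemma evalCX z : evalC 'X z = z.
Proof. by rewrite /evalC map_polyX hornerX. Qed.

Lemma evalC1 z : evalC 1 z = 1.
Proof. by rewrite /evalC rmorph1 hornerC. Qed.

Lemma evalC_sum I (r : seq I) (P : pred I) (F : I -> {poly R}) z :
  evalC (\sum_(i <- r | P i) F i) z = \sum_(i <- r | P i) evalC (F i) z.
Proof. by rewrite /evalC rmorph_sum horner_sum. Qed.

Lemma evalC_real p v : evalC p v%:C%C = (p.[v])%:C%C.
Proof. by rewrite /evalC horner_map. Qed.

Definition joukowski z : C := (z + z^-1) / 2.

Lemma chebT_joukowski n z : z != 0 ->
  evalC (chebT n) (joukowski z) = (z ^+ n + z ^- n) / 2.
Proof.
move=> z0.
have t0 : (2 : C) != 0 by rewrite pnatr_eq0.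
suff : evalC (chebT n) (joukowski z) = (z ^+ n + z ^- n) / 2 /\
  evalC (chebT n.+1) (joukowski z) = (z ^+ n.+1 + z ^- n.+1) / 2 by case.
elim: n => [|n [IH1 IH2]].
  rewrite /= evalC1 evalCX expr0 expr1; split => //.
  by rewrite invr1 -[1 + 1]/(2%:R) divff.
split; first exact: IH2.
rewrite -[chebT n.+2]/(2%:R *: 'X * chebT n.+1 - chebT n) evalCD evalCN evalCM.
rewrite evalCZ evalCX IH1 IH2 /joukowski !exprS rmorph_nat.
have zn : z ^+ n != 0 by rewrite expf_neq0.
by field; rewrite zn z0.
Qed.

Lemma size_chebT n : (size (chebT n) <= n.+1)%N.
Proof.
suff : (size (chebT n) <= n.+1)%N /\ (size (chebT n.+1) <= n.+2)%N by case.
elim: n => [|n [IH1 IH2]]; first by rewrite /= size_poly1 size_polyX.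
split => //; rewrite -[chebT n.+2]/(2%:R *: 'X * chebT n.+1 - chebT n).
apply: (leq_trans (size_polyD _ _)); rewrite geq_max size_polyN; apply/andP; split; last first.
  by apply: (leq_trans IH1); rewrite -addn2 leq_addr.
rewrite -scalerAl; apply: (leq_trans (size_scale_leq _ _)).
by apply: (leq_trans (size_polyMleq _ _)); rewrite size_polyX ltnS.
Qed.

(** The Chebyshev polynomial T_n transported to the segment of midpoint A and half-length B. *)
Definition affT A B n : {poly R} := chebT n \Po (B^-1 *: ('X - A%:P)).

Lemma size_affT A B n : B != 0 -> (size (affT A B n) <= n.+1)%N.
Proof.
move=> B0; rewrite /affT size_comp_poly2 ?size_chebT//.
by rewrite size_scale ?invr_eq0// size_XsubC.
Qed.

Lemma affT_joukowski A B n z : B != 0 -> z != 0 ->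
  evalC (affT A B n) (A%:C%C + B%:C%C * joukowski z) = (z ^+ n + z ^- n) / 2.
Proof.
move=> B0 z0; rewrite /evalC map_comp_poly horner_comp -/(evalC (chebT n) _).
rewrite -chebT_joukowski//; congr (evalC _ _).
rewrite -[LHS]/(evalC _ _) evalCZ evalCD evalCN evalCX.
rewrite -[evalC A%:P _]/((map_poly _ _).[_]) map_polyC/= hornerC.
rewrite addrAC subrr add0r mulrA -rmorphM mulVf// rmorph1 mul1r//.
Qed.

Lemma joukowski_cis t : joukowski (cis t) = (cos t)%:C%C.
Proof.
rewrite /joukowski cis_inv -[cos t](mulfK (_ : 2 != 0 :> R)) ?pnatr_eq0//.
rewrite rmorphM fmorphV/= rmorph_nat; congr (_ / _).
by apply/eqP; rewrite eq_complex/= cosN sinN mulr_natr mulr2n subrr !eqxx.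
Qed.

Lemma affT_cos A B n t : B != 0 -> (affT A B n).[A + B * cos t] = cos (n%:R * t).
Proof.
move=> B0; apply: complexI; rewrite -evalC_real.
have := affT_joukowski A n B0 (cis_neq0 t); rewrite joukowski_cis.
rewrite -rmorphM -rmorphD/= => ->; rewrite cisX cis_inv -joukowski_cis /joukowski.
by rewrite cis_inv.
Qed.

Lemma cheb_pointE a b d j : cheb_point a b d j =
  (a + b) / 2 + (b - a) / 2 * cos (j%:R * (pi / d%:R)) :> R.
Proof. by rewrite /cheb_point mulrA. Qed.

Lemma cheb_interp_id (a b : R) d p : a < b -> (0 < d)%N -> (size p <= d.+1)%N ->
  cheb_interp a b d (fun v => p.[v]) = p.
Proof.
move=> ab d0 sp; apply/eqP; rewrite -subr_eq0; apply/eqP.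
apply: (@roots_geq_poly_eq0 _ _ [seq cheb_point a b d j | j <- iota 0 d.+1]).
- apply/allP => x /mapP[j]; rewrite mem_iota add0n ltnS => /andP[_ jd] ->.
  by rewrite /root hornerD hornerN cheb_interpE// subrr.
- rewrite map_inj_in_uniq ?iota_uniq// => j l; rewrite !mem_iota !add0n !ltnS.
  by move=> /andP[_ jd] /andP[_ ld]; apply: (cheb_point_inj ab d0); rewrite inE.
- rewrite size_map size_iota (leq_trans (size_polyD _ _))// geq_max size_polyN sp andbT.
  exact: size_cheb_interp.
Qed.

Lemma eq_cheb_interp (a b : R) d f g :
  (forall j : 'I_d.+1, f (cheb_point a b d j) = g (cheb_point a b d j)) ->
  cheb_interp a b d f = cheb_interp a b d g.
Proof. by move=> fg; apply: eq_bigr => j _; rewrite fg. Qed.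

(* On the d + 1 nodes, T_k coincides with T_(alias d k). *)
Definition alias d k := let r := (k %% d.*2)%N in if (r <= d)%N then r else (d.*2 - r)%N.

Lemma alias_le d k : (0 < d)%N -> (alias d k <= d)%N.
Proof.
move=> d0; rewrite /alias; move: (k %% _)%N => r /=; case: ifPn => //.
rewrite -ltnNge => dr; by rewrite leq_subLR -addnn leq_add2r ltnW.
Qed.

Lemma alias_id d k : (0 < d)%N -> (k <= d)%N -> alias d k = k.
Proof.
move=> d0 kd; rewrite /alias modn_small ?kd// -addnn.
by rewrite (leq_ltn_trans kd)// -[ltnLHS]addn0 ltn_add2l.
Qed.

(** Shifting k by 2 d adds a multiple of 2 pi to the angle, and 2 d - k gives the opposite angle
    modulo 2 pi. *)
Lemma cos_alias d k j : (0 < d)%N ->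
  cos (k%:R * (j%:R * (pi / d%:R))) = cos ((alias d k)%:R * (j%:R * (pi / d%:R))) :> R.
Proof.
move=> d0; have dn : d%:R != 0 :> R by rewrite pnatr_eq0 -lt0n.
have e2 : (d.*2%:R : R) = d%:R * 2 by rewrite -muln2 natrM.
have kE : k%:R = (k %/ d.*2)%:R * (d%:R * 2) + (k %% d.*2)%:R :> R.
  by rewrite {1}(divn_eq k d.*2) natrD natrM e2.
have e1 : k%:R * (j%:R * (pi / d%:R)) =
    (k %% d.*2)%:R * (j%:R * (pi / d%:R)) + (pi *+ 2) *+ (k %/ d.*2 * j) :> R.
  rewrite kE -[_ *+ (_ * j)]mulr_natr -[pi *+ 2]mulr_natr natrM.
  move: (k %/ d.*2)%:R (k %% d.*2)%:R (j%:R : R) (d%:R : R) (pi : R) dn => x1 x2 x3 x4 x5 x40.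
  by field.
rewrite e1 (periodicn (@cosD2pi R)) /alias; case: ifPn => // rd.
rewrite natrB; last by rewrite ltnW// ltn_mod double_gt0.
rewrite mulrBl -[in RHS]cosN opprB -[in RHS](periodicn (@cosD2pi R) j).
congr cos; rewrite e2 -[(pi *+ 2) *+ j]mulr_natr -[pi *+ 2]mulr_natr.
move: (k %% d.*2)%:R (j%:R : R) (d%:R : R) (pi : R) dn => x2 x3 x4 x5 x40.
by field.
Qed.

Lemma cheb_interp_affT (a b : R) d k : a < b -> (0 < d)%N ->
  let A := (a + b) / 2 in let B := (b - a) / 2 in
  cheb_interp a b d (fun v => (affT A B k).[v]) = affT A B (alias d k).
Proof.
move=> ab d0 A B; have B0 : B != 0 by rewrite gt_eqF// divr_gt0// subr_gt0.
rewrite -[RHS](@cheb_interp_id a b d)//; last first.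
  by rewrite (leq_trans (size_affT _ _ B0))// ltnS alias_le.
by apply: eq_cheb_interp => j; rewrite !cheb_pointE -/A -/B !affT_cos// cos_alias.
Qed.

Definition lagrange (a b : R) d (j : 'I_d.+1) : {poly R} :=
  \prod_(l < d.+1 | l != j)
      ((cheb_point a b d j - cheb_point a b d l)^-1 *: ('X - (cheb_point a b d l)%:P)).

Lemma cheb_interp_lagrange (a b : R) d f :
  cheb_interp a b d f = \sum_(j < d.+1) f (cheb_point a b d j) *: lagrange a b j.
Proof. by []. Qed.

(** Interpolation of complex data, read on the unit circle at points above the nodes. Truncated
    Laurent sums are not known to be real there, so [cheb_interp] does not apply to them. *)
Definition cinterp (a b : R) d (u : C -> C) (x : C) : C :=
  \sum_(j < d.+1) u (cis (j%:R * (pi / d%:R))) * evalC (lagrange a b j) x.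

Lemma cinterp_real (a b : R) d (u : C -> C) (f : R -> R) x :
  (forall j : 'I_d.+1, u (cis (j%:R * (pi / d%:R))) = (f (cheb_point a b d j))%:C%C) ->
  cinterp a b d u x = evalC (cheb_interp a b d f) x.
Proof.
move=> uf; rewrite cheb_interp_lagrange evalC_sum; apply: eq_bigr => j _.
by rewrite evalCZ uf.
Qed.

Lemma cinterp_monomial (a b : R) d k z : a < b -> (0 < d)%N -> z != 0 ->
  cinterp a b d (fun w => w ^+ k + w ^- k)
    (((a + b) / 2)%:C%C + ((b - a) / 2)%:C%C * joukowski z)
  = z ^+ alias d k + z ^- alias d k.
Proof.
move=> ab d0 z0; set A := (a + b) / 2; set B := (b - a) / 2.
have B0 : B != 0 by rewrite gt_eqF// divr_gt0// subr_gt0.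
rewrite (@cinterp_real _ _ _ _ (fun v => ((affT A B k) + (affT A B k)).[v])); last first.
  move=> j; rewrite cheb_pointE -/A -/B hornerD affT_cos// -exprVn cis_inv !cisX rmorphD/=.
  rewrite mulrN -cis_inv -joukowski_cis /joukowski; field.
  by rewrite ?cis_neq0 ?pnatr_eq0.
have -> : cheb_interp a b d (fun v => ((affT A B k) + (affT A B k)).[v])
    = affT A B (alias d k) + affT A B (alias d k).
  rewrite -cheb_interp_affT// -/A -/B !cheb_interp_lagrange -big_split/=.
  by apply: eq_bigr => j _; rewrite hornerD scalerDl.
rewrite evalCD affT_joukowski//; field.
by rewrite ?pnatr_eq0/= ?expf_neq0.
Qed.

End chebyshev_polynomials.

Section interpolation_error.
Context {R : realType}.
Local Notation C := R[i].
Variables (a b rho V : R) (g : C -> C).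
Hypothesis (ab : a < b) (rho1 : 1 < rho).
Hypothesis hg : holo (annulus rho) g.
Hypothesis gV : forall w, annulus rho w -> g w^-1 = g w.
Hypothesis gle : forall w, annulus rho w -> nrm (g w) <= V.

Let pos x : C := ((a + b) / 2)%:C%C + ((b - a) / 2)%:C%C * joukowski x.

(** Interpolation reproduces the Laurent terms of index at most d and aliases the others. So only
    indices k > d contribute, each at most V / S^k times 4 |z|^k, a geometric series in y. The
    estimate is uniform in N and passes to the limit. *)
Let interp_error_lt d z S : (0 < d)%N -> 1 <= nrm z -> nrm z < S -> S < rho ->
  nrm (g z - cinterp a b d g (pos z)) <=
    4 * V * (nrm z / S) ^+ d.+1 / (1 - nrm z / S).
Proof.
move=> d0 z1 zS Srho; set y := nrm z / S.
have S0 : 0 < S by apply: lt_trans zS; apply: lt_le_trans z1.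
have y01 : 0 <= y < 1 by rewrite divr_ge0 ?nrm_ge0 ?(ltW S0)//= ltr_pdivrMr// mul1r.
have S1 : 1 < S := le_lt_trans z1 zS.
have V0 : 0 <= V.
  apply: (le_trans (nrm_ge0 _) (gle (w := 1) _)).
  by rewrite /annulus/= nrm1 rho1 andbT invf_lt1// (lt_trans ltr01).
pose q N w := laurent_sum g S w N.
have cvgz : ctends (q ^~ z) (g z) by move=> e e0; exact: (laurent_cvg rho1 hg gV gle Srho z1 zS e0).
have cvgn j : ctends (q ^~ (cis (j%:R * (pi / d%:R)))) (g (cis (j%:R * (pi / d%:R)))).
  by move=> e e0; apply: (laurent_cvg rho1 hg gV gle Srho) => //; rewrite nrm_cis.
have cvgE : ctends (fun N => q N z - cinterp a b d (q N) (pos z)) (g z - cinterp a b d g (pos z)).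
  rewrite -[X in _ - X]mulr1 -mulrN.
  rewrite (_ : (fun N => _) = fun N => q N z + cinterp a b d (q N) (pos z) * -1); last first.
    by apply/funext => N; rewrite mulrN1.
  apply: ctendsD => //; apply: ctendsZ; apply: ctends_sum => j _; apply: ctendsZ.
  exact: cvgn.
apply: (ctends_le (N1 := 1%N) cvgE) => N N1.
have z0 : z != 0 by rewrite -nrm_gt0 (lt_le_trans ltr01).
have -> : q N z - cinterp a b d (q N) (pos z) = \sum_(k < N.-1) laurent_coef g S N k.+1 *
   (z ^+ k.+1 + z ^- k.+1 - (z ^+ alias d k.+1 + z ^- alias d k.+1)).
  have -> : cinterp a b d (q N) (pos z) = laurent_coef g S N 0
    + \sum_(k < N.-1) laurent_coef g S N k.+1 * (z ^+ alias d k.+1 + z ^- alias d k.+1).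
    rewrite /cinterp /q /laurent_sum.
    under eq_bigr => j _ do rewrite mulrDl mulr_suml.
    rewrite big_split/= exchange_big/=; congr (_ + _).
      rewrite -mulr_sumr; have := cinterp_monomial 0 ab d0 z0.
      rewrite alias_id// -/(pos z) => h.
      (* The symmetric monomial of index 0 is the constant 2, so reproducing it is reproducing
         constants up to this factor. *)
      have h2 : 2 * (\sum_(j < d.+1) evalC (lagrange a b j) (pos z)) = 2.
        rewrite mulr_sumr; transitivity (z ^+ 0 + z ^- 0); last by rewrite expr0 invr1.
        by rewrite -h; apply: eq_bigr => j _; rewrite expr0 invr1.
      have -> : \sum_(j < d.+1) evalC (lagrange a b j) (pos z) = 1.
        by apply: (mulfI (_ : 2 != 0 :> C)); rewrite ?pnatr_eq0// h2 mulr1.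
      by rewrite mulr1.
    apply: eq_bigr => k _; rewrite -(cinterp_monomial _ ab d0 z0) /cinterp mulr_sumr.
    by apply: eq_bigr => j _; rewrite [RHS]mulrA.
  rewrite /q /laurent_sum opprD addrACA subrr add0r -sumrB.
  by apply: eq_bigr => k _; rewrite -mulrBr.
apply: (le_trans (nrm_sum _ _ _)).
(* The index k stands for the coefficient k + 1, so d <= k selects the coefficients beyond d. *)
apply: (@le_trans _ _ (\sum_(k < N.-1) 4 * V * y ^+ d.+1 * (if (d <= k)%N then y ^+ (k - d) else 0))).
  apply: ler_sum => k _; case: ifPn => dk; last first.
    rewrite alias_id// ?subrr ?mulr0 ?nrm0//.
    by rewrite ltnNge.
  have np l : (l <= k.+1)%N -> nrm (z ^+ l + z ^- l) <= 2 * nrm z ^+ k.+1.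
    move=> lk; apply: (le_trans (nrmD _ _)); rewrite nrmV nrmX.
    have h1 : nrm z ^+ l <= nrm z ^+ k.+1 by rewrite ler_weXn2l.
    have h2 : (nrm z ^+ l)^-1 <= 1.
      by rewrite invf_le1 ?exprn_ege1// (lt_le_trans ltr01)// exprn_ege1.
    have h3 : 1 <= nrm z ^+ k.+1 by rewrite exprn_ege1.
    lra.
  rewrite nrmM -mulrA -exprD addSn subnKC// /y expr_div_n.
  rewrite [leRHS](_ : _ = V / S ^+ k.+1 * (4 * nrm z ^+ k.+1)); last by ring.
  apply: ler_pM; rewrite ?nrm_ge0 ?(nrm_laurent_coef rho1 gle Srho z1 zS)//.
  apply: (le_trans (nrmD _ _)); rewrite nrmN.
  have := np k.+1 (leqnn _); have := np (alias d k.+1).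
  rewrite (leq_trans (alias_le _ d0))//; last by rewrite (leq_trans dk).
  by move=> /(_ isT); lra.
rewrite -mulr_sumr ler_wpM2l//.
  by rewrite !mulr_ge0// exprn_ge0//; case/andP: y01.
apply: (le_trans _ (sumr_geo_le N y01)).
have yk k : 0 <= y ^+ k by rewrite exprn_ge0//; case/andP: y01.
rewrite -(big_mkord xpredT (fun k => if (d <= k)%N then y ^+ (k - d) else 0)).
rewrite -(big_mkord xpredT (fun k => y ^+ k)).
have [dN|Nd] := leqP d N.-1; last first.
  rewrite big_nat big1 ?sumr_ge0// => k /andP[_ kN].
  by rewrite leqNgt (ltn_trans kN Nd).
rewrite (big_cat_nat (leq0n d) dN)/= [X in X + _]big_nat big1 ?add0r; last first.
  by move=> k /andP[_ kd]; rewrite leqNgt kd.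
rewrite -{1}[d]add0n big_addn.
rewrite (eq_bigr (fun k => y ^+ k)); last by move=> k _; rewrite leq_addl addnK.
rewrite [leRHS](big_cat_nat (leq0n (N.-1 - d)%N))/=; last first.
  by rewrite (leq_trans (leq_subr _ _))// leq_pred.
by rewrite lerDl sumr_ge0.
Qed.

(** The radius S may approach rho but not reach it. With y = |z| / S the limit is taken from the
    right at |z| / rho, after clearing the denominator, so that only the continuity of a polynomial
    in y is used. *)
Lemma interp_error d z : (0 < d)%N -> 1 <= nrm z -> nrm z < rho ->
  nrm (g z - cinterp a b d g (pos z)) <=
    4 * V * (nrm z / rho) ^+ d.+1 / (1 - nrm z / rho).
Proof.
move=> d0 z1 zr; set E := nrm _; set x := nrm z / rho.
have r0 : 0 < rho := lt_trans ltr01 rho1.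
have z0 : 0 < nrm z := lt_le_trans ltr01 z1.
have x1 : x < 1 by rewrite ltr_pdivrMr// mul1r.
have x0 : 0 < x by rewrite divr_gt0.
rewrite ler_pdivlMr ?subr_gt0//.
pose psi (y : R) := 4 * V * y ^+ d.+1 - E * (1 - y).
have psi_ge0 y : x < y < 1 -> 0 <= psi y.
  move=> /andP[xy y1]; have y0 : 0 < y := lt_trans x0 xy.
  rewrite subr_ge0 -ler_pdivlMr ?subr_gt0//.
  have := @interp_error_lt d z (nrm z / y) d0 z1.
  rewrite ltr_pdivlMr// gtr_pMr// y1 ltr_pdivrMr// -/E => /(_ isT).
  rewrite (mulrC rho) -ltr_pdivrMr// xy => /(_ isT).
  by rewrite invfM invrK mulrA divff ?mul1r// gt_eqF.
suff : 0 <= psi x by rewrite subr_ge0.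
have cpsi : psi y @[y --> x^'+] --> psi x.
  apply: cvg_at_right_filter; apply: cvgB.
    by apply: cvgM; [exact: cvg_cst|exact: exprn_continuous].
  by apply: cvgM; [exact: cvg_cst|apply: cvgB; [exact: cvg_cst|exact: cvg_id]].
apply: (cvgr_to_ge cpsi).
near=> y; apply: psi_ge0; apply/andP; split; near: y; first exact: nbhs_right_gt.
exact: nbhs_right_lt.
Unshelve. all: by end_near. Qed.

End interpolation_error.

Lemma cvg_ctends {R : realType} (C := R[i] : numClosedFieldType) (u : nat -> C) (l : C) :
  u @ \oo --> l -> forall e : R, 0 < e ->
  exists N, forall n, (N <= n)%N -> nrm (u n - l) < e.
Proof.
move=> /cvgrPdist_lt ul e e0.
have [|N _ H] := ul e%:C%C; first by rewrite ltcR.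
by exists N => n /H; rewrite nrmE ltcR nrmB.
Qed.

(** * Bernstein ellipses and the Joukowski map *)

Section ellipse.
Context {R : realType}.
Local Notation C := R[i].
Implicit Types (z w : C).

Lemma nrm_parallelogram w : nrm (w - 1) ^+ 2 + nrm (w + 1) ^+ 2 = 2 * nrm w ^+ 2 + 2.
Proof.
have sq z : nrm z ^+ 2 = complex.Re z ^+ 2 + complex.Im z ^+ 2.
  by rewrite /nrm normc_def/= sqr_sqrtr// addr_ge0 ?sqr_ge0.
by rewrite !sq; case: w => x y /=; ring.
Qed.

(** With J the Joukowski map, J(w) - 1 = (w - 1)^2 / (2 w) and J(w) + 1 = (w + 1)^2 / (2 w). By the
    parallelogram identity the distances to the foci add up to |w| + 1 / |w|, which is below rho + 1
    / rho on the annulus. *)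
Lemma joukowski_ellipse (rho : R) w : 1 < rho -> annulus rho w ->
  bernstein_ellipse rho (joukowski w).
Proof.
move=> r1 aw; have w0 := annulus_neq0 r1 aw; have nw0 : 0 < nrm w by rewrite nrm_gt0.
have r0 : 0 < rho := lt_trans ltr01 r1.
rewrite /bernstein_ellipse/= !nrmE -rmorphD ltcR.
have -> : joukowski w - 1 = (w - 1) ^+ 2 / (2 * w) by rewrite /joukowski; field.
have -> : joukowski w + 1 = (w + 1) ^+ 2 / (2 * w) by rewrite /joukowski; field.
rewrite !nrmM !nrmV !nrmM nrm_nat -mulrDl -!expr2 nrm_parallelogram.
have -> : (2 * nrm w ^+ 2 + 2) / (2 * nrm w) = nrm w + (nrm w)^-1.
  by field; rewrite gt_eqF.
case/andP: aw; set r := nrm w in nw0 *; rewrite -[rho^-1]mul1r ltr_pdivrMr// => h1 h2.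
rewrite -subr_gt0 (_ : _ - _ = (rho - r) * ((r * rho - 1) / (r * rho))); last first.
  by field; rewrite (gt_eqF nw0) gt_eqF.
by rewrite mulr_gt0 ?divr_gt0 ?subr_gt0// mulr_gt0.
Qed.

End ellipse.

Section analytic_extension.
Context {R : realType}.
Local Notation C := R[i].
Implicit Types (a b rho V : R) (f : R -> R) (g : C -> C).

(* The analytic continuation of f seen through v = (a + b)/2 + (b - a)/2 J(w),
   J the Joukowski map: the interval is the image of the unit circle and the
   scaled Bernstein ellipse that of the annulus. *)
Definition extends a b rho V f g :=
  [/\ holo (annulus rho) g, forall w, annulus rho w -> g w^-1 = g w,
      forall w, annulus rho w -> nrm (g w) <= V &
      forall t, g (cis t) = (f ((a + b) / 2 + (b - a) / 2 * cos t))%:C%C].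

Definition posC a b w : C := ((a + b) / 2)%:C%C + ((b - a) / 2)%:C%C * joukowski w.

Lemma joukowskiV (w : C) : joukowski w^-1 = joukowski w.
Proof. by rewrite /joukowski invrK addrC. Qed.

Lemma holo_posC a b rho : 1 < rho -> holo (annulus rho) (posC a b).
Proof.
move=> r1; have h0 (w : C) : annulus rho w -> w != 0 by exact: annulus_neq0.
apply: (@holoD _ _ (fun=> _) (fun w => _ * joukowski w)); first exact: holo_cst.
apply: holoZ; apply: (@holo_ext _ _ (fun w : C => 2^-1 * (w + w^-1))).
  by move=> w; rewrite /joukowski mulrC.
apply: holoZ; apply: (@holoD _ _ id (fun w => w^-1)); first exact: holo_id.
exact: holoV.
Qed.

Lemma cos_in_segment a b t : a < b ->
  (a + b) / 2 + (b - a) / 2 * cos t \in `[a, b].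
Proof.
move=> ab; rewrite in_itv/=.
have ba : 0 < (b - a) / 2 by rewrite divr_gt0// subr_gt0.
have h1 : (b - a) / 2 * cos t <= (b - a) / 2 by rewrite ger_pMr// cos_le1.
have h2 : - ((b - a) / 2) <= (b - a) / 2 * cos t.
  by rewrite -mulrN1 ler_pM2l// cos_geN1.
by apply/andP; split; lra.
Qed.

Lemma segment_cos a b v : a < b -> v \in `[a, b] ->
  exists t, v = (a + b) / 2 + (b - a) / 2 * cos t.
Proof.
move=> ab; rewrite in_itv/= => /andP[av vb].
have ba : 0 < (b - a) / 2 by rewrite divr_gt0// subr_gt0.
exists (acos ((v - (a + b) / 2) / ((b - a) / 2))); rewrite acosK.
  by rewrite [_ * (_ / _)]mulrC divfK ?gt_eqF// addrC subrK.
by rewrite in_itv/= ler_pdivlMr// ler_pdivrMr//; apply/andP; split; lra.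
Qed.

Lemma analytic_extends a b rho V f : a < b -> 1 < rho ->
  analytically_continuable a b rho V f -> exists g, extends a b rho V f g.
Proof.
move=> ab r1 [h [ha hf hV]].
have posE w : annulus rho w -> scaled_bernstein_ellipse a b rho (posC a b w).
  by move=> aw; exists (joukowski w) => //; exact: joukowski_ellipse.
exists (h \o posC a b); split => /=.
- apply: (@holo_comp _ _ (scaled_bernstein_ellipse a b rho)) => //; last exact: holo_posC.
  apply: pseries_holo => z0 /ha[c [r [r0 hc]]]; exists c, r; split => // z zr e e0.
  have [|N HN] := @cvg_ctends _ _ _ (hc z _) e e0; first by rewrite nrmE ltcR.
  by exists N => n /HN; rewrite /series/= big_mkord.
- by move=> w _; rewrite /posC joukowskiV.
- by move=> w /posE/hV; rewrite nrmE lecR.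
- move=> t; rewrite /posC joukowski_cis -rmorphM -rmorphD/= hf//.
  exact: cos_in_segment.
Qed.

Lemma extendsZ a b rho V f g c : 1 < rho -> extends a b rho V f g ->
  extends a b rho (`|c| * V) (fun v => c * f v) (fun w => c%:C%C * g w).
Proof.
move=> r1 [h1 h2 h3 h4]; split.
- exact: holoZ.
- by move=> w aw /=; rewrite h2.
- by move=> w aw /=; rewrite nrmM nrm_real ler_wpM2l// h3.
- by move=> t /=; rewrite h4 rmorphM.
Qed.

Lemma extendsX a b rho V f g n : extends a b rho V f g ->
  extends a b rho (V ^+ n) (fun v => f v ^+ n) (fun w => g w ^+ n).
Proof.
move=> [h1 h2 h3 h4]; split.
- exact: holoX.
- by move=> w aw /=; rewrite h2.
- move=> w aw /=; rewrite nrmX lerXn2r ?nnegrE ?nrm_ge0 ?h3//.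
  exact: le_trans (nrm_ge0 _) (h3 w aw).
- by move=> t /=; rewrite h4 rmorphXn.
Qed.

Lemma extends_ext a b rho V f f' g : f =1 f' ->
  extends a b rho V f g -> extends a b rho V f' g.
Proof. by move=> /funext ->. Qed.

Lemma extends_le a b rho V V' f g : V <= V' ->
  extends a b rho V f g -> extends a b rho V' f g.
Proof.
by move=> VV [h1 h2 h3 h4]; split => // w aw; exact: le_trans (h3 w aw) VV.
Qed.

Lemma extends_sum a b rho I (r : seq I) (P : pred I) (V : I -> R)
    (f : I -> R -> R) (g : I -> C -> C) :
  (forall i, P i -> extends a b rho (V i) (f i) (g i)) ->
  extends a b rho (\sum_(i <- r | P i) V i) (fun v => \sum_(i <- r | P i) f i v)
    (fun w => \sum_(i <- r | P i) g i w).
Proof.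
move=> H; split.
- by apply: holo_sum => i /H[].
- by move=> w aw; apply: eq_bigr => i /H[_ + _ _]; exact.
- move=> w aw; apply: (le_trans (nrm_sum _ _ _)).
  by apply: ler_sum => i /H[_ _ + _]; exact.
- move=> t; rewrite rmorph_sum/=; apply: eq_bigr => i /H[_ _ _]; exact.
Qed.

Lemma extends_poly a b rho (p : {poly R}) V : 1 < rho ->
  (forall w, annulus rho w -> nrm (evalC p (posC a b w)) <= V) ->
  extends a b rho V (horner p) (fun w => evalC p (posC a b w)).
Proof.
move=> r1 pV; split => //.
- by apply: holo_horner; exact: holo_posC.
- by move=> w _; rewrite /posC joukowskiV.
- by move=> t; rewrite /posC joukowski_cis -rmorphM -rmorphD/= evalC_real.
Qed.

Section errors.
Variables (a b rho V : R) (f : R -> R) (g : C -> C).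
Hypotheses (ab : a < b) (rho1 : 1 < rho) (fg : extends a b rho V f g).

Lemma extends_ge0 : 0 <= V.
Proof.
case: fg => _ _ gV _; apply: (le_trans (nrm_ge0 _) (gV 1 _)).
by rewrite /annulus/= nrm1 rho1 andbT invf_lt1// (lt_trans ltr01).
Qed.

Lemma extends_cinterp d x : cinterp a b d g x = evalC (cheb_interp a b d f) x.
Proof.
case: fg => _ _ _ gf; apply: cinterp_real => j.
by rewrite gf cheb_pointE.
Qed.

Lemma cheb_error d v : (0 < d)%N -> v \in `[a, b] ->
  `|f v - (cheb_interp a b d f).[v]| <= 4 * V / (rho ^+ d * (rho - 1)).
Proof.
move=> d0 /(segment_cos ab)[t vt]; have [h1 h2 h3 h4] := fg.
have r0 : 0 < rho := lt_trans ltr01 rho1.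
have := interp_error ab rho1 h1 h2 h3 d0 (z := cis t).
rewrite nrm_cis lexx rho1 extends_cinterp joukowski_cis -rmorphM -rmorphD/= -vt.
rewrite evalC_real h4 -vt -rmorphB nrm_real => /(_ isT isT) /le_trans; apply.
rewrite le_eqVlt; apply/orP; left; apply/eqP; rewrite expr_div_n expr1n exprS.
have rd : rho ^+ d != 0 by rewrite expf_neq0// gt_eqF.
by field; rewrite rd (gt_eqF r0)/= subr_eq0 gt_eqF.
Qed.

(** For |w| < s the ratio |w| / rho is below 1 / s, so on this smaller annulus the interpolation
    error decays at the rate which the parameter s would give on the segment. *)
Lemma cheb_growth d (s : R) w : (0 < d)%N -> s ^+ 2 = rho -> 1 < s ->
  1 <= nrm w -> nrm w < s ->
  nrm (evalC (cheb_interp a b d f) (posC a b w)) <= V + 4 * V / (s ^+ d * (s - 1)).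
Proof.
move=> d0 s2 s1 w1 ws; have [h1 h2 h3 h4] := fg.
have s0 : 0 < s := lt_trans ltr01 s1.
have srho : s < rho by rewrite -s2 expr2 ltr_pMr.
have wr : nrm w < rho := lt_trans ws srho.
have r0 : 0 < rho := lt_trans s0 srho.
have aw : annulus rho w.
  by rewrite /annulus/= wr andbT (lt_le_trans _ w1)// invf_lt1.
have := interp_error ab rho1 h1 h2 h3 d0 w1 wr; rewrite extends_cinterp => h.
have V0 := extends_ge0.
set p := evalC _ _ in h *.
have : nrm (g w - p) <= 4 * V / (s ^+ d * (s - 1)).
  apply: (le_trans h).
  have xs : nrm w / rho <= s^-1.
    by rewrite ler_pdivrMr// -s2 expr2 mulrA mulVf ?gt_eqF// mul1r ltW.
  have s1' : s^-1 < 1 by rewrite invf_lt1.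
  apply: (@le_trans _ _ (4 * V * s^-1 ^+ d.+1 / (1 - s^-1))); last first.
    rewrite le_eqVlt; apply/orP; left; apply/eqP; rewrite exprVn exprS.
    have sd : s ^+ d != 0 by rewrite expf_neq0// gt_eqF.
    by field; rewrite sd (gt_eqF s0)/= subr_eq0 gt_eqF.
  apply: ler_pM.
  - by rewrite !mulr_ge0// exprn_ge0// divr_ge0 ?nrm_ge0// ltW.
  - by rewrite invr_ge0 subr_ge0 (le_trans xs)// ltW.
  - rewrite ler_wpM2l ?mulr_ge0// lerXn2r ?nnegrE ?invr_ge0 ?(ltW s0)//.
    by rewrite divr_ge0 ?nrm_ge0// ltW.
  - by rewrite lef_pV2 ?posrE ?subr_gt0 ?(le_lt_trans xs)// lerB.
have := nrmD (g w) (p - g w); rewrite addrC subrK nrmB.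
have := h3 w aw; lra.
Qed.

End errors.
End analytic_extension.

Section log_exp_series.
Context {R : realType}.

(** The derivative of the Taylor polynomial is a finite geometric sum, so the remainder has
    derivative (-y)^P / (1 + y), and the mean value theorem bounds it. *)
Lemma ln_taylor (t x : R) P : 0 <= x <= t -> t < 1 ->
  `|ln (1 + x) - \sum_(n < P) (-1) ^+ n / n.+1%:R * x ^+ n.+1| <= t ^+ P.
Proof.
move=> /andP[x0 xt] t1.
pose p : {poly R} := \sum_(n < P) ((-1) ^+ n / n.+1%:R) *: 'X^(n.+1).
have pE (y : R) : p.[y] = \sum_(n < P) (-1) ^+ n / n.+1%:R * y ^+ n.+1.
  by rewrite horner_sum; apply: eq_bigr => n _; rewrite hornerZ hornerXn.
have dpE (y : R) : (1 + y) * p^`().[y] = 1 - (- y) ^+ P.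
  rewrite /p raddf_sum/= horner_sum.
  rewrite (eq_bigr (fun n : 'I_P => (- y) ^+ n)) => [|n _].
    by have := subrX1 (- y) P; move: (\sum_(i < P) _) => S h; lra.
  rewrite derivZ derivXn hornerZ hornerMn hornerXn -[_ ^+ _ *+ _]mulr_natr mulrACA.
  by rewrite mulVf ?pnatr_eq0// mulr1 -exprMn mulN1r.
pose f (y : R) := ln (1 + y) - p.[y].
have df (y : R) : 0 <= y -> is_derive y 1 f ((1 + y)^-1 - p^`().[y]).
  move=> y0; have y1 : 0 < 1 + y by rewrite ltr_pwDl.
  have h1 : is_derive y 1 (fun y : R => ln (1 + y)) (1 + y)^-1.
    have d1 : is_derive y 1 (fun y : R => 1 + y) 1.
      by have := is_deriveD (is_derive_cst (1 : R) y 1) (is_derive_id y 1); rewrite add0r.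
    have d2 := is_derive1_ln y1.
    by have := @is_derive1_comp R (@ln R) (fun y : R => 1 + y) y _ _ d2 d1; rewrite mulr1.
  exact: is_deriveB.
have cf : {within `[0, x], continuous f}.
  apply: derivable_within_continuous => y; rewrite in_itv/= => /andP[y0 _].
  by have [] := df y y0.
have [|c] := @MVT_segment _ f (fun y => (1 + y)^-1 - p^`().[y]) 0 x x0 _ cf.
  by move=> y; rewrite in_itv/= => /andP[/ltW/df].
rewrite in_itv/= => /andP[c0 cx].
have -> : f 0 = 0.
  rewrite /f addr0 ln1 pE big1 ?subr0// => n _.
  by rewrite expr0n/= mulr0.
have c10 : 0 < 1 + c by rewrite ltr_pwDl.
have -> : (1 + c)^-1 - p^`().[c] = (- c) ^+ P / (1 + c).
  apply: (mulIf (lt0r_neq0 c10)); rewrite divfK ?gt_eqF// mulrBl mulVf ?gt_eqF//.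
  by rewrite mulrC dpE opprB addrC subrK.
rewrite !subr0 -pE -/(f x) => ->; rewrite !normrM normrX normrN normfV.
rewrite (ger0_norm c0) (gtr0_norm c10) (ger0_norm x0) -mulrA -[leRHS]mulr1.
apply: ler_pM; rewrite ?exprn_ge0//.
- by rewrite mulr_ge0// invr_ge0 ltW.
- by rewrite lerXn2r ?nnegrE ?(le_trans cx)// (le_trans c0) ?(le_trans cx).
- rewrite mulrC ler_pdivrMr// mul1r; lra.
Qed.

Lemma ctends_real (u : nat -> R) (l : R) :
  (forall e : R, 0 < e -> exists N0, forall N, (N0 <= N)%N -> `|u N - l| <= e) ->
  ctends (fun N => (u N)%:C%C) l%:C%C.
Proof.
move=> H e /H[N0 HN]; exists N0 => N /HN.
by rewrite -rmorphB/= nrm_real.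
Qed.

Definition exp_sum (x : R) P : R := \sum_(n < P) x ^+ n / n`!%:R.

Lemma exp_sumE x P : exp_sum x P = series (exp_coeff x) P.
Proof. by rewrite /series/= big_mkord. Qed.

Lemma exp_sum_cvg x : ctends (fun P => (exp_sum x P)%:C%C) (expR x)%:C%C.
Proof.
apply: ctends_real => e e0.
have /cvgrPdist_le/(_ _ e0)[N0 _ H] : series (exp_coeff x) @ \oo --> expR x.
  exact: is_cvg_series_exp_coeff.
by exists N0 => N /H/=; rewrite distrC exp_sumE.
Qed.

Lemma exp_sum_le x P : 0 <= x -> exp_sum x P <= expR x.
Proof.
move=> x0; rewrite exp_sumE; apply: nondecreasing_cvgn_le.
  apply/nondecreasing_seqP => n; rewrite !seriesEnat/= big_nat_recr//= lerDl.
  by rewrite exp_coeff_ge0.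
exact: is_cvg_series_exp_coeff.
Qed.

End log_exp_series.

(** * Relative error of the double interpolation *)

Section double_interpolation.
Context {R : realType} (J : finType).
Local Notation C := R[i].
Variables (a b s t : R) (A : {set J}) (u : J -> R -> R) (g : J -> C -> C)
  (r : J -> nat) (m k : nat).
Hypotheses (ab : a < b) (s1 : 1 < s) (t01 : 0 <= t < 1) (m0 : (0 < m)%N) (k0 : (0 < k)%N).
Hypothesis ug : forall j, j \in A -> extends a b (s ^+ 2) 1 (u j) (g j).
Hypothesis u01 : forall j v, j \in A -> v \in `[a, b] -> 0 <= u j v <= 1.

Let U v := \sum_(j in A) (r j)%:R * ln (1 + t * u j v).
Let Um := cheb_interp a b m U.
Let fk := cheb_interp a b k (fun v => expR Um.[v]).
(** Bound for the continuation of U: for |z| <= 1 the series of log(1 + t z) is dominated by t + t^2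
    + ... = t / (1 - t). *)
Let V : R := (\sum_(j in A) (r j)%:R) * (t / (1 - t)).
Let eps := 4 / (s ^+ m * (s - 1)).
Hypothesis eps1 : eps <= 1.

Let s0 : 0 < s := lt_trans ltr01 s1.
Let rho1 : 1 < s ^+ 2. Proof. by rewrite exprn_egt1. Qed.
Let t0 : 0 <= t. Proof. by case/andP: t01. Qed.
Let t1 : t < 1. Proof. by case/andP: t01. Qed.

(** Truncating the logarithm leaves a polynomial in the u j, whose continuation is the same
    polynomial in the g j; the bound V holds for every P. *)
Let UP P v := \sum_(j in A) (r j)%:R * \sum_(n < P) (-1) ^+ n / n.+1%:R * t ^+ n.+1 * u j v ^+ n.+1.
Let gP P w := \sum_(j in A) (r j)%:R%:C%C *
  \sum_(n < P) ((-1) ^+ n / n.+1%:R * t ^+ n.+1)%:C%C * g j w ^+ n.+1.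

Let UP_extends P : extends a b (s ^+ 2) V (UP P) (gP P).
Proof.
pose c n : R := (-1) ^+ n / n.+1%:R * t ^+ n.+1.
have H : extends a b (s ^+ 2)
    (\sum_(j in A) `|(r j)%:R| * \sum_(n < P) `|c n| * 1 ^+ n.+1) (UP P) (gP P).
  apply: extends_sum => j jA; apply: extendsZ => //; apply: extends_sum => n _.
  by apply: extendsZ => //; apply: extendsX; exact: ug.
apply: extends_le H; rewrite /V mulr_suml; apply: ler_sum => j _.
rewrite normr_nat ler_wpM2l//.
apply: (@le_trans _ _ (\sum_(n < P) t * t ^+ n)); last first.
  by rewrite -mulr_sumr ler_wpM2l// sumr_geo_le.
apply: ler_sum => n _; rewrite expr1n mulr1 /c !normrM normrX normrN1 expr1n mul1r.
rewrite (ger0_norm (exprn_ge0 _ t0)) -exprS ler_piMl ?exprn_ge0//.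
by rewrite ger0_norm ?invr_ge0// invf_le1 ?ltr0n// ler1n.
Qed.

Let UP_cvg v : v \in `[a, b] -> ctends (fun P => (UP P v)%:C%C) (U v)%:C%C.
Proof.
move=> vab; rewrite /U rmorph_sum/= (_ : (fun P => _) = fun P => \sum_(j in A)
  (\sum_(n < P) (-1) ^+ n / n.+1%:R * (t * u j v) ^+ n.+1)%:C%C * (r j)%:R%:C%C); last first.
  apply/funext => P; rewrite rmorph_sum/=; apply: eq_bigr => j _.
  rewrite mulrC rmorphM/=; congr (_%:C%C * _); apply: eq_bigr => n _.
  by rewrite exprMn mulrA.
apply: ctends_sum => j jA; rewrite rmorphM/= [_%:C%C * _]mulrC; apply: ctendsZ.
apply: ctends_real => e e0.
have [N0 HN] := expr_small t01 e0; exists N0 => N /HN; apply: le_trans.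
rewrite distrC; apply: ln_taylor => //.
have /andP[u0 u1] := u01 jA vab.
by rewrite mulr_ge0//= ler_piMr.
Qed.

Let node_in d (j : 'I_d.+1) : cheb_point a b d j \in `[a, b].
Proof. by rewrite cheb_pointE cos_in_segment. Qed.

(** An interpolant is a fixed linear combination of values at finitely many nodes of the segment, so
    convergence there gives convergence of the interpolants at every complex x, even where f is not
    defined. *)
Let cheb_cvg d (F : nat -> R -> R) (f : R -> R) x :
  (forall v, v \in `[a, b] -> ctends (fun P => (F P v)%:C%C) (f v)%:C%C) ->
  ctends (fun P => evalC (cheb_interp a b d (F P)) x) (evalC (cheb_interp a b d f) x).
Proof.
move=> H; rewrite cheb_interp_lagrange evalC_sum.
rewrite (_ : (fun P => _) = fun P => \sum_(j < d.+1) evalC (F P (cheb_point a b d j) *: lagrange a b j) x); last first.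
  by apply/funext => P; rewrite cheb_interp_lagrange evalC_sum.
apply: ctends_sum => j _; rewrite evalCZ.
rewrite (_ : (fun P => _) = fun P => (F P (cheb_point a b d j))%:C%C * evalC (lagrange a b j) x); last first.
  by apply/funext => P; rewrite evalCZ.
by apply: ctendsZ; apply: H; exact: node_in.
Qed.

Let V0 : 0 <= V.
Proof. by rewrite mulr_ge0 ?sumr_ge0// divr_ge0// subr_ge0 ltW. Qed.

Let U_error v : v \in `[a, b] -> `|Um.[v] - U v| <= eps * V.
Proof.
move=> vab; rewrite distrC -nrm_real rmorphB/= -evalC_real.
apply: (@ctends_le _ (fun P => (UP P v)%:C%C - evalC (cheb_interp a b m (UP P)) v%:C%C) _ _ 0).
  rewrite -mulrN1 (_ : (fun P => _) = fun P => (UP P v)%:C%C + evalC (cheb_interp a b m (UP P)) v%:C%C * -1).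
    apply: ctendsD; [exact: UP_cvg|apply: ctendsZ; apply: cheb_cvg; exact: UP_cvg].
  by apply/funext => P; rewrite mulrN1.
move=> P _; rewrite evalC_real -rmorphB nrm_real.
apply: (le_trans (cheb_error ab rho1 (UP_extends P) m0 vab)).
(* The rate in rho = s^2 is weakened to that in s, so that the same eps controls [Um] both on the
   segment and on the annulus of parameter s. *)
rewrite /eps mulrAC ler_wpM2r// ler_wpM2l// lef_pV2 ?posrE; last 2 first.
- by rewrite mulr_gt0 ?exprn_gt0 ?subr_gt0// exprn_gt0.
- by rewrite mulr_gt0 ?exprn_gt0 ?subr_gt0.
apply: ler_pM; rewrite ?exprn_ge0 ?subr_ge0 ?(ltW s0) ?(ltW s1)//.
  by rewrite lerXn2r ?nnegrE ?exprn_ge0 ?(ltW s0)// expr2 ler_peMl ?(ltW s0) ?(ltW s1).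
by rewrite lerD2r expr2 ler_peMl ?(ltW s0) ?(ltW s1).
Qed.

Let Um_growth w : 1 <= nrm w -> nrm w < s -> nrm (evalC Um (posC a b w)) <= 2 * V.
Proof.
move=> w1 ws.
have h : nrm (evalC Um (posC a b w)) <= V + 4 * V / (s ^+ m * (s - 1)).
  apply: (@ctends_le _ (fun P => evalC (cheb_interp a b m (UP P)) (posC a b w)) _ _ 0).
    by apply: cheb_cvg; exact: UP_cvg.
  by move=> P _; exact: (cheb_growth ab rho1 (UP_extends P) m0 erefl s1 w1 ws).
apply: (le_trans h); rewrite mulrAC -/eps mulr2n mulrDl mul1r lerD2l.
by rewrite ler_piMl.
Qed.

Let EP P : {poly R} := \sum_(n < P) (n`!%:R^-1) *: Um ^+ n.

Let EPE P v : (EP P).[v] = exp_sum Um.[v] P.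
Proof.
rewrite horner_sum; apply: eq_bigr => n _.
by rewrite hornerZ horner_exp mulrC.
Qed.

Let EP_extends P : extends a b s (expR (2 * V)) (horner (EP P)) (fun w => evalC (EP P) (posC a b w)).
Proof.
apply: extends_poly => //.
(* [Um_growth] covers the outer half of the annulus; the inner half follows by inversion, under
   which [posC] is invariant. *)
suff H w : 1 <= nrm w -> nrm w < s -> nrm (evalC (EP P) (posC a b w)) <= expR (2 * V).
  move=> w aw; have [w1|w1] := leP 1 (nrm w); first by apply: H => //; case/andP: aw.
  have := annulusV s1 aw => /andP[_ h]; rewrite /posC -joukowskiV; apply: H => //.
  by rewrite nrmV invf_ge1 ?ltW// nrm_gt0 (annulus_neq0 s1 aw).
move=> w1 ws; apply: le_trans (exp_sum_le P (mulr_ge0 _ V0)) => //.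
rewrite evalC_sum; apply: (le_trans (nrm_sum _ _ _)); apply: ler_sum => n _.
rewrite evalCZ nrmM nrm_real mulrC ger0_norm ?invr_ge0// ler_wpM2r ?invr_ge0//.
rewrite /evalC rmorphXn/= horner_exp -/(evalC Um _) nrmX.
have hg := Um_growth w1 ws.
by rewrite lerXn2r// nnegrE ?nrm_ge0// mulr_ge0.
Qed.

Let f_error v : v \in `[a, b] ->
  `|fk.[v] - expR Um.[v]| <= 4 / (s ^+ k * (s - 1)) * expR (2 * V).
Proof.
move=> vab; rewrite distrC -nrm_real rmorphB/= -evalC_real.
have cv y : ctends (fun P => ((EP P).[y])%:C%C) (expR Um.[y])%:C%C.
  rewrite (_ : (fun P => _) = fun P => (exp_sum Um.[y] P)%:C%C); first exact: exp_sum_cvg.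
  by apply/funext => P; rewrite EPE.
apply: (@ctends_le _ (fun P => ((EP P).[v])%:C%C - evalC (cheb_interp a b k (horner (EP P))) v%:C%C) _ _ 0).
  rewrite -mulrN1 (_ : (fun P => _) = fun P => ((EP P).[v])%:C%C + evalC (cheb_interp a b k (horner (EP P))) v%:C%C * -1).
    by apply: ctendsD => //; apply: ctendsZ; apply: cheb_cvg.
  by apply/funext => P; rewrite mulrN1.
move=> P _; rewrite evalC_real -rmorphB nrm_real.
apply: (le_trans (cheb_error ab s1 (EP_extends P) k0 vab)).
by rewrite mulrAC.
Qed.

Lemma U_ge0 v : v \in `[a, b] -> 0 <= U v.
Proof.
move=> vab; apply: sumr_ge0 => j jA; rewrite mulr_ge0// ln_ge0// lerDl mulr_ge0//.
by have /andP[] := u01 jA vab.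
Qed.

(** The second interpolation has an absolute error bound. Since U >= 0, the factor exp(U) >= 1 may
    be put in front of it, which makes it relative like the first. *)
Theorem double_interp_error v : v \in `[a, b] ->
  `|fk.[v] - expR (U v)| <=
    expR (U v) * (expR (eps * V) - 1 + 4 / (s ^+ k * (s - 1)) * expR (2 * V)).
Proof.
move=> vab; have h1 := f_error vab; have h2 := U_error vab.
have U0 := U_ge0 vab; have eU : 1 <= expR (U v) by rewrite -expR0 ler_expR.
have h3 : `|expR Um.[v] - expR (U v)| <= expR (U v) * (expR (eps * V) - 1).
  have -> : expR Um.[v] = expR (U v) * expR (Um.[v] - U v) by rewrite -expRD addrC subrK.
  rewrite -[X in _ - X]mulr1 -mulrBr normrM ger0_norm ?expR_ge0// ler_wpM2l ?expR_ge0//.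
  move: h2; rewrite ler_norml => /andP[l1 l2].
  set y := Um.[v] - U v in l1 l2 *.
  rewrite ler_norml lerD2r ler_expR l2 andbT.
  (* The lower bound is exp(y) + exp(eps V) >= 2 + y + eps V >= 2. *)
  have := expR_ge1Dx y; have := expR_ge1Dx (eps * V); lra.
have h4 : 4 / (s ^+ k * (s - 1)) * expR (2 * V) <=
    expR (U v) * (4 / (s ^+ k * (s - 1)) * expR (2 * V)).
  by rewrite ler_peMl// mulr_ge0 ?expR_ge0// divr_ge0// mulr_ge0 ?exprn_ge0 ?subr_ge0 ?(ltW s0) ?(ltW s1).
have := ler_normD (fk.[v] - expR Um.[v]) (expR Um.[v] - expR (U v)).
rewrite addrA subrK mulrDr; lra.
Qed.

End double_interpolation.

(** * Poisson sums *)

Section countable_sums.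
Context {R : realType} {T : countType}.
Implicit Types (P : set T) (a : T -> \bar R).
Local Open Scope ereal_scope.

(** Lists the summands along their codes, with 0 at numbers that code no element of P. A sum over a
    countable type thus becomes a series, to which the results on scaling, measurability and
    integration of series apply. *)
Definition unpickled P a (l : nat) : \bar R :=
  if pickle_inv l is Some s then (if s \in P then a s else 0) else 0.

Lemma unpickled_ge0 P a l : (forall s, P s -> 0 <= a s) -> 0 <= unpickled P a l.
Proof.
by move=> a0; rewrite /unpickled; case: pickle_inv => // s; case: ifPn => // /set_mem/a0.
Qed.

Lemma esum_countable P a : (forall s, P s -> 0 <= a s) ->
  \esum_(s in P) a s = \sum_(l <oo) unpickled P a l.
Proof.
move=> a0; rewrite nneseries_esumT; last by move=> l; exact: unpickled_ge0.
rewrite [RHS](_ : _ = \esum_(l in range (@pickle T)) unpickled P a l); last first.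
  rewrite [RHS]esum_mkcond; apply: eq_esum => l _; case: ifPn => // lT.
  rewrite /unpickled; case E : pickle_inv => [s|//]; case/negP: lT.
  by apply/mem_set; exists s => //; have := @pickle_invK T l; rewrite E.
rewrite esum_image; last by move=> x y _ _; exact: (pcan_inj pickleK_inv).
by rewrite esum_mkcond; apply: eq_esum => s _; rewrite /unpickled pickleK_inv.
Qed.

Lemma esumZl P a (c : R) : (forall s, P s -> 0 <= a s) -> (0 <= c)%R ->
  \esum_(s in P) (c%:E * a s) = c%:E * \esum_(s in P) a s.
Proof.
move=> a0 c0; rewrite !esum_countable//; last by move=> s Ps; rewrite mule_ge0// a0.
rewrite -nneseriesZl; last by move=> i _; exact: unpickled_ge0.
apply: eq_eseriesr => l _; rewrite /unpickled; case: pickle_inv => [s|]; last by rewrite mule0.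
by case: ifPn => // _; rewrite mule0.
Qed.

Section integral.
Context d (X : measurableType d).

Lemma measurable_unpickled (D : set X) P (a : T -> X -> \bar R) l :
  (forall s, P s -> measurable_fun D (a s)) ->
  measurable_fun D (fun x => unpickled P (a ^~ x) l).
Proof.
move=> ma; rewrite /unpickled; case: pickle_inv => [s|]; last exact: measurable_cst.
by have [/set_mem Ps|_] := boolP (s \in P); [exact: ma|exact: measurable_cst].
Qed.

Lemma measurable_fun_esum (D : set X) P (a : T -> X -> \bar R) : measurable D ->
  (forall s x, P s -> D x -> 0 <= a s x) ->
  (forall s, P s -> measurable_fun D (a s)) ->
  measurable_fun D (fun x => \esum_(s in P) a s x).
Proof.
move=> mD a0 ma; apply: (eq_measurable_fun (fun x => \sum_(l <oo) unpickled P (a ^~ x) l)).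
  by move=> x /set_mem Dx; rewrite esum_countable// => s Ps; exact: a0.
apply: ge0_emeasurable_sum => //.
  by move=> l x Dx _; apply: unpickled_ge0 => s Ps; exact: a0.
by move=> l _; exact: measurable_unpickled.
Qed.

Lemma integral_esum (mu : {measure set X -> \bar R}) (D : set X) P (a : T -> X -> \bar R) :
  measurable D -> (forall s x, P s -> D x -> 0 <= a s x) ->
  (forall s, P s -> measurable_fun D (a s)) ->
  \int[mu]_(x in D) (\esum_(s in P) a s x) = \esum_(s in P) \int[mu]_(x in D) a s x.
Proof.
move=> mD a0 ma.
rewrite (eq_integral (fun x => \sum_(l <oo) unpickled P (a ^~ x) l)); last first.
  by move=> x /set_mem Dx; rewrite esum_countable// => s Ps; exact: a0.
rewrite integral_nneseries//; last 2 first.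
- by move=> l; exact: measurable_unpickled.
- by move=> l x Dx; apply: unpickled_ge0 => s Ps; exact: a0.
rewrite esum_countable; last by move=> s Ps; apply: integral_ge0 => x Dx; exact: a0.
apply: eq_eseriesr => l _; rewrite /unpickled; case: pickle_inv => [s|].
  by have [Ps|_] := boolP (s \in P); rewrite ?integral0.
by rewrite integral0.
Qed.

End integral.
End countable_sums.

Section product_sums.
Context {R : realType} {J : finType}.
Local Open Scope ereal_scope.
Local Notation S := {ffun J -> nat}.

Let insert (j : J) (p : nat * S) : S := [ffun i => if i == j then p.1 else p.2 i].

(** Induction on l. As j does not occur in l, [insert] identifies functions supported in j :: l with
    pairs of a value at j and a function supported in l; nonnegativity then allows iterated
    summation. *)
Lemma esum_prod_seq (l : seq J) (f : J -> nat -> R) (F : J -> R) : uniq l ->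
  (forall j n, 0 <= f j n)%R -> (forall j, j \in l -> \esum_(n in [set: nat]) (f j n)%:E = (F j)%:E) ->
  \esum_(s in [set s : S | forall j, j \notin l -> s j = 0%N]) (\prod_(j <- l) f j (s j))%:E
  = (\prod_(j <- l) F j)%:E.
Proof.
move=> + f0; elim: l => [_ _|j l IH /= /andP[jl ul] fF].
  rewrite (_ : [set s | _] = [set [ffun=> 0%N]]); last first.
    apply/seteqP; split => s /= => [h|-> j _]; last by rewrite ffunE.
    by apply/ffunP => j; rewrite ffunE h.
  by rewrite esum_set1 ?big_nil// lee_fin.
have pf0 (k : seq J) (s : S) : (0 <= (\prod_(j <- k) f j (s j))%:E :> \bar R).
  by rewrite lee_fin prodr_ge0.
pose P := [set s : S | forall j, j \notin l -> s j = 0%N].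
rewrite (@reindex_esum _ _ _ ([set: nat] `*`` (fun=> P)) _ (insert j)); last first.
  split.
  - move=> [n s] /= [_ hs] i; rewrite inE negb_or => /andP[ij il].
    by rewrite /insert ffunE (negbTE ij) hs.
  - move=> [n s] [n' s'] /set_mem[/= _ hs] /set_mem[/= _ hs'] /ffunP h.
    congr pair; first by have := h j; rewrite !ffunE eqxx.
    apply/ffunP => i; have := h i; rewrite !ffunE; case: eqVneq => // -> _.
    by rewrite hs ?hs'.
  - move=> s hs; exists (s j, [ffun i => if i == j then 0%N else s i]) => /=.
      split => // i il; rewrite ffunE; case: eqVneq => // ij; apply: hs.
      by rewrite inE negb_or ij.
    by apply/ffunP => i; rewrite !ffunE; case: eqVneq => [->|].
rewrite (eq_esum (b := fun k : nat * S => (f j k.1 * \prod_(i <- l) f i (k.2 i))%:E)); last first.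
  move=> [n s] [_ Ps]; rewrite big_cons /insert ffunE eqxx/=; congr (_ * _)%:E.
  apply: eq_big_seq => i il; rewrite ffunE; case: eqVneq => // ij.
  by rewrite ij (negbTE jl) in il.
rewrite -(@esum_esum _ _ _ _ (fun=> P) (fun n s => (f j n * \prod_(i <- l) f i (s i))%:E)); last first.
  by move=> n s _ _; rewrite EFinM mule_ge0// lee_fin.
rewrite (eq_esum (b := fun n => (\prod_(i <- l) F i)%:E * (f j n)%:E)); last first.
  move=> n _; under eq_esum do rewrite EFinM.
  rewrite esumZl ?IH//; first by rewrite muleC.
  by move=> i il; apply: fF; rewrite inE il orbT.
rewrite esumZl//.
- by rewrite fF ?mem_head// big_cons -EFinM mulrC.
- by move=> n _; rewrite lee_fin.
- rewrite big_seq; apply: prodr_ge0 => i il.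
  rewrite -lee_fin -fF; last by rewrite inE il orbT.
  by apply: esum_ge0 => n _; rewrite lee_fin.
Qed.

Lemma esum_prod (A : {set J}) (f : J -> nat -> R) (F : J -> R) :
  (forall j n, 0 <= f j n)%R ->
  (forall j, j \in A -> \esum_(n in [set: nat]) (f j n)%:E = (F j)%:E) ->
  \esum_(s in [set s : S | forall j, j \notin A -> s j = 0%N]) (\prod_(j in A) f j (s j))%:E
  = (\prod_(j in A) F j)%:E.
Proof.
move=> f0 fF; have := @esum_prod_seq (enum A) f F (enum_uniq _) f0.
have -> : [set s : S | forall j, j \notin enum A -> s j = 0%N] =
          [set s : S | forall j, j \notin A -> s j = 0%N].
  by apply/seteqP; split => s /= h j jA; apply: h; move: jA; rewrite mem_enum.
rewrite big_enum/= => <- => [|j]; last by rewrite mem_enum; exact: fF.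
by apply: eq_esum => s _; rewrite big_enum.
Qed.

End product_sums.

Section poisson.
Context {R : realType}.
Local Open Scope ereal_scope.

(** Weighting Poisson(r) by y^n gives exp(r (y - 1)) times Poisson(r y), whose total mass is 1. *)
Lemma poisson_mgf (r y : R) : (0 < r)%R -> (0 < y)%R ->
  \esum_(n in [set: nat]) (poisson_pmf r n * y ^+ n)%:E = (expR (r * (y - 1)))%:E.
Proof.
move=> r0 y0; have ry0 : (0 < r * y)%R by rewrite mulr_gt0.
have <- : ((expR (r * (y - 1)))%:E * (\esum_(n in [set: nat]) (poisson_pmf (r * y) n)%:E)
    = (expR (r * (y - 1)))%:E)%E.
  have : poisson_prob (r * y) 0 [set: nat] = 1 by exact: probability_setT.
  by rewrite /poisson_prob ry0 => ->; rewrite mule1.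
rewrite -esumZl ?expR_ge0//; last by move=> n _; rewrite lee_fin poisson_pmf_ge0.
apply: eq_esum => n _; rewrite -EFinM /poisson_pmf r0 ry0; congr _%:E.
rewrite exprMn (_ : - (r * y) = - r - r * (y - 1))%R; last by ring.
rewrite expRD [expR (- (r * _))]expRN.
have e0 : expR (r * (y - 1)) != 0%R by rewrite gt_eqF// expR_gt0.
have n0 : (n`!%:R : R) != 0%R by rewrite pnatr_eq0 -lt0n fact_gt0.
move: (expR (r * (y - 1))) (n`!%:R : R) (r ^+ n)%R (y ^+ n)%R e0 n0 => e q x z e0 q0.
by field; rewrite e0 q0.
Qed.

Lemma poisson_prod_mgf (J : finType) (A : {set J}) (r y : J -> R) :
  (forall j, j \in A -> 0 < r j)%R -> (forall j, j \in A -> 0 < y j)%R ->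
  \esum_(s in [set s : {ffun J -> nat} | forall j, j \notin A -> s j = 0%N])
    (\prod_(j in A) (poisson_pmf (r j) (s j) * y j ^+ s j))%:E
  = (expR (\sum_(j in A) r j * (y j - 1)))%:E.
Proof.
move=> r0 y0.
pose f j n : R := if j \in A then (poisson_pmf (r j) n * y j ^+ n)%R else 0%R.
rewrite (eq_esum (b := fun s : {ffun J -> nat} => (\prod_(j in A) f j (s j))%:E)); last first.
  by move=> s _; congr _%:E; apply: eq_bigr => j jA; rewrite /f jA.
rewrite (@esum_prod _ _ _ f (fun j => expR (r j * (y j - 1)))).
- by rewrite expR_sum.
- move=> j n; rewrite /f; case: ifPn => // jA.
  by rewrite mulr_ge0 ?poisson_pmf_ge0// exprn_ge0// ltW// y0.
- by move=> j jA; rewrite /f jA poisson_mgf ?r0 ?y0.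
Qed.

End poisson.

(** * Single-site chains *)

Section density_integral.
Context d (T : measurableType d) (R : realType).
Variable mu : {measure set T -> \bar R}.
Variables (D : set T) (mD : measurable D).
Variables (f : T -> R) (mf : measurable_fun D f).
Hypothesis f_ge0 : forall x, D x -> 0 <= f x.
Local Notation nu := (density_measure mu mD mf f_ge0).
Local Open Scope ereal_scope.
Import HBNNSimple.

Let mfE : measurable_fun D (EFin \o f).
Proof. exact/measurable_EFinP. Qed.

Let integral_density_nnsfun (h : {nnsfun T >-> R}) :
  \int[nu]_x (h x)%:E = \int[mu]_(x in D) ((f x)%:E * (h x)%:E).
Proof.
under [LHS]eq_integral do rewrite fimfunE -fsumEFin//.
rewrite [LHS]ge0_integral_fsum//; last 2 first.
  - by move=> r; exact/measurable_EFinP/measurableT_comp.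
  - by move=> n x _; rewrite EFinM nnfun_muleindic_ge0.
under [RHS]eq_integral.
  move=> x xD; rewrite fimfunE -fsumEFin// ge0_mule_fsumr; last first.
    by move=> r; rewrite EFinM nnfun_muleindic_ge0.
  over.
rewrite [RHS]ge0_integral_fsum//; last 2 first.
  - move=> r; apply: emeasurable_funM => //.
    apply/measurable_EFinP/measurable_funTS; apply: measurable_funM => //.
  - move=> r x Dx; rewrite mule_ge0 ?lee_fin ?f_ge0//.
    by rewrite -lee_fin EFinM nnfun_muleindic_ge0.
apply: eq_fsbigr => r /set_mem[x _ <-{r}].
have mh : measurable (h @^-1` [set h x]) by [].
rewrite integralZl_indic_nnsfun// integral_indic// setIT.
transitivity ((h x)%:E * \int[mu]_(y in D) ((f y)%:E * (\1_(h @^-1` [set h x]) y)%:E)); last first.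
  rewrite -ge0_integralZl//.
  - by apply: eq_integral => y _; rewrite EFinM muleCA.
  - by apply: emeasurable_funM => //; exact/measurable_EFinP/measurable_indic.
  - by move=> y Dy; rewrite mule_ge0 ?lee_fin ?f_ge0.
  by rewrite lee_fin.
congr (_ * _); rewrite -[LHS]/(\int[mu]_(y in D `&` (h @^-1` [set h x])) (f y)%:E).
rewrite integral_mkcondr.
by under eq_integral do rewrite epatch_indic.
Qed.

Lemma ge0_integral_density (g : T -> \bar R) : measurable_fun setT g ->
  (forall x, 0 <= g x) ->
  \int[nu]_x g x = \int[mu]_(x in D) ((f x)%:E * g x).
Proof.
move=> mg g0; pose g_ := nnsfun_approx measurableT mg.
transitivity (limn (fun n => \int[nu]_x (g_ n x)%:E)).
  rewrite -monotone_convergence//=.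
  - by apply: eq_integral => ? /[!inE] xD; apply/esym/cvg_lim => //=; exact: cvg_nnsfun_approx.
  - by move=> n; exact/measurable_EFinP/measurable_funTS.
  - by move=> n ? _; rewrite lee_fin.
  - by move=> ? _ ? ? mn; rewrite lee_fin; exact/lefP/nd_nnsfun_approx.
under eq_fun do rewrite integral_density_nnsfun.
rewrite -monotone_convergence//=.
- apply: eq_integral => x /set_mem Dx; apply/cvg_lim => //=.
  by apply: cvgeZl => //; exact: cvg_nnsfun_approx.
- move=> n; apply: emeasurable_funM => //.
  exact/measurable_EFinP/measurable_funTS.
- by move=> n x Dx; rewrite mule_ge0 ?lee_fin ?f_ge0.
- move=> x Dx p q pq; apply: lee_wpmul2l; first by rewrite lee_fin f_ge0.
  by rewrite lee_fin; exact/lefP/nd_nnsfun_approx.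
Qed.

End density_integral.

(** * Lebesgue measure on tuples and resampling of a coordinate *)

Section tuple_coordinates.
Context {R : realType}.
Implicit Types (n : nat) (v y : R).
Local Notation mu := (@lebesgue_measure R).
Local Notation RB := (measurableTypeR R).

Lemma measurable_update n (i : 'I_n) :
  measurable_fun [set: state R n * RB] (fun p => update p.1 i p.2).
Proof.
apply/measurable_fun_tnthP => j; rewrite /comp.
apply: (eq_measurable_fun (fun p : state R n * RB => if j == i then p.2 else tnth p.1 j)).
  by move=> p _; rewrite tnth_mktuple.
case: (j == i); first exact: measurable_snd.
by apply: (measurableT_comp (measurable_tnth j)); exact: measurable_fst.
Qed.

Lemma measurable_update_slice n (i : 'I_n) x : measurable_fun setT (update x i : RB -> state R n).
Proof. exact: (measurableT_comp (measurable_update i) (@pair1_measurable _ _ _ RB x)). Qed.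

Lemma measurable_update_preimage n (i : 'I_n) x (B : set (state R n)) :
  measurable B -> measurable (update x i @^-1` B : set RB).
Proof.
by move=> mB; rewrite -[X in measurable X]setTI; exact: measurable_update_slice.
Qed.

Lemma tnth_update n (x : state R n) i v l :
  tnth (update x i v) l = if l == i then v else tnth x l.
Proof. by rewrite tnth_mktuple. Qed.

Lemma update_update n (x : state R n) i v w : update (update x i v) i w = update x i w.
Proof. by apply: eq_from_tnth => l; rewrite !tnth_update; case: eqP. Qed.

Lemma update_id n (x : state R n) i : update x i (tnth x i) = x.
Proof. by apply: eq_from_tnth => l; rewrite !tnth_update; case: eqP => // ->. Qed.

Local Open Scope ereal_scope.

Lemma integral_lebesgue_cons n (g : state R n.+1 -> \bar R) :
  measurable_fun setT g -> (forall x, 0 <= g x) ->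
  \int[lebesgue_tuple R n.+1]_x g x =
  \int[mu]_y \int[lebesgue_tuple R n]_x g (state_cons (y, x)).
Proof.
move=> mg g0.
have mc := @measurable_state_cons R n.
transitivity (\int[(lebesgue_measure \x lebesgue_tuple R n)]_z (g \o @state_cons R n) z).
  have := @ge0_integral_pushforward _ _ _ _ R _ mc (lebesgue_measure \x lebesgue_tuple R n)
    setT g measurableT mg (fun x _ => g0 x).
  by rewrite preimage_setT.
by rewrite fubini_tonelli1//; [exact: (measurableT_comp mg mc)|move=> p; exact: g0].
Qed.

Lemma update_cons0 n (x : state R n) y v :
  update (state_cons (y, x)) ord0 v = state_cons (v, x).
Proof.
apply: eq_from_tnth => l; rewrite tnth_update; case: (unliftP ord0 l) => [j ->|->] //.
by rewrite !tnthS.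
Qed.

Lemma update_consS n (x : state R n) y v i :
  update (state_cons (y, x)) (lift ord0 i) v = state_cons (y, update x i v).
Proof.
apply: eq_from_tnth => l; rewrite tnth_update; case: (unliftP ord0 l) => [j ->|->] //.
rewrite !tnthS /= tnth_update (inj_eq lift_inj).
by [].
Qed.

(* Resampling one coordinate of a Lebesgue distributed point: the pair (old
   point, new value) and its reversal have the same law. *)
Lemma integral_swap n (i : 'I_n) (H : state R n * RB -> \bar R) :
  measurable_fun setT H -> (forall p, 0 <= H p) ->
  \int[lebesgue_tuple R n]_x \int[mu]_v H (x, v) =
  \int[lebesgue_tuple R n]_x \int[mu]_v H (update x i v, tnth x i).
Proof.
elim: n i H => [[]//|n IH] i H mH H0.
have mupd : measurable_fun setT (fun p : state R n.+1 * RB => H (update p.1 i p.2, tnth p.1 i)).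
  apply: measurableT_comp => //; apply/measurable_fun_pair => /=.
    exact: measurable_update.
  by apply: (measurableT_comp (measurable_tnth i)); exact: measurable_fst.
have mF1 := @measurable_fun_fubini_tonelli_F _ _ _ _ _ (mu : {sigma_finite_measure set RB -> \bar R}) _ mH H0.
have mF2 := @measurable_fun_fubini_tonelli_F _ _ _ _ _ (mu : {sigma_finite_measure set RB -> \bar R}) _ mupd (fun p => H0 _).
rewrite (integral_lebesgue_cons mF1); last by move=> x; apply: integral_ge0.
rewrite (integral_lebesgue_cons mF2); last by move=> x; apply: integral_ge0.
rewrite /fubini_F.
have [j ->|->] := unliftP ord0 i.
  apply: eq_integral => y _.
  pose Hy (p : state R n * RB) := H (state_cons (y, p.1), p.2).
  have mHy : measurable_fun setT Hy.
    apply: measurableT_comp => //; apply/measurable_fun_pair => /=; last exact: measurable_snd.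
    apply: (measurableT_comp (@measurable_state_cons R n)).
    by apply/measurable_fun_pair => //=; exact: measurable_fst.
  rewrite (IH j Hy mHy (fun p => H0 _)); apply: eq_integral => x _.
  by apply: eq_integral => v _; rewrite /Hy /= update_consS tnthS.
(* When the head is resampled, the tail is integrated out first. Exchanging y and v is then Tonelli
   in the plane, framed by two exchanges with the integral over the tail. *)
pose A (y v : R) := \int[lebesgue_tuple R n]_x H (state_cons (y, x), v).
have mH3 : measurable_fun setT (fun q : (RB * RB) * state R n => H (state_cons (q.1.1, q.2), q.1.2)).
  apply: measurableT_comp => //; apply/measurable_fun_pair => /=; last first.
    by apply: (measurableT_comp measurable_snd); exact: measurable_fst.
  apply: (measurableT_comp (@measurable_state_cons R n)).
  apply/measurable_fun_pair => //=.
  by apply: (measurableT_comp measurable_fst); exact: measurable_fst.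
have mA : measurable_fun setT (fun q : RB * RB => A q.1 q.2).
  exact: (@measurable_fun_fubini_tonelli_F _ _ _ _ _ (lebesgue_tuple R n) _ mH3 (fun p => H0 _)).
have A0 y v : 0 <= A y v by apply: integral_ge0.
transitivity (\int[mu]_y \int[mu]_v A y v).
  apply: eq_integral => y _.
  apply: (@fubini_tonelli _ _ _ _ _ (lebesgue_tuple R n) mu (fun p => H (state_cons (y, p.1), p.2))) => //.
  apply: measurableT_comp => //; apply/measurable_fun_pair => /=; last exact: measurable_snd.
  apply: (measurableT_comp (@measurable_state_cons R n)).
  by apply/measurable_fun_pair => //=; exact: measurable_fst.
transitivity (\int[mu]_y \int[mu]_v A v y).
  exact: (@fubini_tonelli _ _ _ _ _ mu mu (fun q => A q.1 q.2)).
apply: eq_integral => y _.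
rewrite -[LHS](@fubini_tonelli _ _ _ _ _ (lebesgue_tuple R n) mu (fun p => H (state_cons (p.2, p.1), y))).
- apply: eq_integral => x _; apply: eq_integral => v _.
  by rewrite /= update_cons0.
- apply: measurableT_comp => //; apply/measurable_fun_pair => //=.
  apply: (measurableT_comp (@measurable_state_cons R n)).
  by apply/measurable_fun_pair; [exact: measurable_snd|exact: measurable_fst].
- by move=> p; exact: H0.
Qed.

End tuple_coordinates.

Section site_kernel.
Context {R : realType} (n : nat).
Local Notation mu := (@lebesgue_measure R).
Local Notation RB := (measurableTypeR R).
Variables (n0 : (0 < n)%N) (D : set (state R n)) (mD : measurable D).
Variables (psi : 'I_n -> state R n * RB -> \bar R) (hold : 'I_n -> state R n -> R).
Hypotheses (mpsi : forall i, measurable_fun setT (psi i)) (psi0 : forall i p, (0 <= psi i p)%E).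
Hypotheses (mhold : forall i, measurable_fun setT (hold i)) (hold0 : forall i x, 0 <= hold i x).
Hypothesis mass : forall i x, D x -> (\int[mu]_v psi i (x, v) + (hold i x)%:E = 1)%E.
Local Open Scope ereal_scope.

Definition site i (x : state R n) (B : set (state R n)) : \bar R :=
  \int[mu]_(v in update x i @^-1` B) psi i (x, v) + (hold i x)%:E * \d_x B.

(** A kernel must be a probability at every tuple, while the chain lives on D only; staying put
    elsewhere is harmless because the target has no mass there. *)
Definition site_mixture (x : state R n) (B : set (state R n)) : \bar R :=
  if x \in D then \sum_(i < n) (n%:R^-1)%:E * site i x B else \d_x B.

Let mpsix i (x : state R n) : measurable_fun setT (fun v : RB => psi i (x, v)).
Proof. exact: measurableT_comp (mpsi i) (@pair1_measurable _ _ _ RB x). Qed.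

Let site_ge0 i x B : 0 <= site i x B.
Proof.
by apply: adde_ge0; [apply: integral_ge0|rewrite mule_ge0// lee_fin].
Qed.

Let mix0 x : site_mixture x set0 = 0.
Proof.
rewrite /site_mixture; case: ifPn => _; last by rewrite measure0.
apply: big1 => i _; rewrite /site preimage_set0 integral_set0 measure0.
by rewrite mule0 adde0 mule0.
Qed.

Let mix_ge0 x B : 0 <= site_mixture x B.
Proof.
rewrite /site_mixture; case: ifPn => _ //.
by apply: sume_ge0 => i _; rewrite mule_ge0// lee_fin.
Qed.

Let site_bigcup i x (F : (set (state R n))^nat) : (forall k, measurable (F k)) ->
  trivIset setT F -> measurable (\bigcup_k F k) ->
  site i x (\bigcup_k F k) = \sum_(k <oo) site i x (F k).
Proof.
move=> mF tF mUF; rewrite nneseriesD; last 2 first.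
- by move=> k _ _; apply: integral_ge0.
- by move=> k _ _; rewrite mule_ge0// lee_fin.
rewrite /site preimage_bigcup ge0_integral_bigcup//; last 3 first.
- by move=> k; exact: measurable_update_preimage.
- exact: measurable_funTS.
- apply/trivIsetP => k l _ _ kl; rewrite -preimage_setI.
  by move/trivIsetP : tF => /(_ k l Logic.I Logic.I kl) ->; rewrite preimage_set0.
by rewrite nneseriesZl// measure_semi_bigcup.
Qed.

Let mix_sigma_additive x : semi_sigma_additive (site_mixture x).
Proof.
move=> F mF tF mUF; apply: cvg_toP.
  apply: ereal_nondecreasing_is_cvgn => p q pq.
  by apply: lee_sum_nneg_natr => // k _ _; exact: mix_ge0.
rewrite /site_mixture; case: ifPn => _; last by rewrite measure_semi_bigcup.
rewrite (@nneseries_sum _ _ _ _ (fun i k => (n%:R^-1)%:E * site i x (F k))); last first.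
  by move=> i k _; rewrite mule_ge0// lee_fin.
apply: eq_bigr => i _; rewrite nneseriesZl; last by move=> k _; exact: site_ge0.
by rewrite site_bigcup.
Qed.

Let msite i B : measurable B -> measurable_fun setT (fun x => site i x B).
Proof.
move=> mB; apply: emeasurable_funD; last first.
  apply: emeasurable_funM; first exact/measurable_EFinP.
  exact: measurable_fun_dirac.
pose h (p : state R n * RB) := psi i p * (\1_B (update p.1 i p.2))%:E.
have mh : measurable_fun setT h.
  apply: emeasurable_funM => //; apply/measurable_EFinP.
  apply: (measurableT_comp (measurable_indic _)) => //.
  exact: measurable_update.
have h0 p : 0 <= h p by rewrite mule_ge0// lee_fin.
apply: (eq_measurable_fun (fubini_F (mu : {sigma_finite_measure set RB -> \bar R}) h)).
  move=> x _; rewrite /fubini_F /h /= [RHS]integral_mkcond.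
  apply: eq_integral => v _; rewrite patchE indicE.
  rewrite (_ : (v \in _) = (update x i v \in B)).
    by case: ifPn => _; rewrite ?mule1 ?mule0.
  by apply/idP/idP => /set_mem hB; exact/mem_set.
exact: measurable_fun_fubini_tonelli_F.
Qed.

Let mmix B : measurable B -> measurable_fun setT (site_mixture ^~ B).
Proof.
move=> mB; apply: measurable_fun_if => //.
- by apply: (measurable_fun_bool true); rewrite setTI preimage_mem_true.
- apply: measurable_funTS; apply: emeasurable_sum => i _.
  by apply: emeasurable_funM => //; exact: msite.
- by apply: measurable_funTS; exact: measurable_fun_dirac.
Qed.

Let mix1 x : site_mixture x setT = 1.
Proof.
rewrite /site_mixture; case: ifPn => [/set_mem Dx|_]; last by rewrite diracT.
rewrite (eq_bigr (fun=> (n%:R^-1)%:E)); last first.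
  by move=> i _; rewrite /site preimage_setT diracT mule1 mass// mule1.
by rewrite sumEFin sumr_const card_ord -[(_ *+ n)%R]mulr_natr mulVf// pnatr_eq0 -lt0n.
Qed.

Lemma site_kernel_exists :
  exists k : R.-pker (state R n) ~> (state R n), forall x B, k x B = site_mixture x B.
Proof.
pose m x : {measure set (state R n) -> \bar R} := HB.pack (site_mixture x)
  (isMeasure.Build _ _ _ (site_mixture x) (mix0 x) (mix_ge0 x) (@mix_sigma_additive x)).
pose k0 : R.-ker (state R n) ~> (state R n) := HB.pack m (isKernel.Build _ _ _ _ R m mmix).
pose k : R.-pker (state R n) ~> (state R n) :=
  HB.pack m (isKernel.Build _ _ _ _ R m mmix) (Kernel_isProbability.Build _ _ _ _ R k0 mix1).
by exists k.
Qed.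

End site_kernel.

Section site_mixture_domination.
Context {R : realType} (n : nat).
Local Notation mu := (@lebesgue_measure R).
Local Notation RB := (measurableTypeR R).
Variables (D : set (state R n)).
Variables (psi psi' : 'I_n -> state R n * RB -> \bar R) (hold : 'I_n -> state R n -> R).
Hypotheses (mpsi : forall i, measurable_fun setT (psi i)) (psi0 : forall i p, (0 <= psi i p)%E).
Hypotheses (mpsi' : forall i, measurable_fun setT (psi' i)) (psi'0 : forall i p, (0 <= psi' i p)%E).
Hypothesis (hold0 : forall i x, 0 <= hold i x).
Variable c : R.
Hypotheses (c1 : c <= 1) (dom : forall i x v, D x -> (c%:E * psi' i (x, v) <= psi i (x, v))%E).
Local Open Scope ereal_scope.

Lemma site_mixture_le (x : state R n) (B : set (state R n)) : measurable B ->
  c%:E * site_mixture D psi' (fun=> cst 0%R) x B <= site_mixture D psi hold x B.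
Proof.
move=> mB.
have int0 (f : 'I_n -> state R n * RB -> \bar R) (A : set RB) i :
    (forall i p, 0 <= f i p) -> 0 <= \int[mu]_(v in A) f i (x, v).
  by move=> f0; apply: integral_ge0 => v _.
have site0 (h : 'I_n -> state R n -> R) (f : 'I_n -> state R n * RB -> \bar R) i :
    (forall i x, 0 <= h i x)%R -> (forall i p, 0 <= f i p) ->
    0 <= (n%:R^-1)%:E * site f h i x B.
  by move=> h0 f0; rewrite mule_ge0 ?lee_fin// adde_ge0 ?int0// mule_ge0 ?lee_fin.
(* Outside D both kernels are the same Dirac mass, and c <= 1 settles the comparison. Inside D a
   negative c is trivial by sign. *)
rewrite /site_mixture; case: ifPn => [/set_mem xD|_]; last first.
  by rewrite -[leRHS]mul1e lee_wpmul2r// lee_fin.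
have [c0|c0] := leP 0%R c; last first.
  apply: (@le_trans _ _ 0); first by rewrite mule_le0_ge0 ?lee_fin ?(ltW c0) ?sume_ge0// => i _; exact: site0.
  by apply: sume_ge0 => i _; exact: site0.
rewrite ge0_sume_distrr; last by move=> i _; exact: site0.
apply: lee_sum => i _; rewrite muleCA lee_wpmul2l ?lee_fin// /site mul0e adde0.
have mupd := measurable_update_preimage i x mB.
have mslice (f : 'I_n -> state R n * RB -> \bar R) : (forall i, measurable_fun setT (f i)) ->
    measurable_fun (update x i @^-1` B : set RB) (fun v => f i (x, v)).
  move=> mf; apply: measurable_funTS.
  exact: (measurableT_comp (mf i) (@pair1_measurable _ _ _ RB x)).
rewrite -ge0_integralZl//; last exact: mslice.
apply: (@le_trans _ _ (\int[mu]_(v in update x i @^-1` B) psi i (x, v))); last first.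
  by rewrite leeDl// mule_ge0 ?lee_fin.
apply: ge0_le_integral => //.
- by move=> v _; rewrite mule_ge0.
- by apply: measurable_funeM; exact: mslice.
- exact: mslice.
- by move=> v _; exact: dom.
Qed.

End site_mixture_domination.

Section reversible_site_kernel.
Context {R : realType} (n : nat).
Local Notation mu := (@lebesgue_measure R).
Local Notation RB := (measurableTypeR R).
Local Notation leb := (lebesgue_tuple R n).
Variables (D : set (state R n)) (mD : measurable D).
Variables (f : state R n -> R) (mf : measurable_fun D f).
Hypothesis f0 : forall x, D x -> 0 <= f x.
Variables (psi : 'I_n -> state R n * RB -> \bar R) (hold : 'I_n -> state R n -> R).
Hypotheses (mpsi : forall i, measurable_fun setT (psi i)) (psi0 : forall i p, (0 <= psi i p)%E).
Hypotheses (mhold : forall i, measurable_fun setT (hold i)) (hold0 : forall i x, 0 <= hold i x).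
Variable P : R.-pker (state R n) ~> (state R n).
Hypothesis PE : forall x B, measurable B -> P x B = site_mixture D psi hold x B.
Local Notation nu := (density_measure leb mD mf f0).
Local Open Scope ereal_scope.

Let fD : state R n -> R := f \_ D.

Hypothesis balance : forall i x v,
  (fD x)%:E * psi i (x, v) = (fD (update x i v))%:E * psi i (update x i v, tnth x i).

Let fD0 x : (0 <= fD x)%R.
Proof. by rewrite /fD patchE; case: ifPn => // /set_mem; exact: f0. Qed.

Let mfD : measurable_fun setT fD.
Proof. exact/(measurable_restrictT f mD). Qed.

Let move_flow i B C : \bar R := \int[leb]_x \int[mu]_v
  ((fD x)%:E * psi i (x, v) * ((\1_B x)%:E * (\1_C (update x i v))%:E)).

Let mflow i B C : measurable B -> measurable C -> measurable_fun setT
  (fun p : state R n * RB => (fD p.1)%:E * psi i p * ((\1_B p.1)%:E * (\1_C (update p.1 i p.2))%:E)).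
Proof.
move=> mB mC; apply: emeasurable_funM; apply: emeasurable_funM => //.
- by apply/measurable_EFinP; apply: (measurableT_comp mfD).
- by apply/measurable_EFinP; apply: (measurableT_comp (measurable_indic _)).
- by apply/measurable_EFinP; apply: (measurableT_comp (measurable_indic _)) => //; exact: measurable_update.
Qed.

Let flow_ge0 i B C p : 0 <=
  (fD p.1)%:E * psi i p * ((\1_B p.1)%:E * (\1_C (update p.1 i p.2))%:E).
Proof. by rewrite !mule_ge0// lee_fin. Qed.

(** [integral_swap] exchanges the old point with the new one, which interchanges B and C; [balance]
    says that the density of the flow is unchanged. *)
Let move_flowC i B C : measurable B -> measurable C -> move_flow i B C = move_flow i C B.
Proof.
move=> mB mC; rewrite /move_flow.
rewrite (integral_swap i (mflow i mB mC)); last by move=> p; exact: flow_ge0.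
apply: eq_integral => x _; apply: eq_integral => v _ /=.
by rewrite -balance update_update update_id [in X in _ * X]muleC.
Qed.

Let integral_step B C : measurable B -> measurable C ->
  \int[nu]_(x in B) P x C = \sum_(i < n) ((n%:R^-1)%:E * (move_flow i B C +
    \int[leb]_x ((fD x)%:E * (hold i x)%:E * ((\1_B x)%:E * (\1_C x)%:E)))).
Proof.
move=> mB mC; have mPC := measurable_kernel P C mC.
rewrite integral_mkcond ge0_integral_density; last 2 first.
- by apply/(measurable_restrictT _ mB); exact: measurable_funTS mPC.
- by move=> x; rewrite patchE; case: ifPn.
rewrite integral_mkcond.
have mm i : measurable_fun setT (fun x => \int[mu]_v ((fD x)%:E * psi i (x, v) *
    ((\1_B x)%:E * (\1_C (update x i v))%:E))).
  exact: (@measurable_fun_fubini_tonelli_F _ _ _ _ _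
    (mu : {sigma_finite_measure set RB -> \bar R}) _ (mflow i mB mC) (@flow_ge0 i B C)).
have mh i : measurable_fun setT (fun x => (fD x)%:E * (hold i x)%:E * ((\1_B x)%:E * (\1_C x)%:E)).
  by apply: emeasurable_funM; apply: emeasurable_funM => //; exact/measurable_EFinP.
have m0 i x : 0 <= \int[mu]_v ((fD x)%:E * psi i (x, v) * ((\1_B x)%:E * (\1_C (update x i v))%:E)).
  by apply: integral_ge0 => v _; exact: (@flow_ge0 i B C (x, v)).
have h0 i x : 0 <= (fD x)%:E * (hold i x)%:E * ((\1_B x)%:E * (\1_C x)%:E).
  by rewrite !mule_ge0// lee_fin.
transitivity (\int[leb]_x \sum_(i < n) ((n%:R^-1)%:E * (
   \int[mu]_v ((fD x)%:E * psi i (x, v) * ((\1_B x)%:E * (\1_C (update x i v))%:E)) +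
   (fD x)%:E * (hold i x)%:E * ((\1_B x)%:E * (\1_C x)%:E)))).
  apply: eq_integral => x _; rewrite patchE.
  have [/set_mem Dx|Dx] := boolP (x \in D); last first.
    rewrite big1// => i _; rewrite /fD patchE (negbTE Dx) !mul0e adde0 integral0_eq ?mule0//.
    by move=> v _; rewrite !mul0e.
  rewrite patchE; have [/set_mem Bx|Bx] := boolP (x \in B); last first.
    have B0 : \1_B x = 0%R :> R by rewrite indicE (negbTE Bx).
    rewrite mule0 big1// => i _; rewrite B0 !mul0e !mule0 adde0.
    by rewrite integral0_eq ?mule0// => v _; rewrite mul0e mule0.
  rewrite PE// /site_mixture mem_set// ge0_sume_distrr; last first.
    move=> i _; rewrite mule_ge0 ?lee_fin//; apply: adde_ge0; first exact: integral_ge0.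
    by rewrite mule_ge0// lee_fin.
  apply: eq_bigr => i _; rewrite muleCA; congr (_ * _).
  rewrite /site muleDr//; last first.
    by rewrite ge0_adde_def// inE ?integral_ge0// mule_ge0// lee_fin.
  have fDx : fD x = f x by rewrite /fD patchE mem_set.
  have B1 : \1_B x = 1%R :> R by rewrite indicE mem_set.
  congr (_ + _); last by rewrite fDx B1 mul1e muleA diracE indicE.
  rewrite -ge0_integralZl//; last 3 first.
  - by rewrite -[X in measurable X]setTI; apply: (measurableT_comp (@measurable_update R n i) (@pair1_measurable _ _ _ RB x)).
  - by apply: measurable_funTS; exact: (measurableT_comp (mpsi i) (@pair1_measurable _ _ _ RB x)).
  - by rewrite lee_fin f0.
  rewrite integral_mkcond; apply: eq_integral => v _; rewrite patchE fDx B1 mul1e indicE.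
  rewrite (_ : (v \in _) = (update x i v \in C)).
    by case: ifPn => _; rewrite ?mule1 ?mule0.
  by apply/idP/idP => /set_mem hB; exact/mem_set.
rewrite ge0_integral_sum//; last 2 first.
- by move=> i; apply: emeasurable_funM => //; apply: emeasurable_funD.
- by move=> i x _; rewrite mule_ge0 ?lee_fin// adde_ge0.
apply: eq_bigr => i _; rewrite ge0_integralZl//; last 2 first.
- exact: emeasurable_funD.
- by move=> x _; rewrite adde_ge0.
by rewrite ge0_integralD.
Qed.

Lemma site_kernel_reversible : reversible nu P.
Proof.
move=> B C mB mC; rewrite !integral_step//; apply: eq_bigr => i _.
rewrite move_flowC//; congr (_ * (_ + _)).
by apply: eq_integral => x _; rewrite [in X in _ * X]muleC.
Qed.

End reversible_site_kernel.

(** * Reversibility and comparison of spectral gaps *)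

Section markov_comparison.
Context d (T : measurableType d) (R : realType).
Variable nu : {measure set T -> \bar R}.
Local Open Scope ereal_scope.

Lemma reversible_stationary (P : R.-pker T ~> T) : reversible nu P -> stationary nu P.
Proof.
move=> rev B mB; rewrite rev// (eq_integral (fun=> 1)).
  by rewrite integral_cst// mul1e.
by move=> x _; rewrite prob_kernel.
Qed.

Lemma dirichlet_form_ge0 (P : T -> {measure set T -> \bar R}) (f : T -> R) :
  0 <= dirichlet_form nu P f.
Proof.
rewrite /dirichlet_form mule_ge0 ?lee_fin//; apply: integral_ge0 => x _.
by apply: integral_ge0 => y _; rewrite lee_fin sqr_ge0.
Qed.

Lemma spectral_gap_ge0 (P : T -> {measure set T -> \bar R}) : 0 <= spectral_gap nu P.
Proof. by apply: le_ereal_inf_tmp => _ [f _ <-]; exact: dirichlet_form_ge0. Qed.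

(** Both infima range over the same test functions, and the Dirichlet form integrates a nonnegative
    function, so it is monotone in the kernel. For c <= 0 the left side is at most 0. *)
Lemma spectral_gap_le (P Q : R.-pker T ~> T) (c : R) :
  (forall x B, measurable B -> c%:E * Q x B <= P x B) ->
  c%:E * spectral_gap nu Q <= spectral_gap nu P.
Proof.
move=> cQP; have [c0|c0] := leP c 0%R.
  apply: (le_trans _ (spectral_gap_ge0 P)).
  by rewrite mule_le0_ge0 ?lee_fin ?spectral_gap_ge0.
apply: le_ereal_inf_tmp => _ [f [fL f1 f2] <-].
have mf : measurable_fun setT f.
  by move: fL; rewrite inE => /andP[+ _]; rewrite inE.
apply: (@le_trans _ _ (c%:E * dirichlet_form nu Q f)).
  rewrite lee_wpmul2l ?lee_fin ?(ltW c0)//.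
  by apply: ge_ereal_inf; exists (dirichlet_form nu Q f) => //; exists f.
have mk : measurable_fun setT (fun p : T * T => ((f p.1 - f p.2) ^+ 2)%:E).
  apply/measurable_EFinP; apply: measurable_funX; apply: measurable_funB.
    exact: measurableT_comp mf measurable_fst.
  exact: measurableT_comp mf measurable_snd.
have k0 (p : T * T) : 0 <= ((f p.1 - f p.2) ^+ 2)%:E by rewrite lee_fin sqr_ge0.
have mP (K : R.-pker T ~> T) : measurable_fun setT (fun x => \int[K x]_y ((f x - f y) ^+ 2)%:E).
  exact: (@measurable_fun_integral_finite_kernel _ _ _ _ R (fun p : T * T => ((f p.1 - f p.2) ^+ 2)%:E) K k0 mk).
rewrite /dirichlet_form muleCA lee_wpmul2l ?lee_fin ?invr_ge0//.
rewrite -ge0_integralZl//; last 2 first.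
- by move=> x _; apply: integral_ge0 => y _; exact: (k0 (x, y)).
- by rewrite lee_fin ltW.
apply: ge0_le_integral => //.
- move=> x _; rewrite mule_ge0 ?lee_fin ?(ltW c0)//.
  by apply: integral_ge0 => y _; exact: (k0 (x, y)).
- exact: emeasurable_funM.
move=> x _.
have mfx : measurable_fun setT (fun y => ((f x - f y) ^+ 2)%:E).
  exact: (measurableT_comp mk (@pair1_measurable _ _ _ T x)).
have fx0 y : 0 <= ((f x - f y) ^+ 2)%:E by exact: (k0 (x, y)).
rewrite -[c in c%:E](_ : (NngNum (ltW c0))%:num%R = c)//.
rewrite -ge0_integral_mscale//.
by apply: ge0_le_measure_integral => // B mB; exact: cQP.
Qed.

End markov_comparison.

(** * Inverse distribution function of a polynomial density *)

Section segment_integral.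
Context {R : realType} (a b : R).
Hypothesis ab : a < b.
Local Notation mu := (@lebesgue_measure R).
Local Notation RB := (measurableTypeR R).
Local Open Scope ereal_scope.

Let mab : measurable (`[a, b] : set RB) := measurable_itv `[a, b].

Let mu_ab : mu (`[a, b] : set RB) = (b - a)%:E.
Proof. by apply: (etrans (lebesgue_measure_itv `[a, b])); rewrite /= lte_fin ab. Qed.

Variables (f : RB -> R) (K : R).
Hypotheses (mf : measurable_fun (`[a, b] : set RB) f).
Hypothesis f1K : forall v, v \in `[a, b] -> (1 <= f v <= K)%R.

Lemma EFin_segment_integral :
  \int[mu]_(v in `[a, b]) (f v)%:E = (\int[mu]_(v in `[a, b]) f v)%R%:E.
Proof.
have f0 v : `[a, b]%classic v -> 0 <= (f v)%:E.
  by move=> /f1K/andP[h _]; rewrite lee_fin (le_trans ler01).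
have K0 : (0 <= K)%R.
  have /f1K/andP[h1 h2] : a \in `[a, b] by rewrite in_itv/= lexx ltW.
  by rewrite (le_trans ler01)// (le_trans h1).
rewrite /Rintegral fineK// ge0_fin_numE; last exact: integral_ge0.
apply: (@le_lt_trans _ _ (\int[mu]_(v in `[a, b]) K%:E)).
  apply: ge0_le_integral => //; first exact/measurable_EFinP.
  by move=> v /f1K/andP[_]; rewrite lee_fin.
by rewrite integral_cst//; apply: lte_mul_pinfty => //; rewrite [ltLHS]mu_ab ltry.
Qed.

Lemma segment_integral_gt0 : (0 < \int[mu]_(v in `[a, b]) f v)%R.
Proof.
rewrite -lte_fin -EFin_segment_integral.
apply: (@lt_le_trans _ _ (\int[mu]_(v in `[a, b]) 1)).
  by rewrite integral_cst// mul1e [ltRHS]mu_ab lte_fin subr_gt0.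
apply: ge0_le_integral => //; first exact/measurable_EFinP.
by move=> v /f1K/andP[h _]; rewrite lee_fin.
Qed.

End segment_integral.

Section polynomial_cdf.
Context {R : realType}.
Local Notation mu := (@lebesgue_measure R).
Implicit Types (p : {poly R}) (u v w : R).

Definition primitive p : {poly R} :=
  \poly_(i < (size p).+1) (if i is j.+1 then p`_j / j.+1%:R else 0).

Lemma deriv_primitive p : (primitive p)^`() = p.
Proof.
apply/polyP => i; rewrite coef_deriv coef_poly ltnS.
have [ip|pi] := ltnP i (size p); last by rewrite mul0rn nth_default.
by rewrite -[LHS]mulr_natr divfK// pnatr_eq0.
Qed.

(** Negativity persists near v. The interval is taken to the right of v, or to its left when v = b,
    so as to stay in [a, b]. *)
Lemma poly_lt0_itv a b p v : a < b -> v \in `[a, b] -> p.[v] < 0 ->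
  exists x y, [/\ a <= x, x < y, y <= b & forall c, c \in `]x, y[ -> p.[c] < 0].
Proof.
move=> ab; rewrite in_itv/= => /andP[av vb] pv.
have /cvgrPdist_lt/(_ (- p.[v])) := @continuous_horner _ p v.
rewrite oppr_gt0 => /(_ pv); rewrite near_nbhs => -/nbhs_ballP[e /= e0 He].
have neg c : `|v - c| < e -> p.[c] < 0.
  by move=> /He; rewrite ltr_norml => /andP[]; lra.
have e20 : 0 < e / 2 by rewrite divr_gt0.
have [vlb|bv] := ltP v b.
  exists v, (Num.min b (v + e / 2)); split => //.
  - by rewrite lt_min vlb ltrDl.
  - by rewrite ge_min lexx.
  - move=> c; rewrite in_itv/= lt_min => /and3P[vc _ ce]; apply: neg.
    by rewrite distrC ger0_norm ?subr_ge0 ?(ltW vc)//; lra.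
exists (Num.max a (b - e / 2)), b; split => //.
- by rewrite le_max lexx.
- by rewrite gt_max ab gtrBl.
- move=> c; rewrite in_itv/= gt_max => /andP[/andP[_ ce] cb]; apply: neg.
  have -> : v = b by apply/eqP; rewrite eq_le vb bv.
  by rewrite ger0_norm ?subr_ge0 ?(ltW cb)//; lra.
Qed.

Variables (a b : R) (p : {poly R}).
Hypotheses (ab : a < b) (pa : 0 < p.[a]).

Definition mass_upto v := (primitive p).[v] - (primitive p).[a].

Lemma integral_deriv_poly (q : {poly R}) v : a <= v ->
  (\int[mu]_(y in `[a, v]) (q^`().[y])%:E = (q.[v] - q.[a])%:E)%E.
Proof.
rewrite le_eqVlt => /predU1P[<-|av].
  by rewrite set_itv1 integral_set1 subrr.
rewrite (@continuous_FTC2 _ _ (horner q))//.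
- by apply: continuous_subspaceT => x; exact: continuous_horner.
- split.
  + by move=> x _; exact: derivable_horner.
  + by apply: cvg_at_right_filter; exact: continuous_horner.
  + by apply: cvg_at_left_filter; exact: continuous_horner.
- by move=> x _; rewrite -derivE.
Qed.

Lemma integral_poly v : a <= v ->
  (\int[mu]_(y in `[a, v]) (p.[y])%:E = (mass_upto v)%:E)%E.
Proof. by rewrite -{1}(deriv_primitive p); exact: integral_deriv_poly. Qed.

Lemma Rintegral_poly v : a <= v -> \int[mu]_(y in `[a, v]) p.[y] = mass_upto v.
Proof. by move=> av; rewrite /Rintegral integral_poly. Qed.

Definition cdf_poly : {poly R} :=
  (mass_upto b)^-1 *: (primitive p - (primitive p).[a]%:P).

Lemma cdf_polyE v : cdf_poly.[v] = (mass_upto b)^-1 * mass_upto v.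
Proof. by rewrite hornerZ hornerD hornerN hornerC. Qed.

Lemma deriv_cdf_poly : cdf_poly^`() = (mass_upto b)^-1 *: p.
Proof. by rewrite derivZ derivB derivC subr0 deriv_primitive. Qed.

(** [Fint], [Froot] and [well_posed] are [F_interp], [is_root] and [root_problem_well_posed] with an
    arbitrary polynomial p in place of the interpolant; the two versions agree by conversion. *)
Definition Fint v : R :=
  (\int[mu]_(y in `[a, b]) p.[y])^-1 * \int[mu]_(y in `[a, v]) p.[y].

Lemma FintE v : a <= v -> Fint v = cdf_poly.[v].
Proof. by move=> av; rewrite /Fint !Rintegral_poly ?cdf_polyE// ltW. Qed.

Definition Froot u v : Prop := v \in `[a, b] /\ Fint v = u.

Definition well_posed : Prop := forall u, 0 <= u <= 1 -> exists! v, Froot u v.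

Let cq := cdf_poly.

Let FrootE u v : Froot u v <-> v \in `[a, b] /\ cq.[v] = u.
Proof.
rewrite /Froot; split=> -[vab <-]; split => //; rewrite FintE//;
  by move: vab; rewrite in_itv/= => /andP[].
Qed.

Let cq_ivt v w u : v <= w -> Num.min cq.[v] cq.[w] <= u <= Num.max cq.[v] cq.[w] ->
  exists2 c, c \in `[v, w] & cq.[c] = u.
Proof.
by move=> vw; apply: IVT => //; apply: continuous_subspaceT => x; exact: continuous_horner.
Qed.

Let cq_mvt v w : v < w -> exists2 c, c \in `]v, w[ & cq.[w] - cq.[v] = cq^`().[c] * (w - v).
Proof.
move=> vw; apply: (@MVT _ (horner cq) (horner cq^`())) => //.
by apply: continuous_subspaceT => x; exact: continuous_horner.
Qed.

Let cqa : cq.[a] = 0.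
Proof. by rewrite cdf_polyE /mass_upto subrr mulr0. Qed.

Section well_posed_nonneg.
Hypothesis wp : well_posed.

Let uniq v w u : 0 <= u <= 1 -> v \in `[a, b] -> w \in `[a, b] ->
  cq.[v] = u -> cq.[w] = u -> v = w.
Proof.
move=> u01 vab wab cv cw; have [z [_ zu]] := wp u01.
by rewrite -(zu v) ?FrootE// -(zu w) ?FrootE.
Qed.

Let mass_neq0 : mass_upto b != 0.
Proof.
(* If the mass is 0, its inverse is 0 by convention, so [cq] vanishes identically and never takes
   the value 1. *)
apply/eqP => m0; have [|z [/FrootE[_ +] _]] := wp (u := 1); first by rewrite ler01 lexx.
by rewrite cdf_polyE m0 invr0 mul0r => /esym/eqP; rewrite oner_eq0.
Qed.

Let cqb : cq.[b] = 1.
Proof. by rewrite cdf_polyE mulVf. Qed.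

(** A descent would make some value in [0, 1] be taken twice. If cq(w) < 0, the value 0 of a returns
    to the right of w; if cq(w) lies in [0, 1], it was already taken up to v; if cq(w) > 1, the
    value 1 of b was already taken up to v. *)
Let cq_nondecreasing v w : a <= v -> v < w -> w <= b -> cq.[v] <= cq.[w].
Proof.
move=> av vw wb; rewrite leNgt; apply/negP => wv.
have inab z : a <= z -> z <= b -> z \in `[a, b] by move=> h1 h2; rewrite in_itv/= h1.
have aw : a < w := le_lt_trans av vw.
have vb : v < b := lt_le_trans vw wb.
have [w0|w0] := ltP cq.[w] 0.
  have [|c] := @cq_ivt w b 0 wb; first by rewrite ge_min (ltW w0)/= le_max cqb ler01 orbT.
  rewrite in_itv/= => /andP[wc cb] c0.
  have /eqP : a = c.
    apply: (uniq (u := 0)) => //; rewrite ?lexx ?ler01//; apply: inab => //; first exact: ltW.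
    exact: le_trans (ltW aw) wc.
  by rewrite lt_eqF// (lt_le_trans aw).
have [w1|w1] := leP cq.[w] 1.
  have [|c] := @cq_ivt a v cq.[w] av; first by rewrite cqa ge_min w0/= le_max (ltW wv) orbT.
  rewrite in_itv/= => /andP[ac cv] cw.
  have /eqP : c = w.
    apply: (uniq (u := cq.[w])) => //; rewrite ?w0//; apply: inab => //; last exact: ltW.
    exact: le_trans cv (ltW vb).
  by rewrite lt_eqF// (le_lt_trans cv).
have [|c] := @cq_ivt a v 1 av.
  by rewrite cqa ge_min ler01/= le_max (ltW (lt_trans w1 wv)) orbT.
rewrite in_itv/= => /andP[ac cv] c1.
have /eqP : c = b.
  apply: (uniq (u := 1)) => //; rewrite ?lexx ?ler01//; apply: inab => //; last exact: ltW.
  exact: le_trans cv (ltW vb).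
by rewrite lt_eqF// (le_lt_trans cv).
Qed.

Let deriv_cq_ge0 v : a <= v -> v <= b -> 0 <= cq^`().[v].
Proof.
move=> av vb; rewrite leNgt; apply/negP => d0.
have [|x [y [ax xy yb neg]]] := poly_lt0_itv ab _ d0; first by rewrite in_itv/= av.
have [c cxy ceq] := cq_mvt xy.
have := cq_nondecreasing ax xy yb; rewrite -subr_ge0 ceq pmulr_lge0 ?subr_gt0//.
by rewrite leNgt neg.
Qed.

(** The derivative of [cq] is p divided by the total mass. That mass could a priori be negative, but
    the derivative is nonnegative at a, where p is positive, which fixes the sign. *)
Lemma well_posed_poly_ge0 v : v \in `[a, b] -> 0 <= p.[v].
Proof.
rewrite in_itv/= => /andP[av vb].
have := deriv_cq_ge0 av vb; have := deriv_cq_ge0 (lexx a) (ltW ab).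
rewrite !deriv_cdf_poly !hornerZ pmulr_lge0// le_eqVlt eq_sym invr_eq0 (negbTE mass_neq0)/=.
by move=> m0; rewrite pmulr_rge0.
Qed.

End well_posed_nonneg.

Section nonneg_well_posed.
Hypothesis p0 : forall v, v \in `[a, b] -> 0 <= p.[v].

(** Equality would make the primitive constant between v and w, hence constant as a polynomial,
    since it takes that value at more points than its degree allows. Then p = 0, against p(a) >
    0. *)
Lemma mass_upto_lt v w : a <= v -> v < w -> w <= b -> mass_upto v < mass_upto w.
Proof.
move=> av vw wb.
have mono x y : v <= x -> x <= y -> y <= w -> mass_upto x <= mass_upto y.
  move=> vx; rewrite le_eqVlt => /predU1P[->//|xy] yw.
  have [|c] := @MVT _ (horner (primitive p)) (horner (primitive p)^`()) x y xy (fun _ _ => _).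
    by apply: continuous_subspaceT => z; exact: continuous_horner.
  rewrite in_itv/= deriv_primitive => /andP[xc cy] ceq.
  rewrite -subr_ge0 /mass_upto opprB addrA subrK ceq mulr_ge0 ?subr_ge0 ?(ltW xy)//.
  apply: p0; rewrite in_itv/= (le_trans av (le_trans vx (ltW xc)))/=.
  exact: le_trans (ltW cy) (le_trans yw wb).
rewrite lt_neqAle mono ?(ltW vw)// andbT; apply/eqP => vweq.
have q0 : primitive p - (primitive p).[v]%:P = 0.
  set q := _ - _; pose N := size q.
  pose pts := [seq v + (w - v) / i.+1%:R | i <- iota 0 N].
  apply: (@roots_geq_poly_eq0 _ _ pts).
  - apply/allP => x /mapP[i _ ->]; rewrite /root hornerD hornerN hornerC subr_eq0.
    set x0 := v + _.
    have vx : v <= x0 by rewrite lerDl divr_ge0// subr_ge0 ltW.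
    have xw : x0 <= w.
      rewrite -lerBrDl ler_pdivrMr ?ltr0n// ler_peMr ?subr_ge0 ?(ltW vw)//.
      by rewrite ler1n.
    have h1 := mono v x0 (lexx v) vx xw; have h2 := mono x0 w vx xw (lexx w).
    by move: h1 h2 vweq; rewrite /mass_upto => h1 h2 h3; apply/eqP; lra.
  - rewrite map_inj_in_uniq ?iota_uniq// => i j _ _ /addrI.
    have wv0 : w - v != 0 by rewrite subr_eq0 gt_eqF.
    by move=> /(mulfI wv0)/invr_inj/eqP; rewrite eqr_nat eqSS => /eqP.
  - by rewrite size_map size_iota.
have : p = 0 by rewrite -(deriv_primitive p) -[X in X^`()](subrK (primitive p).[v]%:P) q0 add0r derivC.
by move=> pE; move: pa; rewrite pE horner0 ltxx.
Qed.

Lemma mass_gt0 : 0 < mass_upto b.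
Proof. by have := mass_upto_lt (lexx a) ab (lexx b); rewrite {1}/mass_upto subrr. Qed.

Let cq_lt v w : a <= v -> v < w -> w <= b -> cq.[v] < cq.[w].
Proof. by move=> av vw wb; rewrite !cdf_polyE ltr_pM2l ?invr_gt0 ?mass_gt0// mass_upto_lt. Qed.

Let cqb : cq.[b] = 1.
Proof. by rewrite cdf_polyE mulVf// gt_eqF// mass_gt0. Qed.

Let cq_le v w : a <= v -> v <= w -> w <= b -> cq.[v] <= cq.[w].
Proof. by move=> av; rewrite le_eqVlt => /predU1P[->//|vw] wb; exact/ltW/cq_lt. Qed.

Lemma nonneg_well_posed : well_posed.
Proof.
move=> u /andP[u0 u1]; have [|v vab vu] := @cq_ivt a b u (ltW ab).
  by rewrite cqa cqb ge_min u0/= le_max u1 orbT.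
exists v; split; first exact/FrootE.
move=> w /FrootE[wab wu]; move: vab wab; rewrite !in_itv/= => /andP[av vb] /andP[aw wb].
by case: (ltgtP v w) => // vw; [have := cq_lt av vw wb|have := cq_lt aw vw vb];
  rewrite vu wu ltxx.
Qed.

Definition quantile u := xget a [set v | Froot u v].

Lemma quantileP u : 0 <= u <= 1 -> quantile u \in `[a, b] /\ cq.[quantile u] = u.
Proof.
move=> u01; rewrite /quantile; case: xgetP => [v _ /FrootE//|h].
by have [v [vF _]] := nonneg_well_posed u01; case: (h v).
Qed.

Let quantile_out u : ~~ (0 <= u <= 1) -> quantile u = a.
Proof.
move=> u01; rewrite /quantile; case: xgetP => // v _ /FrootE[+ vu].
rewrite in_itv/= => /andP[av vb]; move: u01; rewrite -vu -{1}cqa -cqb.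
by rewrite !cq_le.
Qed.

Let quantile_le u v : 0 <= u <= 1 -> v \in `[a, b] -> (quantile u <= v) = (u <= cq.[v]).
Proof.
move=> u01; rewrite in_itv/= => /andP[av vb].
have [+ qu] := quantileP u01; rewrite in_itv/= => /andP[aq qb].
apply/idP/idP => h; first by rewrite -qu cq_le.
by rewrite leNgt; apply/negP => /(cq_lt av)/(_ qb); rewrite qu ltNge h.
Qed.

Lemma quantile_mem u : quantile u \in `[a, b].
Proof.
have [/quantileP[]//|/quantile_out->] := boolP (0 <= u <= 1).
by rewrite in_itv/= lexx ltW.
Qed.

Lemma measurable_quantile : measurable_fun [set: measurableTypeR R] (quantile : _ -> measurableTypeR R).
Proof.
(* Without a root, [quantile] takes the default value a. Below 0 this is compatible with
   monotonicity, but above 1 it is not, so the value is raised to b there and restored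
   afterwards. *)
pose q u := if u <= 1 then quantile u else b.
have qab u : a <= quantile u <= b by have := quantile_mem u; rewrite in_itv.
have mq : measurable_fun [set: R] q.
  apply: nondecreasing_measurable => // u v uv; rewrite /q.
  have [v1|v1] := leP v 1; last first.
    by case: ifPn => // _; have /andP[] := qab u.
  rewrite (le_trans uv v1); have [u0|u0] := ltP u 0.
    rewrite quantile_out; last by rewrite leNgt u0.
    by have /andP[] := qab v.
  have u01 : 0 <= u <= 1 by rewrite u0 (le_trans uv v1).
  have v01 : 0 <= v <= 1 by rewrite (le_trans u0 uv).
  have [vab vE] := quantileP v01.
  by rewrite quantile_le// vE.
apply: (eq_measurable_fun (fun u : R => if u <= 1 then q u else a)).
  move=> u _; rewrite /q; have [//|u1] := boolP (u <= 1).
  by rewrite quantile_out// (negbTE u1) andbF.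
by apply: measurable_fun_ifT => //; exact: measurable_fun_ler.
Qed.

Definition pdf v : R := (mass_upto b)^-1 * p.[v].

Lemma measurable_pdf : measurable_fun (`[a, b] : set (measurableTypeR R)) pdf.
Proof.
apply: measurable_funTS; apply: measurable_funM => //.
by apply: continuous_measurable_fun => x; exact: continuous_horner.
Qed.

Lemma pdf_ge0 v : `[a, b]%classic v -> 0 <= pdf v.
Proof. by move=> vab; rewrite mulr_ge0 ?p0// invr_ge0 ltW// mass_gt0. Qed.

Local Notation mab := (measurable_itv `[a, b] : measurable (`[a, b] : set (measurableTypeR R))).
Local Notation nu := (density_measure mu mab measurable_pdf pdf_ge0).

Local Open Scope ereal_scope.

Let integral_pdf v : (a <= v)%R -> \int[mu]_(y in `[a, v]) (pdf y)%:E = (cq.[v])%:E.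
Proof.
move=> av; rewrite -[RHS]/((cq.[v])%:E) -[cq.[v]]subr0 -cqa -integral_deriv_poly//.
by apply: eq_integral => y _; rewrite deriv_cdf_poly hornerZ.
Qed.

Let pdf_ray c : nu `]-oo, c] =
  (if (c < a)%R then 0 else (cq.[Num.min c b])%:E).
Proof.
rewrite /density_measure; have [ca|ac] := ltP c a.
  rewrite (_ : _ `&` _ = set0) ?integral_set0// -subset0 => v [/=].
  by rewrite !in_itv/= => /andP[av _] vc; move: (lt_le_trans ca av); rewrite ltNge vc.
rewrite (_ : _ `&` _ = `[a, Num.min c b]%classic); last first.
  by apply/seteqP; split => v /=; rewrite !in_itv/= le_min; [case=> /andP[-> ->] ->|case/and3P=> -> -> ->].
by rewrite integral_pdf// le_min ac ltW.
Qed.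

Let cq01 v : (a <= v)%R -> (v <= b)%R -> (0 <= cq.[v] <= 1)%R.
Proof. by move=> av vb; rewrite -{1}cqa -cqb !cq_le// ?lexx. Qed.

Let uniform_ray c : uniform_prob (@ltr01 R) (quantile @^-1` `]-oo, c]) =
  (if (c < a)%R then 0 else (cq.[Num.min c b])%:E).
Proof.
rewrite /uniform_prob integral_uniform_pdf.
transitivity (\int[mu]_(x in (quantile @^-1` `]-oo, c]) `&` `[0%R, 1%R]) (1 : \bar R)).
  apply: eq_integral => u; rewrite inE/= => -[_]; rewrite in_itv/= => u01.
  by rewrite /uniform_pdf u01 subr0 invr1.
have [ca|ac] := ltP c a.
  rewrite (_ : _ `&` _ = set0) ?integral_set0// -subset0 => u [/=].
  rewrite !in_itv/= => qc /quantileP[+ _]; rewrite in_itv/= => /andP[aq _].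
  by move: (lt_le_trans ca aq); rewrite ltNge qc.
set c' := Num.min c b.
have c'ab : c' \in `[a, b] by rewrite in_itv/= le_min ac ltW//= ge_min lexx orbT.
have /andP[ac' c'b] : (a <= c' <= b)%R by move: c'ab; rewrite in_itv.
have /andP[c0 c1] := cq01 ac' c'b.
rewrite (_ : _ `&` _ = `[0%R, cq.[c']]%classic).
  rewrite integral_cst// mul1e.
  apply: (etrans (lebesgue_measure_itv `[0%R, cq.[c']])); rewrite /= lte_fin.
  by case: ltP => [_|c0']; [rewrite -EFinD subr0|congr EFin; apply/le_anti; rewrite c0 c0'].
apply/seteqP; split => u /=; rewrite !in_itv/=.
  move=> [qc u01]; have /andP[-> _] := u01.
  rewrite -quantile_le// le_min qc/=.
  by have [+ _] := quantileP u01; rewrite in_itv/= => /andP[].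
move=> /andP[u0 uc]; have u01 : (0 <= u <= 1)%R by rewrite u0 (le_trans uc).
by move: uc; rewrite -quantile_le// le_min => /andP[-> _]; rewrite u01.
Qed.

Let mquantile := isMeasurableFun.Build _ _ _ _ _ measurable_quantile.
Let Q : {mfun measurableTypeR R >-> measurableTypeR R} := HB.pack quantile mquantile.
Let law : probability (measurableTypeR R) R := distribution (uniform_prob (@ltr01 R)) Q.

Let measurable_ray c : measurable (`]-oo, c]%classic : set (measurableTypeR R)).
Proof. exact: measurable_itv. Qed.

(** Inverse transform sampling. The two finite measures agree on rays, hence on the half-open
    intervals, which are differences of rays, form a pi-system and generate the Borel sets. *)
Let law_nu (B : set (measurableTypeR R)) : measurable B -> law B = nu B.
Proof.
have ray c : law `]-oo, c]%classic = nu `]-oo, c]%classic by rewrite pdf_ray -uniform_ray.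
have law1 (A : set (measurableTypeR R)) : measurable A -> law A < +oo.
  by move=> mA; apply: (@le_lt_trans _ _ 1); [exact: probability_le1|rewrite ltry].
have meas (m : {measure set (measurableTypeR R) -> \bar R}) c d : (c <= d)%R ->
    m `]-oo, d]%classic < +oo ->
    m `]c, d]%classic = m `]-oo, d]%classic - m `]-oo, c]%classic.
  move=> cd mfin.
  have -> : `]c, d]%classic = `]-oo, d] `\` `]-oo, c].
    apply/seteqP; split => x /=; rewrite !in_itv/= ltNge.
      by move=> /andP[/negP].
    by case=> -> /negP ->.
  rewrite measureD// ?(setIidr _)//.
  by move=> x /=; rewrite !in_itv/= => /le_trans; apply.
apply: (@measure_unique _ R (measurableTypeR R) (@ocitv R)
  (fun k => `](- k%:R)%R, k%:R%R]%classic) _ _ _ _ law nu) => //.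
- exact: ocitvI.
- by move=> k; exact: is_ocitv.
- rewrite -subTset => x _; exists (Num.truncn `|x|%R).+1 => //=.
  rewrite in_itv/=; have := truncnS_gt `|x|%R; rewrite ltr_norml => /andP[-> /ltW]//.
- move=> _ [[c d] _ <-] /=; have [dc|cd] := leP d c.
    by rewrite set_itv_ge ?measure0// bnd_simp -leNgt.
  have lawd := law1 _ (measurable_ray d).
  have nud : nu `]-oo, d]%classic < +oo by rewrite -ray.
  have e := f_equal2 (fun x y => x - y) (ray d) (ray c).
  exact: (etrans (meas law c d (ltW cd) lawd) (etrans e (esym (meas nu c d (ltW cd) nud)))).
- by move=> k; apply: law1; exact: measurable_itv.
Qed.

Let integral_quantileT (g : measurableTypeR R -> \bar R) :
  measurable_fun setT g -> (forall v, 0 <= g v) ->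
  \int[uniform_prob (@ltr01 R)]_u g (quantile u) =
    \int[mu]_(v in `[a, b]) ((pdf v)%:E * g v).
Proof.
move=> mg g0; rewrite -(ge0_integral_density mu mab measurable_pdf pdf_ge0 mg g0).
have H := @ge0_integral_pushforward _ _ (measurableTypeR R) (measurableTypeR R) R
  quantile measurable_quantile
  (uniform_prob (@ltr01 R)) setT g measurableT mg (fun v _ => g0 v).
rewrite preimage_setT in H; apply: (etrans (esym H)).
by apply: eq_measure_integral => [|mq B mB _]; [exact: measurable_quantile|exact: law_nu].
Qed.

Lemma integral_quantile (g : measurableTypeR R -> \bar R) :
  measurable_fun (`[a, b] : set (measurableTypeR R)) g ->
  (forall v, v \in `[a, b] -> 0 <= g v) ->
  \int[uniform_prob (@ltr01 R)]_u g (quantile u) =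
    \int[mu]_(v in `[a, b]) ((pdf v)%:E * g v).
Proof.
move=> mg g0; have mg' := (measurable_restrictT g mab).1 mg.
transitivity (\int[uniform_prob (@ltr01 R)]_u (g \_ `[a, b]) (quantile u)).
  by apply: eq_integral => u _; rewrite patchE mem_set//=; exact: quantile_mem.
rewrite integral_quantileT//; last by move=> v; rewrite patchE; case: ifPn => // /set_mem/g0.
by apply: eq_integral => v vab; rewrite patchE vab.
Qed.

Lemma integral_pdf1 : \int[mu]_(y in `[a, b]) (pdf y)%:E = 1.
Proof. by rewrite integral_pdf ?cqb// ltW. Qed.

End nonneg_well_posed.
End polynomial_cdf.

(** * The PGDA and Gibbs chains *)

(** The formula x exp(-ln(x^2)) equals 1 / x, also at 0, where both vanish by convention. *)
Lemma measurable_invr {R : realType} : measurable_fun [set: R] (@GRing.inv R).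
Proof.
apply: (eq_measurable_fun (fun x : R => x * expR (- ln (x ^+ 2)))).
  move=> x _; have [->|x0] := eqVneq x 0; first by rewrite mul0r invr0.
  by rewrite expRN lnK ?posrE ?exprn_even_gt0// -[LHS]/(x / x ^+ 2) expr2 invfM mulrA divff// mul1r.
apply: measurable_funM => //; apply: measurableT_comp => //.
apply: measurable_funN; apply: (measurableT_comp (@measurable_ln R)).
exact: measurable_funX.
Qed.

Lemma coef_primitive {R : realType} (p : {poly R}) i :
  (primitive p)`_i = if i is j.+1 then p`_j / j.+1%:R else 0.
Proof.
rewrite coef_poly ltnS; case: i => //= i; case: ltnP => // pi.
by rewrite nth_default// mul0r.
Qed.

(** Used to write the mass of an interpolant as a fixed linear combination of its nodal values,
    which makes it measurable in x. *)
Lemma primitive_lincomb {R : realType} d (c : 'I_d -> R) (p : 'I_d -> {poly R}) :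
  primitive (\sum_(j < d) c j *: p j) = \sum_(j < d) c j *: primitive (p j).
Proof.
apply/polyP => i; rewrite coef_primitive coef_sum.
under [RHS]eq_bigr do rewrite coefZ coef_primitive.
case: i => [|i]; first by rewrite big1// => j _; rewrite mulr0.
by rewrite coef_sum mulr_suml; apply: eq_bigr => j _; rewrite coefZ mulrA.
Qed.

Section chains.
Context {R : realType} {n : nat} {J : finType} (G : factor_graph R n J).
Context (lambda : R) (m k : nat).
Hypotheses (n_gt0 : (0 < n)%N) (lambda_gt0 : 0 < lambda) (k_gt0 : (0 < k)%N).
Local Notation a := (lo G).
Local Notation b := (hi G).
Local Notation mu := (@lebesgue_measure R).
Local Notation RB := (measurableTypeR R).
Local Notation phi := (factor_fun G).
Local Notation adjacent := (Defs.adjacent G).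
Local Notation L := (Lmax G).
Local Notation M := (Mphi G).
Local Notation U := (U G lambda).
Local Notation Ui := (U_interp G lambda m).
Local Notation fi := (f_interp G lambda m k).
Local Notation wp := (root_problem_well_posed G lambda m k).
Local Notation accept := (accept G lambda m k).
Local Notation Omega := (Omega G).
Implicit Types (x : state R n) (i : 'I_n) (s : {ffun J -> nat}) (v : R).

Let ab : a < b := lo_lt_hi G.

Let mOmega : measurable Omega := measurable_box a b.

Lemma Mphi_gt0 j : 0 < M j.
Proof. exact: factor_osc_gt0. Qed.

Lemma Mphi_le_Lmax i j : j \in adjacent i -> M j <= L.
Proof.
move=> jA; apply: (@le_trans _ _ (\sum_(l in adjacent i) M l)).
  by rewrite (bigD1 j)//= lerDl sumr_ge0// => l _; exact/ltW/Mphi_gt0.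
by rewrite /Lmax (bigD1 i)//= le_max lexx.
Qed.

Lemma sum_Mphi_le_Lmax i : \sum_(j in adjacent i) M j <= L.
Proof. by rewrite /Lmax (bigD1 i)//= le_max lexx. Qed.

Lemma Lmax_gt0 i j : j \in adjacent i -> 0 < L.
Proof. by move=> /Mphi_le_Lmax; exact/lt_le_trans/Mphi_gt0. Qed.

Lemma Lmax_ge0 : 0 <= L.
Proof.
by rewrite /Lmax; elim/big_ind : _ => // [x y x0 y0|i _];
  [rewrite le_max x0|apply: sumr_ge0 => j _; exact/ltW/Mphi_gt0].
Qed.

Lemma Omega_update x i v : Omega x -> v \in `[a, b] -> Omega (update x i v).
Proof. by move=> xO; rewrite in_itv/= => vab l; rewrite tnth_update; case: ifP. Qed.

Lemma Omega_tnth x i : Omega x -> tnth x i \in `[a, b].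
Proof. by rewrite in_itv/=; exact. Qed.

Lemma U_update x i s v w : U (update x i v) i s w = U x i s w.
Proof. by apply: eq_bigr => j _; rewrite update_update. Qed.

Lemma f_interp_update x i s v : fi (update x i v) i s = fi x i s.
Proof.
rewrite /f_interp /U_interp (_ : U (update x i v) i s = U x i s)//.
by apply/funext => w; exact: U_update.
Qed.

Lemma f_interp_lo_gt0 x i s : 0 < (fi x i s).[a].
Proof.
have -> : a = cheb_point a b k k.
  have k0 : k%:R != 0 :> R by rewrite pnatr_eq0 -lt0n.
  by rewrite /cheb_point [_ * pi]mulrC mulfK// cospi; field.
by rewrite cheb_interpE// expR_gt0.
Qed.

Lemma well_posed_f_interp x i s : wp x i s <-> forall v, v \in `[a, b] -> 0 <= (fi x i s).[v].
Proof.
split=> [w v vab|h]; first exact: (well_posed_poly_ge0 ab (f_interp_lo_gt0 x i s) w).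
exact: (nonneg_well_posed ab (f_interp_lo_gt0 x i s) h).
Qed.

Definition minibatch_density i s x v : R :=
  if `[< wp x i s >] then pdf a b (fi x i s) v * accept x i s v else 0.

(* The symmetric part of the flow from x to x^{i -> v} under the minibatch s. *)
Definition minibatch_flow i s x v : R :=
  if `[< wp x i s >] then
    Num.min (expR (U x i s (tnth x i)) * (fi x i s).[v])
            (expR (U x i s v) * (fi x i s).[tnth x i]) / mass_upto a (fi x i s) b
  else 0.

Lemma minibatch_flowE i s x v : Omega x -> v \in `[a, b] ->
  expR (U x i s (tnth x i)) * minibatch_density i s x v = minibatch_flow i s x v.
Proof.
move=> xO vab; rewrite /minibatch_density /minibatch_flow.
case: asboolP => [/well_posed_f_interp f0|_]; last by rewrite mulr0.
rewrite /pdf /Defs.accept; set f := fi x i s; set I := mass_upto a f b.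
have fx0 : 0 <= f.[tnth x i] by apply: f0; exact: Omega_tnth.
(* If f(v) = 0 the acceptance ratio divides by zero, but the proposal density and the minimum both
   vanish. *)
have := f0 _ vab; rewrite -/f le_eqVlt => /predU1P[<-|fv0].
  by rewrite !mulr0 mul0r mulr0 min_l ?mul0r// mulr_ge0 ?expR_ge0.
set e := expR _; set e' := expR _.
have e0 : 0 < e := expR_gt0 _.
have -> : Num.min (e * f.[v]) (e' * f.[tnth x i]) =
    e * f.[v] * Num.min 1 (e' * f.[tnth x i] / (e * f.[v])).
  by rewrite minr_pMr ?mulr1 ?mulr_ge0 ?ltW// ?mulr_gt0// [e * _ * _]mulrC divfK// gt_eqF// mulr_gt0.
by rewrite -[X in e * X]mulrA mulrCA mulrC [in LHS]mulrA.
Qed.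

(** The interpolant and its mass do not depend on coordinate i of x, so exchanging x(i) and v only
    swaps the arguments of the minimum. *)
Lemma minibatch_flowC i s x v :
  minibatch_flow i s (update x i v) (tnth x i) = minibatch_flow i s x v.
Proof.
rewrite /minibatch_flow /root_problem_well_posed /is_root /F_interp f_interp_update.
rewrite !U_update tnth_update eqxx; case: asboolP => //= _.
by rewrite minC.
Qed.

Lemma minibatch_flow_ge0 i s x v : Omega x -> v \in `[a, b] -> 0 <= minibatch_flow i s x v.
Proof.
move=> xO vab; rewrite /minibatch_flow; case: asboolP => // /well_posed_f_interp f0.
rewrite divr_ge0 ?le_min ?mulr_ge0 ?expR_ge0 ?f0 ?Omega_tnth//.
exact/ltW/mass_gt0/f0/f_interp_lo_gt0.
Qed.

Lemma minibatch_density_ge0 i s x v : Omega x -> v \in `[a, b] ->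
  0 <= minibatch_density i s x v.
Proof.
move=> xO vab; rewrite -(pmulr_rge0 _ (expR_gt0 (U x i s (tnth x i)))).
by rewrite minibatch_flowE// minibatch_flow_ge0.
Qed.

Lemma accept_ge0 i s x v : Omega x -> v \in `[a, b] -> wp x i s -> 0 <= accept x i s v.
Proof.
move=> xO vab /well_posed_f_interp f0.
by rewrite /Defs.accept le_min ler01 divr_ge0// mulr_ge0 ?expR_ge0// f0// Omega_tnth.
Qed.

Definition moves : set (state R n * RB) := Omega `*` `[a, b].

Lemma measurable_moves : measurable moves.
Proof. by apply: measurableX => //; exact: measurable_itv. Qed.

Lemma measurable_move_slice x : Omega x ->
  forall f : state R n * RB -> R, measurable_fun moves f ->
  measurable_fun (`[a, b] : set RB) (fun v : RB => f (x, v)).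
Proof.
move=> xO f mf; apply: (measurable_comp measurable_moves _ mf) => //.
  by move=> _ [v vab <-].
by apply: measurable_funTS; exact: pair1_measurable.
Qed.

Lemma measurable_on_Omega (f : state R n -> R) : measurable_fun Omega f ->
  measurable_fun moves (fun p => f p.1).
Proof.
move=> mf; apply: (measurable_comp mOmega _ mf); last exact: measurable_funTS.
by move=> _ [p [pO _] <-].
Qed.

Lemma measurable_U i s : measurable_fun moves (fun p => U p.1 i s p.2).
Proof.
rewrite /Defs.U; under eq_fun do rewrite -big_enum/=.
apply: measurable_sum => j; apply: measurable_funM => //.
apply: (measurableT_comp (@measurable_ln R)); apply: measurable_funD => //.
apply: measurable_funM => //.
apply: (measurable_comp mOmega _ (@factor_measurable _ _ _ G j)).
  by move=> _ [p [pO pab] <-]; exact: Omega_update.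
by apply: measurable_funTS; exact: measurable_update.
Qed.

Lemma measurable_U_at i s (c : R) : c \in `[a, b] -> measurable_fun Omega (fun x => U x i s c).
Proof.
move=> cab; apply: (measurable_comp measurable_moves _ (measurable_U i s) (g := fun x => (x, c : RB))).
  by move=> _ [x xO <-].
by apply: measurable_funTS; exact: pair2_measurable.
Qed.

Lemma measurable_U_self i s : measurable_fun Omega (fun x => U x i s (tnth x i)).
Proof.
apply: (measurable_comp measurable_moves _ (measurable_U i s) (g := fun x => (x, tnth x i : RB))).
  by move=> _ [x xO <-]; split => //=; exact: Omega_tnth.
by apply: measurable_funTS; apply/measurable_fun_pair => //; exact: measurable_tnth.
Qed.

Lemma cheb_point_mem d j : cheb_point a b d j \in `[a, b].
Proof. by rewrite cheb_pointE; exact: cos_in_segment.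
Qed.

Let horner_interp d g v :
  (cheb_interp a b d g).[v] = \sum_(j < d.+1) g (cheb_point a b d j) * (lagrange a b j).[v].
Proof.
by rewrite cheb_interp_lagrange horner_sum; apply: eq_bigr => j _; rewrite hornerZ.
Qed.

Let measurable_node i s (c : R) : measurable_fun Omega (fun x => expR (Ui x i s).[c]).
Proof.
apply: measurableT_comp => //; rewrite /U_interp; under eq_fun do rewrite horner_interp.
by apply: measurable_sum => j; apply: measurable_funM => //; apply: measurable_U_at; exact: cheb_point_mem.
Qed.

Lemma measurable_f_interp i s : measurable_fun moves (fun p => (fi p.1 i s).[p.2]).
Proof.
rewrite /f_interp; under eq_fun do rewrite horner_interp.
apply: measurable_sum => j; apply: measurable_funM.
  exact: measurable_on_Omega (measurable_node i s _).
apply: measurable_funTS; apply: (measurableT_comp (f := horner (lagrange a b j))) => //.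
by apply: continuous_measurable_fun => x; exact: continuous_horner.
Qed.

Lemma measurable_f_interp_self i s : measurable_fun Omega (fun x => (fi x i s).[tnth x i]).
Proof.
apply: (measurable_comp measurable_moves _ (measurable_f_interp i s)
  (g := fun x => (x, tnth x i : RB))).
  by move=> _ [x xO <-]; split => //=; exact: Omega_tnth.
by apply: measurable_funTS; apply/measurable_fun_pair => //; exact: measurable_tnth.
Qed.

Lemma measurable_f_mass i s : measurable_fun Omega (fun x => mass_upto a (fi x i s) b).
Proof.
rewrite /mass_upto /f_interp.
under eq_fun do rewrite cheb_interp_lagrange primitive_lincomb !horner_sum.
by apply: measurable_funB; apply: measurable_sum => j;
  under eq_fun do rewrite hornerZ; apply: measurable_funM => //; exact: measurable_node.
Qed.

(** A negative value would persist on an interval, which contains a rational. Well-posedness thereby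
    becomes a countable family of conditions, hence measurable in x. *)
Lemma poly_ge0_rat (p : {poly R}) :
  (forall q : rat, ratr q \in `[a, b] -> 0 <= p.[ratr q]) ->
  forall v, v \in `[a, b] -> 0 <= p.[v].
Proof.
move=> pq v vab; rewrite leNgt; apply/negP => /(poly_lt0_itv ab vab)[u [w [au uw wb neg]]].
have [q quw] := rat_in_itvoo uw.
suff /pq : ratr q \in `[a, b] by rewrite leNgt neg.
move: quw; rewrite !in_itv/= => /andP[uq qw].
by rewrite (le_trans au (ltW uq)) (le_trans (ltW qw) wb).
Qed.

Lemma measurable_well_posed i s : measurable_fun Omega (fun x => `[< wp x i s >]).
Proof.
apply: (measurable_fun_bool true) => //.
rewrite (_ : _ `&` _ = Omega `&` \bigcap_(q in [set: rat]) (if ratr q \in `[a, b]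
    then Omega `&` (fun x => (fi x i s).[ratr q]) @^-1` `[0, +oo[ else setT)).
  apply: measurableI => //; rewrite bigcap_mkcond -[X in measurable X]setCK setC_bigcap.
  apply: measurableC; apply: bigcupT_measurable_rat => q; apply: measurableC.
  rewrite mem_set//; case: ifPn => // qab.
  have mq : measurable_fun Omega (fun x => (fi x i s).[ratr q]).
    apply: (measurable_comp measurable_moves _ (measurable_f_interp i s)
      (g := fun x => (x, ratr q : RB))).
      by move=> _ [x xO <-].
    by apply: measurable_funTS; exact: pair2_measurable.
  by apply: mq => //; exact: measurable_itv.
apply/seteqP; split => x /= [xO h]; split => //.
  move=> q _; case: ifPn => // qab; split => //=; rewrite in_itv/= andbT.
  by move/asboolP: h => /well_posed_f_interp; apply.
apply/asboolP/well_posed_f_interp/poly_ge0_rat => q qab.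
by have := h q Logic.I; rewrite qab /= in_itv/= andbT => -[].
Qed.

Lemma measurable_accept i s : measurable_fun moves (fun p => accept p.1 i s p.2).
Proof.
apply: measurable_minr => //; apply: measurable_funM.
  apply: measurable_funM; first exact: measurableT_comp (measurable_U i s).
  exact: measurable_on_Omega (measurable_f_interp_self i s).
apply: (measurableT_comp (@measurable_invr R)); apply: measurable_funM.
  exact: measurableT_comp (measurable_on_Omega (measurable_U_self i s)).
exact: measurable_f_interp.
Qed.

Lemma measurable_minibatch_density i s :
  measurable_fun moves (fun p => minibatch_density i s p.1 p.2).
Proof.
rewrite /minibatch_density; apply: (measurable_fun_if measurable_moves).
- apply: (measurable_comp mOmega _ (measurable_well_posed i s)); last exact: measurable_funTS.
  by move=> _ [p [pO _] <-].
- apply: (measurable_funS measurable_moves) => //; apply: measurable_funM.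
    apply: measurable_funM; last exact: measurable_f_interp.
    exact: measurable_on_Omega (measurableT_comp (@measurable_invr R) (measurable_f_mass i s)).
  exact: measurable_accept.
- exact: measurable_cst.
Qed.

Local Notation dens := minibatch_density.

Let mab : measurable (`[a, b] : set RB) := measurable_itv `[a, b].

Local Open Scope ereal_scope.

Lemma integral_moves x (h : state R n * RB -> \bar R) (A : set RB) : Omega x ->
  \int[mu]_(v in A) (h \_ moves) (x, v) = \int[mu]_(v in `[a, b] `&` A) h (x, v).
Proof.
move=> xO; rewrite [LHS]integral_mkcond [RHS]integral_mkcond.
apply: eq_integral => v _; rewrite !patchE.
have -> : ((x, v) \in moves) = (v \in `[a, b]%classic).
  by apply/idP/idP => /set_mem h'; apply/mem_set; [case: h'|split].
by rewrite in_setI andbC; case: (v \in A); case: (v \in `[a, b]%classic).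
Qed.

Lemma measurable_integral_slice (h : state R n * RB -> \bar R) :
  measurable_fun setT h -> (forall p, 0 <= h p) ->
  measurable_fun setT (fun x => \int[mu]_v h (x, v)).
Proof.
move=> mh h0.
exact: (@measurable_fun_fubini_tonelli_F _ _ _ _ _
  (mu : {sigma_finite_measure set RB -> \bar R}) h mh h0).
Qed.

Let fin01 (q : \bar R) : 0 <= q -> q <= 1 -> q \is a fin_num.
Proof. by move=> q0 q1; rewrite ge0_fin_numE// (le_lt_trans q1)// ltry. Qed.

Let slice x (h : state R n * RB -> R) : Omega x -> measurable_fun moves h ->
  measurable_fun (`[a, b] : set RB) (fun v : RB => h (x, v)).
Proof. by move=> xO mh; exact: measurable_move_slice mh. Qed.

Let mind i x (B : set (state R n)) : measurable B ->
  measurable_fun (`[a, b] : set RB) (fun v : RB => \1_B (update x i v) : R).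
Proof.
move=> mB; apply: measurable_funTS.
exact: (measurableT_comp (measurable_indic mB) (measurable_update_slice i x)).
Qed.

Let minibatch_mass i s x := \int[mu]_(v in `[a, b]) (dens i s x v)%:E.

Let dens_ge0 i s x v : Omega x -> v \in `[a, b] -> (0 <= dens i s x v)%R.
Proof. by move=> xO vab; exact: minibatch_density_ge0. Qed.

Let mdens i s x : Omega x -> measurable_fun (`[a, b] : set RB) (dens i s x).
Proof. by move=> xO; exact: (slice xO (measurable_minibatch_density i s)). Qed.

Let minibatch_mass_ge0 i s x : Omega x -> 0 <= minibatch_mass i s x.
Proof. by move=> xO; apply: integral_ge0 => v vab; rewrite lee_fin dens_ge0. Qed.

Let accept_bound i s x v : Omega x -> wp x i s -> v \in `[a, b] -> (0 <= accept x i s v <= 1)%R.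
Proof. by move=> xO w vab; rewrite accept_ge0//= /Defs.accept ge_min lexx. Qed.

Let maccept i s x : Omega x -> measurable_fun (`[a, b] : set RB) (accept x i s).
Proof. by move=> xO; exact: (slice xO (measurable_accept i s)). Qed.

Let pdf_fi_ge0 i s x v : wp x i s -> v \in `[a, b] -> (0 <= pdf a b (fi x i s) v)%R.
Proof. by move=> /well_posed_f_interp f0; exact: (pdf_ge0 ab (f_interp_lo_gt0 x i s) f0). Qed.

Let reject i s x v := (pdf a b (fi x i s) v * (1 - accept x i s v))%R.

Let reject_ge0 i s x v : Omega x -> wp x i s -> v \in `[a, b] -> 0 <= (reject i s x v)%:E.
Proof.
move=> xO w vab; rewrite lee_fin mulr_ge0 ?pdf_fi_ge0// subr_ge0.
by case/andP: (accept_bound xO w vab).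
Qed.

Let mreject i s x : Omega x -> measurable_fun (`[a, b] : set RB) (fun v => (reject i s x v)%:E).
Proof.
move=> xO; apply/measurable_EFinP; apply: measurable_funM; first exact: measurable_pdf.
by apply: measurable_funB => //; exact: maccept.
Qed.

Let minibatch_rejection i s x : Omega x -> wp x i s ->
  \int[mu]_(v in `[a, b]) (reject i s x v)%:E + minibatch_mass i s x = 1.
Proof.
move=> xO w; have f0 := (well_posed_f_interp x i s).1 w.
rewrite -(integral_pdf1 ab (f_interp_lo_gt0 x i s) f0) -ge0_integralD//.
- apply: eq_integral => v vab; rewrite -EFinD; congr EFin.
  by rewrite /minibatch_density asboolT// -mulrDr subrK mulr1.
- by move=> v vab; exact: reject_ge0.
- exact: mreject.
- by move=> v vab; rewrite lee_fin dens_ge0.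
- by apply/measurable_EFinP; exact: mdens.
Qed.

Let minibatch_mass_le1 i s x : Omega x -> minibatch_mass i s x <= 1.
Proof.
move=> xO; have [w|w] := pselect (wp x i s); last first.
  rewrite /minibatch_mass /minibatch_density asboolF//.
  by under eq_integral do []; rewrite integral0 lee_fin.
rewrite -[leRHS](minibatch_rejection xO w) leeDr//.
by apply: integral_ge0 => v vab; exact: reject_ge0.
Qed.

Let minibatch_reject_ge0 i s x : Omega x -> 0 <= 1 - minibatch_mass i s x.
Proof. by move=> xO; rewrite sube_ge0 ?minibatch_mass_le1// orbT. Qed.

(** By [integral_quantile] the integral over u becomes one over v with the normalised interpolant as
    density; rejected proposals and ill-posed minibatches both end up in the mass at x. *)
Lemma minibatch_stepE i s x (B : set (state R n)) : Omega x -> measurable B ->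
  minibatch_step G lambda m k x i s B =
  \int[mu]_(v in `[a, b]) ((dens i s x v)%:E * (\1_B (update x i v))%:E)
  + (1 - \int[mu]_(v in `[a, b]) (dens i s x v)%:E) * \d_x B.
Proof.
move=> xO mB; rewrite /minibatch_step; case: asboolP => w; last first.
  have z v : dens i s x v = 0%R by rewrite /minibatch_density asboolF.
  under eq_integral do rewrite z mul0e.
  under [X in 1 - X]eq_integral do rewrite z.
  by rewrite !integral0 sube0 mul1e add0e.
pose g v := (accept x i s v * \1_B (update x i v) + (1 - accept x i s v) * \1_B x)%:E.
have mg : measurable_fun (`[a, b] : set RB) g.
  have ma := maccept i s xO.
  apply/measurable_EFinP; apply: measurable_funD; apply: measurable_funM => //; first exact: mind.
  exact: measurable_funB.
have g0 v : v \in `[a, b] -> 0 <= g v.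
  by case/(accept_bound xO w)/andP => a0 a1; rewrite lee_fin addr_ge0// mulr_ge0// subr_ge0.
transitivity (\int[mu]_(v in `[a, b]) ((pdf a b (fi x i s) v)%:E * g v)).
  have f0 := (well_posed_f_interp x i s).1 w.
  exact: (integral_quantile ab (f_interp_lo_gt0 x i s) f0 mg g0).
transitivity (\int[mu]_(v in `[a, b]) ((dens i s x v)%:E * (\1_B (update x i v))%:E)
  + \int[mu]_(v in `[a, b]) ((\1_B x)%:E * (reject i s x v)%:E)).
  rewrite -ge0_integralD//.
  - apply: eq_integral => v _; rewrite /g /reject /minibatch_density asboolT// -!EFinM -EFinD.
    by congr EFin; ring.
  - by move=> v vab; rewrite mule_ge0 ?lee_fin ?dens_ge0.
  - by apply/measurable_EFinP; apply: measurable_funM; [exact: mdens|exact: mind].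
  - by move=> v vab; rewrite mule_ge0 ?lee_fin// -lee_fin reject_ge0.
  - by apply: measurable_funeM; exact: mreject.
rewrite ge0_integralZl//; last 2 first.
- exact: mreject.
- by move=> v vab; exact: reject_ge0.
rewrite -(minibatch_rejection xO w) addeK ?fin01 ?minibatch_mass_ge0 ?minibatch_mass_le1//.
by rewrite muleC diracE indicE.
Qed.

Definition minibatch_weight i s x : R :=
  (\prod_(j in adjacent i) poisson_pmf (poisson_rate G lambda x j) (s j))%R.

Lemma minibatch_weight_ge0 i s x : (0 <= minibatch_weight i s x)%R.
Proof. by apply: prodr_ge0 => j _; exact: poisson_pmf_ge0. Qed.

Lemma poisson_rate_gt0 i j x : Omega x -> j \in adjacent i -> (0 < poisson_rate G lambda x j)%R.
Proof.
move=> xO jA; rewrite ltr_pwDl//; last by have /andP[] := @factor_bounds _ _ _ G j x xO.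
by rewrite divr_gt0 ?(Lmax_gt0 jA)// mulr_gt0 ?Mphi_gt0.
Qed.

Lemma minibatch_weight_sum i x : Omega x ->
  \esum_(s in minibatches G i) (minibatch_weight i s x)%:E = 1.
Proof.
move=> xO.
have := @poisson_prod_mgf R J (adjacent i) (poisson_rate G lambda x) (fun=> 1%R).
rewrite big1 ?expR0; last by move=> j _; rewrite subrr mulr0.
move=> <- //; last by move=> j; exact: poisson_rate_gt0.
by apply: eq_esum => s _; under [in RHS]eq_bigr do rewrite expr1n mulr1.
Qed.

Lemma measurable_minibatch_weight i s : measurable_fun Omega (minibatch_weight i s).
Proof.
rewrite /minibatch_weight; under eq_fun do rewrite -big_enum/=.
apply: measurable_prod => j _.
apply: (measurableT_comp (measurable_poisson_pmf (s j) measurableT)).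
by apply: measurable_funD => //; exact: factor_measurable.
Qed.

Definition pgda_density i : state R n * RB -> \bar R :=
  (fun p => \esum_(s in minibatches G i) (minibatch_weight i s p.1 * dens i s p.1 p.2)%:E)
  \_ moves.

Lemma pgda_density_ge0 i p : 0 <= pgda_density i p.
Proof.
rewrite /pgda_density patchE; case: ifPn => // /set_mem[pO pab].
by apply: esum_ge0 => s _; rewrite lee_fin mulr_ge0 ?minibatch_weight_ge0 ?dens_ge0.
Qed.

Lemma measurable_pgda_density i : measurable_fun setT (pgda_density i).
Proof.
apply/(measurable_restrictT _ (measurable_moves)).
apply: measurable_fun_esum; first exact: measurable_moves.
  by move=> s p _ [pO pab]; rewrite lee_fin mulr_ge0 ?minibatch_weight_ge0 ?dens_ge0.
move=> s _; apply/measurable_EFinP; apply: measurable_funM.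
  exact: measurable_on_Omega (measurable_minibatch_weight i s).
exact: measurable_minibatch_density.
Qed.

Let pgda_integral i x (B : set (state R n)) : Omega x -> measurable B ->
  \int[mu]_(v in update x i @^-1` B) pgda_density i (x, v) =
  \esum_(s in minibatches G i) ((minibatch_weight i s x)%:E *
    \int[mu]_(v in `[a, b]) ((dens i s x v)%:E * (\1_B (update x i v))%:E)).
Proof.
move=> xO mB; rewrite integral_moves//= integral_mkcondr.
transitivity (\int[mu]_(v in `[a, b]) \esum_(s in minibatches G i)
    ((minibatch_weight i s x)%:E * ((dens i s x v)%:E * (\1_B (update x i v))%:E))).
  apply: eq_integral => v /set_mem vab; rewrite patchE.
  have [vB|vB] := boolP (v \in update x i @^-1` B).
    apply: eq_esum => s _; rewrite indicE mem_set ?mule1 ?EFinM//; exact: (set_mem vB).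
  rewrite esum1// => s _; rewrite indicE memNset ?mule0//.
  by move=> h; move/negP: vB; apply; exact: mem_set.
rewrite integral_esum//.
- apply: eq_esum => s _; rewrite ge0_integralZl ?lee_fin ?minibatch_weight_ge0//.
    by apply/measurable_EFinP; apply: measurable_funM; [exact: mdens|exact: mind].
  by move=> v vab; rewrite mule_ge0 ?lee_fin ?dens_ge0.
- by move=> s v _ vab; rewrite !mule_ge0 ?lee_fin ?minibatch_weight_ge0 ?dens_ge0.
- move=> s _; apply/measurable_EFinP; apply: measurable_funM => //.
  by apply: measurable_funM; [exact: mdens|exact: mind].
Qed.

Let pgda_mass i x : Omega x -> \int[mu]_v pgda_density i (x, v) =
  \esum_(s in minibatches G i) ((minibatch_weight i s x)%:E * minibatch_mass i s x).
Proof.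
move=> xO; have := pgda_integral i xO measurableT; rewrite preimage_setT => ->.
apply: eq_esum => s _; congr (_ * _); apply: eq_integral => v _.
by rewrite indicT mule1.
Qed.

Let pgda_rejection i x : Omega x ->
  \esum_(s in minibatches G i) ((minibatch_weight i s x)%:E * (1 - minibatch_mass i s x))
  + \int[mu]_v pgda_density i (x, v) = 1.
Proof.
move=> xO; rewrite pgda_mass// -esumD.
- rewrite -[RHS](minibatch_weight_sum i xO); apply: eq_esum => s _.
  rewrite -ge0_muleDr ?minibatch_reject_ge0 ?minibatch_mass_ge0//.
  by rewrite subeK ?mule1//; apply: fin01; [exact: minibatch_mass_ge0|exact: minibatch_mass_le1].
- by move=> s _; rewrite mule_ge0 ?lee_fin ?minibatch_weight_ge0// minibatch_reject_ge0.
- by move=> s _; rewrite mule_ge0 ?lee_fin ?minibatch_weight_ge0 ?minibatch_mass_ge0.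
Qed.

Lemma pgda_density_mass_le1 i x : \int[mu]_v pgda_density i (x, v) <= 1.
Proof.
have [xO|xO] := pselect (Omega x); last first.
  under eq_integral.
    move=> v _; rewrite /pgda_density patchE memNset; last by case.
    over.
  by rewrite integral0 lee_fin.
rewrite -[leRHS](pgda_rejection i xO) leeDr//; apply: esum_ge0 => s _.
by rewrite mule_ge0 ?lee_fin ?minibatch_weight_ge0// minibatch_reject_ge0.
Qed.

Definition pgda_hold i x : R := (1 - fine (\int[mu]_v pgda_density i (x, v)))%R.

Lemma pgda_holdE i x : (pgda_hold i x)%:E = 1 - \int[mu]_v pgda_density i (x, v).
Proof.
rewrite /pgda_hold EFinB fineK// fin01 ?pgda_density_mass_le1//.
by apply: integral_ge0 => v _; exact: pgda_density_ge0.
Qed.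

Lemma pgda_stepE x (B : set (state R n)) : Omega x -> measurable B ->
  pgda_step G lambda m k x B = site_mixture Omega pgda_density pgda_hold x B.
Proof.
move=> xO mB; rewrite /site_mixture mem_set//; apply: eq_bigr => i _; congr (_ * _).
rewrite /site pgda_holdE pgda_integral// -(pgda_rejection i xO) addeK; last first.
  rewrite fin01 ?pgda_density_mass_le1//.
  by apply: integral_ge0 => v _; exact: pgda_density_ge0.
have r0 s : 0 <= (minibatch_weight i s x)%:E * (1 - minibatch_mass i s x).
  by rewrite mule_ge0 ?lee_fin ?minibatch_weight_ge0// minibatch_reject_ge0.
have t0 s : 0 <= (minibatch_weight i s x)%:E *
    \int[mu]_(v in `[a, b]) ((dens i s x v)%:E * (\1_B (update x i v))%:E).
  rewrite mule_ge0 ?lee_fin ?minibatch_weight_ge0//.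
  by apply: integral_ge0 => v vab; rewrite mule_ge0 ?lee_fin ?dens_ge0.
rewrite diracE muleC -[X in _ + X]esumZl// -esumD//.
apply: eq_esum => s _; rewrite minibatch_stepE// ge0_muleDr//.
- by congr (_ + _); rewrite -/(minibatch_mass i s x) diracE muleA muleC.
- by apply: integral_ge0 => v vab; rewrite mule_ge0 ?lee_fin ?dens_ge0.
- by rewrite mule_ge0// minibatch_reject_ge0.
- by move=> s _; rewrite mule_ge0// lee_fin.
Qed.

Lemma pgda_hold_ge0 i x : (0 <= pgda_hold i x)%R.
Proof. by rewrite -lee_fin pgda_holdE sube_ge0 ?pgda_density_mass_le1// orbT. Qed.

Lemma measurable_pgda_hold i : measurable_fun setT (pgda_hold i).
Proof.
apply: measurable_funB => //; apply: measurableT_comp => //.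
exact: (measurable_integral_slice (measurable_pgda_density i) (pgda_density_ge0 i)).
Qed.

Lemma pgda_kernel_exists : exists P : R.-pker (state R n) ~> (state R n),
  forall x B, P x B = site_mixture Omega pgda_density pgda_hold x B.
Proof.
apply: (site_kernel_exists n_gt0 mOmega measurable_pgda_density pgda_density_ge0
  measurable_pgda_hold pgda_hold_ge0) => i x _.
rewrite pgda_holdE addeC subeK// fin01 ?pgda_density_mass_le1//.
by apply: integral_ge0 => v _; exact: pgda_density_ge0.
Qed.

Lemma gibbs_weight_bound i x v : Omega x -> v \in `[a, b] ->
  (1 <= gibbs_weight G x i v <= expR L)%R.
Proof.
move=> xO vab; have f01 j := @factor_bounds _ _ _ G j _ (Omega_update i xO vab).
rewrite /gibbs_weight -{1}expR0 !ler_expR sumr_ge0 => [|j _]; last by case/andP: (f01 j).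
apply: le_trans (sum_Mphi_le_Lmax i).
by apply: ler_sum => j _; case/andP: (f01 j).
Qed.

Lemma measurable_gibbs_weight i : measurable_fun moves (fun p => gibbs_weight G p.1 i p.2).
Proof.
rewrite /gibbs_weight; apply: measurableT_comp => //.
under eq_fun do rewrite -big_enum/=.
apply: measurable_sum => j.
apply: (measurable_comp mOmega _ (@factor_measurable _ _ _ G j)).
  by move=> _ [p [pO pab] <-]; exact: Omega_update.
by apply: measurable_funTS; exact: measurable_update.
Qed.

Definition gibbs_mass i x : R := (\int[mu]_(v in `[a, b]) gibbs_weight G x i v)%R.

Let mweight i x : Omega x -> measurable_fun (`[a, b] : set RB) (gibbs_weight G x i).
Proof. by move=> xO; exact: (slice xO (measurable_gibbs_weight i)). Qed.

Lemma integral_gibbs_weight i x : Omega x ->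
  \int[mu]_(v in `[a, b]) (gibbs_weight G x i v)%:E = (gibbs_mass i x)%:E.
Proof.
move=> xO; exact: (EFin_segment_integral ab (mweight i xO) (fun v => gibbs_weight_bound i xO)).
Qed.

Lemma gibbs_mass_gt0 i x : Omega x -> (0 < gibbs_mass i x)%R.
Proof.
move=> xO; exact: (segment_integral_gt0 ab (mweight i xO) (fun v => gibbs_weight_bound i xO)).
Qed.

Lemma measurable_gibbs_mass i : measurable_fun Omega (gibbs_mass i).
Proof.
pose h : state R n * RB -> \bar R := (fun p => (gibbs_weight G p.1 i p.2)%:E) \_ moves.
have mh : measurable_fun setT h.
  apply/(measurable_restrictT _ (measurable_moves)).
  by apply/measurable_EFinP; exact: measurable_gibbs_weight.
have h0 p : 0 <= h p by rewrite /h patchE; case: ifPn => // _; rewrite lee_fin expR_ge0.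
apply: (eq_measurable_fun (fun x => fine (\int[mu]_v h (x, v)))).
  move=> x /set_mem xO; rewrite (integral_moves _ setT xO) setIT.
  by rewrite integral_gibbs_weight.
apply: measurable_funTS; apply: measurableT_comp => //.
exact: measurable_integral_slice.
Qed.

Definition gibbs_density i : state R n * RB -> \bar R :=
  (fun p => (gibbs_weight G p.1 i p.2 / gibbs_mass i p.1)%:E) \_ moves.

Lemma gibbs_density_ge0 i p : 0 <= gibbs_density i p.
Proof.
rewrite /gibbs_density patchE; case: ifPn => // /set_mem[pO _].
by rewrite lee_fin divr_ge0 ?expR_ge0// ltW// gibbs_mass_gt0.
Qed.

Lemma measurable_gibbs_density i : measurable_fun setT (gibbs_density i).
Proof.
apply/(measurable_restrictT _ (measurable_moves))/measurable_EFinP.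
apply: measurable_funM; first exact: measurable_gibbs_weight.
exact: measurable_on_Omega (measurableT_comp (@measurable_invr R) (measurable_gibbs_mass i)).
Qed.

Lemma gibbs_stepE x (B : set (state R n)) : Omega x -> measurable B ->
  gibbs_step G x B = site_mixture Omega gibbs_density (fun=> cst 0%R) x B.
Proof.
move=> xO mB; rewrite /site_mixture mem_set//; apply: eq_bigr => i _; congr (_ * _).
rewrite /site mul0e adde0 integral_moves//= -ge0_integralZl//.
- by apply: eq_integral => v _; rewrite -EFinM mulrC.
- by apply: measurableI => //; exact: measurable_update_preimage.
- apply/measurable_EFinP; apply: measurable_funS (mweight i xO) => //.
- by move=> v _; rewrite lee_fin expR_ge0.
- by rewrite lee_fin invr_ge0 ltW// gibbs_mass_gt0.
Qed.

Lemma gibbs_kernel_exists : exists P : R.-pker (state R n) ~> (state R n),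
  forall x B, P x B = site_mixture Omega gibbs_density (fun=> cst 0%R) x B.
Proof.
apply: (site_kernel_exists n_gt0 mOmega measurable_gibbs_density gibbs_density_ge0) => //.
move=> i x xO; rewrite adde0 (integral_moves _ setT xO) setIT.
transitivity (\int[mu]_(v in `[a, b]) ((gibbs_mass i x)^-1%:E * (gibbs_weight G x i v)%:E)).
  by apply: eq_integral => v _; rewrite -EFinM mulrC.
rewrite ge0_integralZl//.
- by rewrite integral_gibbs_weight// -EFinM mulVf// gt_eqF// gibbs_mass_gt0.
- by apply/measurable_EFinP; exact: mweight.
- by move=> v _; rewrite lee_fin expR_ge0.
- by rewrite lee_fin invr_ge0 ltW// gibbs_mass_gt0.
Qed.

Lemma minibatch_weightE i s x : Omega x ->
  (expR (\sum_(j in adjacent i) phi j x) * minibatch_weight i s x =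
   (\prod_(j in adjacent i) poisson_pmf (lambda * Mphi G j / Lmax G) (s j)) *
   expR (U x i s (tnth x i)))%R.
Proof.
move=> xO; rewrite /minibatch_weight /Defs.U !expR_sum -!big_split/=.
apply: eq_bigr => j jA; rewrite update_id.
have L0 := Lmax_gt0 jA; have M0 := Mphi_gt0 j.
have r0 : (0 < lambda * Mphi G j / Lmax G)%R by rewrite divr_gt0// mulr_gt0.
have /andP[f0 _] := @factor_bounds _ _ _ G j x xO.
have f1 : (0 < 1 + Lmax G / (lambda * Mphi G j) * phi j x)%R.
  by rewrite ltr_pwDl// mulr_ge0// divr_ge0 ?ltW// mulr_gt0.
rewrite /poisson_pmf r0 (poisson_rate_gt0 xO jA) /poisson_rate.
rewrite expRM_natl lnK ?posrE//.
rewrite opprD expRD.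
have -> : (lambda * Mphi G j / Lmax G + phi j x =
    lambda * Mphi G j / Lmax G * (1 + Lmax G / (lambda * Mphi G j) * phi j x))%R.
  by field; rewrite !gt_eqF.
rewrite exprMn.
have e1 : (expR (phi j x) * expR (- phi j x) = 1)%R by rewrite -expRD subrr expR0.
move: e1; set E := expR (phi j x); set F := expR (- phi j x); set D := expR (- (_ / _)).
set A : R := ((_ / _) ^+ _)%R; set B := ((1 + _) ^+ _)%R; set C := (_ `!%:R^-1)%R => e1.
clearbody A B C D E F.
have -> : (E * (A * B * C * (D * F)) = E * F * (A * C * D * B))%R by ring.
by rewrite e1 mul1r.
Qed.

Let target_pdfE i x : (target_pdf G x = (partition_function G)^-1 *
   expR (\sum_(j | j \notin adjacent i) phi j x) * expR (\sum_(j in adjacent i) phi j x))%R.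
Proof.
by rewrite /target_pdf (bigID (mem (adjacent i)))/= addrC expRD mulrA.
Qed.

Lemma nonadjacent_update i j x v : Omega x -> v \in `[a, b] -> j \notin adjacent i ->
  phi j (update x i v) = phi j x.
Proof.
move=> xO vab; rewrite inE => /asboolPn nd; apply/eqP/negPn/negP => /eqP neq; apply: nd.
exists (update x i v), x; split => //; first exact: Omega_update.
by move=> l /negbTE li; rewrite tnth_update li.
Qed.

Let w0 i s : R := (\prod_(j in adjacent i) poisson_pmf (lambda * Mphi G j / Lmax G) (s j))%R.

Lemma pgda_flowE i s x v : Omega x -> v \in `[a, b] ->
  (expR (\sum_(j in adjacent i) phi j x) * (minibatch_weight i s x * dens i s x v) =
   w0 i s * minibatch_flow i s x v)%R.
Proof.
move=> xO vab; rewrite mulrA minibatch_weightE// -mulrA.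
by rewrite minibatch_flowE.
Qed.

Lemma pgda_balance i x v :
  ((target_pdf G \_ Omega) x)%:E * pgda_density i (x, v) =
  ((target_pdf G \_ Omega) (update x i v))%:E * pgda_density i (update x i v, tnth x i).
Proof.
have half y w : Omega y -> w \in `[a, b] ->
  (target_pdf G y)%:E * pgda_density i (y, w) =
  ((partition_function G)^-1 * expR (\sum_(j | j \notin adjacent i) phi j y))%:E *
  \esum_(s in minibatches G i) (w0 i s * minibatch_flow i s y w)%:E.
  move=> yO wab; rewrite (target_pdfE i) EFinM -muleA; congr (_ * _).
  rewrite /pgda_density patchE mem_set//= -esumZl ?expR_ge0//.
    by apply: eq_esum => s _; rewrite -EFinM pgda_flowE.
  by move=> s _; rewrite lee_fin mulr_ge0 ?minibatch_weight_ge0 ?minibatch_density_ge0.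
have [[xO vab]|nm] := pselect (Omega x /\ v \in `[a, b]).
  rewrite !patchE !mem_set//; last exact: Omega_update.
  have xO' := Omega_update i xO vab.
  rewrite (half x v xO vab) (half _ _ xO' (Omega_tnth i xO)).
  have -> : (\sum_(j | j \notin adjacent i) phi j (update x i v) =
      \sum_(j | j \notin adjacent i) phi j x)%R.
    by apply: eq_bigr => j jA; exact: (nonadjacent_update xO vab jA).
  apply: (f_equal (mule _)).
  apply: eq_esum => s _.
  by rewrite (minibatch_flowC i s x v).
(* A second update undoes the first, so being a move is symmetric; off the moves both densities
   vanish. *)
have nm' : ~ (Omega (update x i v) /\ tnth x i \in `[a, b]).
  move=> [uO iab]; apply: nm; split.
    by rewrite -(update_id x i) -(update_update x i v); exact: Omega_update.
  by have := Omega_tnth i uO; rewrite tnth_update eqxx.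
have z y w : ~ (Omega y /\ w \in `[a, b]) -> pgda_density i (y, w) = 0.
  by move=> h; rewrite /pgda_density patchE memNset.
by rewrite !z// !mule0.
Qed.

End chains.

(** * Comparison of the densities *)

Section numeric_bounds.
Context {R : realType}.
Implicit Types (t e y : R).

Lemma expR_le_invB y : y < 1 -> expR y <= (1 - y)^-1.
Proof.
move=> y1; rewrite -[leLHS]invrK -expRN lef_pV2 ?posrE ?expR_gt0 ?subr_gt0//.
exact: expR_ge1Dx.
Qed.

Lemma expR_sub1_le y : expR y - 1 <= y * expR y.
Proof.
have h : 1 - y <= expR (- y) by exact: expR_ge1Dx.
have := ler_wpM2r (expR_ge0 y) h; rewrite -expRD addNr expR0; lra.
Qed.

(** Source of exp(8 L). With c = t / (1 - t), the bound exp(c) <= 1 / (1 - c) = (1 - t) / (1 - 2 t)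
    is squared. *)
Lemma expR_double_bound t : 0 <= t <= 1 / 4 ->
  (1 + t) ^+ 2 * (expR (2 * (t / (1 - t))) - 1) <= 8 * t.
Proof.
move=> /andP[t0 t1]; have d1 : 0 < 1 - t by lra.
have d2 : 0 < 1 - 2 * t by lra.
have c1 : t / (1 - t) < 1 by rewrite ltr_pdivrMr//; lra.
have h : expR (2 * (t / (1 - t))) <= ((1 - t) / (1 - 2 * t)) ^+ 2.
  rewrite mulrC expRM_natr ler_pXn2r ?nnegrE ?expR_ge0 ?divr_ge0 ?(ltW d1) ?(ltW d2)//.
  apply: (le_trans (expR_le_invB c1)); rewrite (_ : 1 - _ = (1 - 2 * t) / (1 - t)) ?invf_div//.
  by field; rewrite gt_eqF.
apply: (@le_trans _ _ ((1 + t) ^+ 2 * (((1 - t) / (1 - 2 * t)) ^+ 2 - 1))).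
  by rewrite ler_wpM2l ?sqr_ge0// lerD2r.
rewrite (_ : _ * _ = t * ((1 + t) ^+ 2 * (2 - 3 * t)) / (1 - 2 * t) ^+ 2); last first.
  by field; rewrite gt_eqF.
rewrite ler_pdivrMr ?exprn_gt0// [8 * t]mulrC -[leRHS]mulrA ler_wpM2l//.
(* The right side minus the left one equals 36 (1 / 4 - t) (2 / 3 - t) + 3 t^3. *)
by have : 0 <= (1 / 4 - t) * (2 / 3 - t) by [apply: mulr_ge0; lra]; nra.
Qed.

(** Source of the exponent with 16 L: it is applied with e = [cheb_rate m], whose numerator is 4.
    Unlike the previous bound this one must be linear in e, hence exp(y) - 1 <= y exp(y). *)
Lemma expR_small_bound t e : 0 <= t <= 1 / 4 -> 0 <= e <= 1 ->
  (1 + t) ^+ 2 * (expR (e * (t / (1 - t))) - 1) <= 4 * e * t.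
Proof.
move=> /andP[t0 t1] /andP[e0 e1]; have d1 : 0 < 1 - t by lra.
have d2 : 0 < 1 - 2 * t by lra.
have c1 : t / (1 - t) < 1 by rewrite ltr_pdivrMr//; lra.
have c0 : 0 <= t / (1 - t) by rewrite divr_ge0// ltW.
have h : expR (e * (t / (1 - t))) - 1 <= e * (t / (1 - 2 * t)).
  apply: (le_trans (expR_sub1_le _)); rewrite -mulrA ler_wpM2l//.
  apply: (@le_trans _ _ (t / (1 - t) * ((1 - t) / (1 - 2 * t)))); last first.
    by rewrite mulrA divfK// gt_eqF.
  rewrite ler_wpM2l//; apply: (@le_trans _ _ (expR (t / (1 - t)))).
    by rewrite ler_expR ler_piMl.
  apply: (le_trans (expR_le_invB c1)); rewrite (_ : 1 - _ = (1 - 2 * t) / (1 - t)) ?invf_div//.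
  by field; rewrite gt_eqF.
apply: (@le_trans _ _ ((1 + t) ^+ 2 * (e * (t / (1 - 2 * t))))).
  by rewrite ler_wpM2l ?sqr_ge0.
rewrite (_ : _ * _ = e * t * ((1 + t) ^+ 2 / (1 - 2 * t))); last by ring.
rewrite (_ : 4 * e * t = e * t * 4); last by ring.
rewrite ler_wpM2l ?mulr_ge0// ler_pdivrMr//.
by have : 0 <= t * (1 / 4 - t) by [apply: mulr_ge0; lra]; nra.
Qed.

End numeric_bounds.

(** * Averaging the flow over the Poisson minibatch *)

Section minibatch_bounds.
Context {R : realType} {n : nat} {J : finType} (G : factor_graph R n J).
Context (lambda : R) (m k : nat) (rho : R).
Hypotheses (lambda_gt0 : 0 < lambda) (m_gt0 : (0 < m)%N) (k_gt0 : (0 < k)%N).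
Local Notation a := (lo G).
Local Notation b := (hi G).
Local Notation mu := (@lebesgue_measure R).
Local Notation RB := (measurableTypeR R).
Local Notation phi := (factor_fun G).
Local Notation L := (Lmax G).
Local Notation M := (Mphi G).
Local Notation U := (U G lambda).
Local Notation fi := (f_interp G lambda m k).
Local Notation wp := (root_problem_well_posed G lambda m k).
Local Notation Omega := (Omega G).
Local Notation adjacent := (Defs.adjacent G).
Local Notation flow := (minibatch_flow G lambda m k).
Implicit Types (x : state R n) (i : 'I_n) (s : {ffun J -> nat}) (v : R).

Let ab : a < b := lo_lt_hi G.

Let sigma := Num.sqrt rho.
Definition cheb_rate d : R := 4 / (sigma ^+ d * (sigma - 1)).
Definition energy_ratio : R := L / lambda.
Local Notation t := energy_ratio.

Hypotheses (rho_gt1 : 1 < rho) (t_le : t <= 1 / 4) (rate_le1 : cheb_rate m <= 1).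
Hypothesis continuable : forall (j : J) (i : 'I_n) (x : state R n), Omega x ->
  analytically_continuable a b rho (M j) (fun v => phi j (update x i v)).

Lemma sigma_gt1 : 1 < sigma.
Proof. by rewrite -sqrtr1 ltr_sqrt// (lt_trans ltr01). Qed.

Lemma sigma_sqr : sigma ^+ 2 = rho.
Proof. by rewrite sqr_sqrtr// ltW// (lt_trans ltr01). Qed.

Lemma cheb_rate_ge0 d : 0 <= cheb_rate d.
Proof.
have s1 := sigma_gt1; rewrite divr_ge0// mulr_ge0 ?exprn_ge0 ?subr_ge0 ?ltW//.
exact: lt_trans s1.
Qed.

Lemma energy_ratio_ge0 : 0 <= t.
Proof. by rewrite divr_ge0 ?Lmax_ge0// ltW. Qed.

Let t1 : 0 <= t < 1.
Proof. by rewrite energy_ratio_ge0/=; apply: (le_lt_trans t_le); lra. Qed.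

(** After this normalisation L phi / (lambda M) = t theta, so one t serves all factors and the
    continuations are bounded by 1. *)
Definition factor_ratio i x j v : R := phi j (update x i v) / M j.
Local Notation theta := factor_ratio.

Lemma factor_ratio01 i x j v : Omega x -> v \in `[a, b] -> 0 <= theta i x j v <= 1.
Proof.
move=> xO vab; have /andP[f0 f1] := @factor_bounds _ _ _ G j _ (Omega_update i xO vab).
by rewrite divr_ge0 ?(ltW (Mphi_gt0 G j))//= ler_pdivrMr ?Mphi_gt0// mul1r.
Qed.

Lemma U_ratio i x s v :
  U x i s v = \sum_(j in adjacent i) (s j)%:R * ln (1 + t * theta i x j v).
Proof.
apply: eq_bigr => j _; congr (_ * ln (1 + _)).
by rewrite /energy_ratio /factor_ratio invfM; ring.
Qed.

Definition minibatch_size i s : R := (\sum_(j in adjacent i) (s j)%:R) * (t / (1 - t)).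
Local Notation V := minibatch_size.

Definition interp_defect i s : R :=
  expR (cheb_rate m * V i s) - 1 + cheb_rate k * expR (2 * V i s).
Local Notation delta := interp_defect.

Lemma minibatch_size_ge0 i s : 0 <= V i s.
Proof.
have /andP[t0 t1'] := t1.
by rewrite mulr_ge0 ?sumr_ge0// divr_ge0// subr_ge0 ltW.
Qed.

Lemma interp_defect_ge0 i s : 0 <= delta i s.
Proof.
apply: addr_ge0; last by rewrite mulr_ge0 ?cheb_rate_ge0 ?expR_ge0.
by rewrite subr_ge0 -expR0 ler_expR mulr_ge0 ?cheb_rate_ge0 ?minibatch_size_ge0.
Qed.

Lemma f_interp_error i s x v : Omega x -> v \in `[a, b] ->
  `|(fi x i s).[v] - expR (U x i s v)| <= expR (U x i s v) * delta i s.
Proof.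
move=> xO vab.
have /choice[g Hg] j : exists g, extends a b (sigma ^+ 2) 1 (theta i x j) g.
  have [h hE] := analytic_extends ab rho_gt1 (continuable j i xO).
  exists (fun w => (M j)^-1%:C%C * h w).
  have M0 := Mphi_gt0 G j; rewrite sigma_sqr.
  have := extendsZ (M j)^-1 rho_gt1 hE; rewrite ger0_norm ?invr_ge0 ?ltW// mulVf ?gt_eqF//.
  by apply: extends_ext => w; rewrite mulrC.
have := @double_interp_error _ J a b sigma t (adjacent i) (theta i x) g s m k ab sigma_gt1 t1
  m_gt0 k_gt0 (fun j _ => Hg j) (fun j w _ => factor_ratio01 i j xO) rate_le1 v vab.
have -> : (fun w => \sum_(j in adjacent i) (s j)%:R * ln (1 + t * theta i x j w)) = U x i s.
  by apply/funext => w; rewrite U_ratio.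
by rewrite -U_ratio.
Qed.

Lemma expU_bound i s x v : Omega x -> v \in `[a, b] ->
  0 <= U x i s v <= \sum_(j in adjacent i) (s j)%:R.
Proof.
move=> xO vab; rewrite U_ratio; have /andP[t0 t1'] := t1.
have h j : 0 <= ln (1 + t * theta i x j v) <= 1.
  have /andP[h0 h1] := factor_ratio01 i j xO vab.
  have th0 : 0 <= t * theta i x j v by rewrite mulr_ge0.
  rewrite ln_ge0 ?lerDl//=; apply: (le_trans (le_ln1Dx _)); first by lra.
  by rewrite -[leRHS]mulr1 ler_pM// ltW.
apply/andP; split; first by apply: sumr_ge0 => j _; rewrite mulr_ge0//; case/andP: (h j).
by apply: ler_sum => j _; rewrite ler_piMr//; case/andP: (h j).
Qed.

Definition expU_mass i s x : R := \int[mu]_(v in `[a, b]) expR (U x i s v).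

Let measurable_expU i s x : Omega x -> measurable_fun (`[a, b] : set RB) (fun v => expR (U x i s v)).
Proof.
move=> xO; apply: (measurableT_comp (@measurable_expR R)).
exact: (measurable_move_slice xO (measurable_U lambda i s)).
Qed.

Let expU1 i s x : Omega x -> forall v, v \in `[a, b] ->
  1 <= expR (U x i s v) <= expR (\sum_(j in adjacent i) (s j)%:R).
Proof. by move=> xO v vab; rewrite -{1}expR0 !ler_expR; exact: expU_bound. Qed.

Lemma integral_expU i s x : Omega x ->
  (\int[mu]_(v in `[a, b]) (expR (U x i s v))%:E = (expU_mass i s x)%:E)%E.
Proof. by move=> xO; exact: (EFin_segment_integral ab (measurable_expU i s xO) (expU1 i s xO)). Qed.

Lemma expU_mass_gt0 i s x : Omega x -> 0 < expU_mass i s x.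
Proof. by move=> xO; exact: (segment_integral_gt0 ab (measurable_expU i s xO) (expU1 i s xO)). Qed.

Lemma f_mass_le i s x : Omega x -> delta i s < 1 ->
  mass_upto a (fi x i s) b <= (1 + delta i s) * expU_mass i s x.
Proof.
move=> xO d1; rewrite -lee_fin -(integral_poly _ (ltW ab)) EFinM -integral_expU//.
have f_bounds v : v \in `[a, b] ->
    0 <= (fi x i s).[v] <= (1 + delta i s) * expR (U x i s v).
  move=> vab; have := f_interp_error i s xO vab; rewrite ler_distl => /andP[h1 h2].
  rewrite mulrDl mul1r [_ * expR _]mulrC h2 andbT (le_trans _ h1)//.
  by rewrite -[X in X - _]mulr1 -mulrBr mulr_ge0 ?expR_ge0// subr_ge0 ltW.
rewrite -ge0_integralZl//.
- apply: ge0_le_integral => //.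
  + by move=> v /f_bounds/andP[].
  + apply/measurable_EFinP; apply: measurable_funTS.
    by apply: continuous_measurable_fun => w; exact: continuous_horner.
  + apply/measurable_EFinP; apply: measurable_funM => //; exact: measurable_expU.
  + by move=> v /f_bounds/andP[].
- by apply/measurable_EFinP; exact: measurable_expU.
- by rewrite lee_fin addr_ge0// interp_defect_ge0.
Qed.

(** A defect below 1 makes the interpolant nonnegative, so the root problem is well posed. Both
    entries of the minimum are at least 1 - delta times the product of exponentials, the mass is at
    most 1 + delta times [expU_mass], and (1 - 2 delta)(1 + delta) <= 1 - delta. *)
Lemma flow_lower_bound i s x v : Omega x -> v \in `[a, b] -> delta i s < 1 / 2 ->
  (1 - 2 * delta i s) * (expR (U x i s (tnth x i)) * expR (U x i s v)) / expU_mass i s x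
  <= flow i s x v.
Proof.
move=> xO vab d2; have d0 := interp_defect_ge0 i s; have d1 : delta i s < 1 by lra.
have f_ge w : w \in `[a, b] -> (1 - delta i s) * expR (U x i s w) <= (fi x i s).[w].
  move=> wab; have := f_interp_error i s xO wab; rewrite ler_distl => /andP[h1 _].
  by apply: le_trans h1; lra.
have f_ge0 w : w \in `[a, b] -> 0 <= (fi x i s).[w].
  by move=> wab; apply: le_trans (f_ge w wab); rewrite mulr_ge0 ?expR_ge0// subr_ge0 ltW.
have fa := f_interp_lo_gt0 G lambda m k_gt0 x i s.
have I0 := mass_gt0 ab fa f_ge0.
have J0 := expU_mass_gt0 i s xO.
rewrite /minibatch_flow asboolT; last exact/(well_posed_f_interp G lambda m k_gt0).
set E := expR _; set E' := expR _; have E0 : 0 <= E := expR_ge0 _; have E0' : 0 <= E' := expR_ge0 _.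
apply: (@le_trans _ _ ((1 - delta i s) * (E * E') / mass_upto a (fi x i s) b)); last first.
  rewrite ler_pM2r ?invr_gt0// le_min; apply/andP; split.
    by rewrite mulrCA ler_wpM2l// f_ge.
  by rewrite mulrA mulrC ler_wpM2l// f_ge// Omega_tnth.
rewrite -!mulrA mulrCA [leRHS]mulrCA ler_wpM2l// mulrCA [leRHS]mulrCA ler_wpM2l//.
rewrite ler_pdivrMr// mulrAC ler_pdivlMr//.
apply: (@le_trans _ _ ((1 - 2 * delta i s) * ((1 + delta i s) * expU_mass i s x))).
  by rewrite ler_wpM2l ?f_mass_le//; lra.
by rewrite mulrA ler_pM2r//; nra.
Qed.

(* For delta >= 1/2 the inequality is trivial; for delta < 1/2 it is the
   AM-GM inequality q / J + tau ^ 2 * J >= 2 * tau * q with q = 1 - 2 * delta <= 1.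
   Being linear in the flow, it survives averaging over the minibatch. *)
Lemma flow_linear_bound i s x v tau : Omega x -> v \in `[a, b] -> 0 <= tau ->
  6 * tau * (expR (U x i s (tnth x i)) * expR (U x i s v)) <=
  flow i s x v + expR (U x i s (tnth x i)) * expR (U x i s v) *
    (4 * tau * (cheb_rate k * expR (2 * V i s) + expR (cheb_rate m * V i s))
     + tau ^+ 2 * expU_mass i s x).
Proof.
move=> xO vab tau0; have g0 : 0 <= flow i s x v by exact: minibatch_flow_ge0.
have J0 := expU_mass_gt0 i s xO.
set N := _ * expR (U x i s v); have N0 : 0 <= N by rewrite mulr_ge0 ?expR_ge0.
(* The 6 comes from 2 tau (1 - 2 delta) = 6 tau - 4 tau (delta + 1): the shift by 1 leaves two pure
   exponentials to average. *)
have -> : cheb_rate k * expR (2 * V i s) + expR (cheb_rate m * V i s) = delta i s + 1.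
  by rewrite /interp_defect; ring.
have [d2|d2] := ltP (delta i s) (1 / 2); last first.
  have h : 0 <= tau * (delta i s - 1 / 2) by rewrite mulr_ge0// subr_ge0.
  rewrite -[leLHS]add0r; apply: lerD => //; rewrite mulrC ler_wpM2l//.
  have := mulr_ge0 (sqr_ge0 tau) (ltW J0); lra.
have := flow_lower_bound xO vab d2; rewrite -/N => h.
rewrite -lerBlDr; apply: le_trans h; have d0 := interp_defect_ge0 i s.
rewrite lerBlDr -subr_ge0.
set q := 1 - 2 * delta i s; set I := expU_mass i s x in J0 *.
have -> : q * N / I + N * (4 * tau * (delta i s + 1) + tau ^+ 2 * I) - 6 * tau * N =
    N * (q * (1 - tau * I) ^+ 2 / I + (1 - q) * tau ^+ 2 * I).
  by rewrite /q; field; rewrite gt_eqF.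
rewrite mulr_ge0// addr_ge0//.
  by rewrite divr_ge0 ?(ltW J0)// mulr_ge0 ?sqr_ge0// /q; lra.
by rewrite !mulr_ge0 ?(ltW J0) ?sqr_ge0// /q; lra.
Qed.

Let t_ge0 : 0 <= t := energy_ratio_ge0.

Variables (i : 'I_n) (x : state R n) (v : R).
Hypotheses (xO : Omega x) (vab : v \in `[a, b]).

Let rate j := lambda * M j / L.
Let prior s := \prod_(j in adjacent i) poisson_pmf (rate j) (s j).
Let gain w j := 1 + t * theta i x j w.
Let gains j := gain (tnth x i) j * gain v j.
Let c0 := t / (1 - t).
Let start := tnth x i.

Let xab : start \in `[a, b] := Omega_tnth i xO.

Let rate_gt0 j : j \in adjacent i -> 0 < rate j.
Proof. by move=> jA; rewrite divr_gt0 ?(Lmax_gt0 jA)// mulr_gt0// Mphi_gt0. Qed.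

Let rate_ratio j : j \in adjacent i -> rate j * t = M j.
Proof.
move=> jA; have L0 := Lmax_gt0 jA; rewrite /rate /energy_ratio.
by field; rewrite !gt_eqF.
Qed.

Let gain_bound w j : w \in `[a, b] -> 1 <= gain w j <= 1 + t.
Proof.
move=> wab; have /andP[h0 h1] := factor_ratio01 i j xO wab.
by rewrite lerDl mulr_ge0//= lerD2l ler_piMr.
Qed.

Let gains_bound j : 1 <= gains j <= (1 + t) ^+ 2.
Proof.
have /andP[h0 h1] := gain_bound j xab; have /andP[h2 h3] := gain_bound j vab.
rewrite /gains; apply/andP; split; first by rewrite -[leLHS]mulr1 ler_pM.
by rewrite expr2 ler_pM// (le_trans ler01).
Qed.

Let prior_ge0 s : 0 <= prior s.
Proof. by apply: prodr_ge0 => j _; exact: poisson_pmf_ge0. Qed.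

Let expU w s : w \in `[a, b] -> expR (U x i s w) = \prod_(j in adjacent i) gain w j ^+ s j.
Proof.
move=> wab; rewrite U_ratio expR_sum; apply: eq_bigr => j _.
by rewrite expRM_natl lnK// posrE (lt_le_trans ltr01)//; case/andP: (gain_bound j wab).
Qed.

Let expV r s : expR (r * V i s) = \prod_(j in adjacent i) expR (r * c0) ^+ s j.
Proof.
rewrite /minibatch_size -/c0 mulrCA mulr_suml expR_sum.
by apply: eq_bigr => j _; rewrite expRM_natl.
Qed.

Let nu s := expR (U x i s start) * expR (U x i s v).

Let nuE s : nu s = \prod_(j in adjacent i) gains j ^+ s j.
Proof.
by rewrite /nu !expU// -big_split; apply: eq_bigr => j _; rewrite /gains exprMn.
Qed.

Let total := expR (\sum_(j in adjacent i) rate j * (gains j - 1)).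

Local Open Scope ereal_scope.

Let esum_prior (y : J -> R) : (forall j, j \in adjacent i -> (0 < y j)%R) ->
  \esum_(s in minibatches G i) (prior s * \prod_(j in adjacent i) y j ^+ s j)%:E =
  (expR (\sum_(j in adjacent i) rate j * (y j - 1)))%:E.
Proof.
move=> y0; rewrite -(poisson_prod_mgf rate_gt0 y0).
by apply: eq_esum => s _; rewrite -big_split.
Qed.

Let gains_gt0 j : (0 < gains j)%R.
Proof. by apply: lt_le_trans ltr01 _; case/andP: (gains_bound j). Qed.

Let esum_nu : \esum_(s in minibatches G i) (prior s * nu s)%:E = total%:E.
Proof. by rewrite /total -esum_prior//; apply: eq_esum => s _; rewrite nuE. Qed.

(** The extra factor exp(r c0) per unit of s j raises the exponent of the generating function by
    rate j times gains j times (exp(r c0) - 1). The assumption bounds this by B times rate j times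
    t, that is B M j, and the M j add up to at most L. *)
Let esum_nu_tilt (r B : R) : (0 <= r)%R -> (0 <= B)%R ->
  ((1 + t) ^+ 2 * (expR (r * c0) - 1) <= B * t)%R ->
  \esum_(s in minibatches G i) (prior s * (nu s * expR (r * V i s)))%:E
    <= (total * expR (B * L))%:E.
Proof.
move=> r0 B0 h.
have -> : \esum_(s in minibatches G i) (prior s * (nu s * expR (r * V i s)))%:E =
    \esum_(s in minibatches G i)
      (prior s * \prod_(j in adjacent i) (gains j * expR (r * c0)) ^+ s j)%:E.
  apply: eq_esum => s _; rewrite nuE expV -big_split; congr (_ * _)%:E.
  by apply: eq_bigr => j _; rewrite [RHS]exprMn.
rewrite esum_prior; last by move=> j _; rewrite mulr_gt0// expR_gt0.
rewrite lee_fin -expRD ler_expR.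
have c00 : (0 <= c0)%R by rewrite divr_ge0// subr_ge0 (le_trans t_le)//; lra.
have e1 : (1 <= expR (r * c0))%R by rewrite -expR0 ler_expR mulr_ge0.
apply: (@le_trans _ _ (\sum_(j in adjacent i) (rate j * (gains j - 1) + B * M j))%R).
  apply: ler_sum => j jA; rewrite -(rate_ratio jA) [(B * _)%R]mulrCA -mulrDr.
  rewrite ler_pM2l ?rate_gt0//.
  have /andP[_ g2] := gains_bound j.
  have : (gains j * (expR (r * c0) - 1) <= B * t)%R.
    by apply: le_trans h; rewrite ler_wpM2r// subr_ge0.
  lra.
by rewrite big_split/= lerD2l -mulr_sumr ler_wpM2l// sum_Mphi_le_Lmax.
Qed.

Let weight w := gibbs_weight G x i w.
Let mass := gibbs_mass G i x.
(** Price of averaging [expU_mass] jointly with [nu]. As 2 t + t^2 <= 4 t, it is at most exp(4 L^2 /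
    lambda), which is the loss in the theorem. *)
Let slack := expR ((2 * t + t ^+ 2) * L).

Let M_gain j w : j \in adjacent i -> (rate j * (gain w j - 1) = phi j (update x i w))%R.
Proof.
move=> jA; rewrite /gain addrAC subrr add0r mulrA rate_ratio//.
by rewrite /factor_ratio mulrC divfK// gt_eqF// Mphi_gt0.
Qed.

Let esum_nu_expU w : w \in `[a, b] ->
  \esum_(s in minibatches G i) (prior s * (nu s * expR (U x i s w)))%:E
    <= (total * slack * weight w)%:E.
Proof.
move=> wab.
have -> : \esum_(s in minibatches G i) (prior s * (nu s * expR (U x i s w)))%:E =
    \esum_(s in minibatches G i)
      (prior s * \prod_(j in adjacent i) (gains j * gain w j) ^+ s j)%:E.
  apply: eq_esum => s _; rewrite nuE expU// -big_split; congr (_ * _)%:E.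
  by apply: eq_bigr => j _; rewrite [RHS]exprMn.
have gw0 j : (0 < gain w j)%R.
  by apply: lt_le_trans ltr01 _; case/andP: (gain_bound j wab).
rewrite esum_prior; last by move=> j _; rewrite mulr_gt0.
rewrite lee_fin -!expRD ler_expR.
apply: (@le_trans _ _ (\sum_(j in adjacent i)
  (rate j * (gains j - 1) + (2 * t + t ^+ 2) * M j + phi j (update x i w)))%R).
  apply: ler_sum => j jA; rewrite -(M_gain w jA) -(rate_ratio jA).
  rewrite [((2 * _ + _) * _)%R]mulrCA -!mulrDr ler_pM2l ?rate_gt0//.
  have /andP[g1 g2] := gains_bound j; have /andP[w1 w2] := gain_bound j wab.
  have : ((gains j - 1) * (gain w j - 1) <= ((1 + t) ^+ 2 - 1) * t)%R.
    by rewrite ler_pM ?subr_ge0// ?lerD2r// lerBlDl.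
  lra.
rewrite !big_split/= lerD2r lerD2l -mulr_sumr ler_wpM2l ?sum_Mphi_le_Lmax//.
by apply: addr_ge0; [rewrite pmulr_rge0|exact: sqr_ge0].
Qed.

Let esum_nu_mass :
  \esum_(s in minibatches G i) (prior s * (nu s * expU_mass i s x))%:E
    <= (total * (slack * mass))%:E.
Proof.
have mU s : measurable_fun (`[a, b] : set RB) (fun w => expR (U x i s w)).
  apply: (measurableT_comp (@measurable_expR R)).
  exact: (measurable_move_slice xO (measurable_U lambda i s)).
have pn0 s : (0 <= prior s * nu s)%R by rewrite mulr_ge0// mulr_ge0 ?expR_ge0.
have -> : \esum_(s in minibatches G i) (prior s * (nu s * expU_mass i s x))%:E =
    \int[mu]_(w in `[a, b]) \esum_(s in minibatches G i)
      (prior s * (nu s * expR (U x i s w)))%:E.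
  rewrite integral_esum//; last 2 first.
  - by move=> s w _ _; rewrite lee_fin mulrA mulr_ge0 ?expR_ge0.
  - move=> s _; apply/measurable_EFinP; apply: measurable_funM => //.
    exact: measurable_funM.
  apply: eq_esum => s _; rewrite mulrA EFinM -integral_expU// -ge0_integralZl//.
  - by apply: eq_integral => w _; rewrite -EFinM mulrA.
  - by apply/measurable_EFinP.
  - by rewrite lee_fin.
have mw : measurable_fun (`[a, b] : set RB) weight.
  by have := measurable_move_slice xO (measurable_gibbs_weight (G := G) i).
have ts0 : (0 <= total * slack)%R by rewrite mulr_ge0 ?expR_ge0.
have -> : (total * (slack * mass))%:E =
    (total * slack)%:E * \int[mu]_(w in `[a, b]) (weight w)%:E.
  by rewrite integral_gibbs_weight// -EFinM mulrA.
rewrite -ge0_integralZl//; last 2 first.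
- by apply/measurable_EFinP.
- by move=> w _; rewrite lee_fin expR_ge0.
apply: ge0_le_integral => //.
- by move=> w _; apply: esum_ge0 => s _; rewrite lee_fin mulrA mulr_ge0 ?expR_ge0.
- apply: measurable_fun_esum => //.
    by move=> s w _ _; rewrite lee_fin mulrA mulr_ge0 ?expR_ge0.
  move=> s _; apply/measurable_EFinP; apply: measurable_funM => //.
  exact: measurable_funM.
- by apply/measurable_EFinP; apply: measurable_funM.
Qed.

Definition gap_loss : R :=
  (cheb_rate k * expR (8 * L) + expR (4 * cheb_rate m * L) - 1)%R.

Let mass_gt0 : (0 < mass)%R := gibbs_mass_gt0 i xO.

(** By [esum_nu_mass] the average of [nu] times [expU_mass] is at most total / tau, so the quadratic
    term of the AM-GM bound costs no more than tau total. *)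
Let tau : R := (slack * mass)^-1.

Let tau_ge0 : (0 <= tau)%R.
Proof. by rewrite invr_ge0 mulr_ge0 ?expR_ge0// ltW. Qed.

Let C_ge0 d : (0 <= cheb_rate d)%R.
Proof. exact: cheb_rate_ge0. Qed.

(** Averaging [flow_linear_bound] gives 6 tau total on the left; on the right, besides the flow, 4
    (gap_loss + 1) tau total from the two exponentials and tau total from the quadratic term. What
    remains is 6 - 4 (gap_loss + 1) - 1 = 1 - 4 gap_loss. *)
Lemma esum_flow_ge : ((1 - 4 * gap_loss) * (tau * total))%:E <=
  \esum_(s in minibatches G i) (prior s * flow i s x v)%:E.
Proof.
have t14 : (0 <= t <= 1 / 4)%R by rewrite t_ge0.
have nu0 s : (0 <= nu s)%R by rewrite mulr_ge0 ?expR_ge0.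
have fl0 s : (0 <= flow i s x v)%R by exact: minibatch_flow_ge0.
have mass0 s : (0 <= expU_mass i s x)%R by apply/ltW; exact: expU_mass_gt0.
pose e1 s := (prior s * (nu s * expR (2 * V i s)))%:E.
pose e2 s := (prior s * (nu s * expR (cheb_rate m * V i s)))%:E.
pose e3 s := (prior s * (nu s * expU_mass i s x))%:E.
have e1_0 s : 0 <= e1 s by rewrite lee_fin !mulr_ge0 ?expR_ge0.
have e2_0 s : 0 <= e2 s by rewrite lee_fin !mulr_ge0 ?expR_ge0.
have e3_0 s : 0 <= e3 s by rewrite lee_fin mulr_ge0// mulr_ge0.
have fl s : (6 * tau)%:E * (prior s * nu s)%:E <= (prior s * flow i s x v)%:E +
    ((4 * tau * cheb_rate k)%:E * e1 s + ((4 * tau)%:E * e2 s + (tau ^+ 2)%:E * e3 s)).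
  rewrite -!EFinM -!EFinD lee_fin.
  have := flow_linear_bound i s xO vab tau_ge0.
  rewrite -/start -/(nu s) => /(ler_wpM2l (prior_ge0 s)); nra.
have tau2 : (0 <= tau ^+ 2)%R by exact: sqr_ge0.
have tau4 : (0 <= 4 * tau)%R by rewrite mulr_ge0.
have tau4C : (0 <= 4 * tau * cheb_rate k)%R by rewrite mulr_ge0.
have := @le_esum _ _ (minibatches G i) _ _ (fun s _ => fl s).
rewrite esumZl ?mulr_ge0//; last by move=> s _; rewrite lee_fin mulr_ge0.
rewrite esum_nu esumD; last 2 first.
- by move=> s _; rewrite lee_fin mulr_ge0.
- by move=> s _; rewrite !adde_ge0// mule_ge0.
rewrite esumD; last 2 first.
- by move=> s _; rewrite mule_ge0.
- by move=> s _; rewrite adde_ge0// mule_ge0.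
rewrite esumD; last 2 first.
- by move=> s _; rewrite mule_ge0.
- by move=> s _; rewrite mule_ge0.
rewrite !esumZl//.
have h1 : \esum_(s in minibatches G i) e1 s <= (total * expR (8 * L))%:E.
  by apply: esum_nu_tilt => //; exact: expR_double_bound.
have h2 : \esum_(s in minibatches G i) e2 s <= (total * expR (4 * cheb_rate m * L))%:E.
  apply: esum_nu_tilt => //; first by rewrite mulr_ge0.
  by apply: expR_small_bound; rewrite // C_ge0.
have h3 : \esum_(s in minibatches G i) e3 s <= (total * (slack * mass))%:E by exact: esum_nu_mass.
move=> h.
have : (6 * tau)%:E * total%:E <= \esum_(s in minibatches G i) (prior s * flow i s x v)%:E +
    (4 * tau * cheb_rate k * (total * expR (8 * L)) +
     (4 * tau * (total * expR (4 * cheb_rate m * L)) + tau ^+ 2 * (total * (slack * mass))))%:E.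
  apply: (le_trans h); rewrite leeD2l// 2!EFinD.
  by apply: leeD; [|apply: leeD]; rewrite [leRHS]EFinM lee_wpmul2l// lee_fin.
rewrite -EFinM -leeBlDr// -EFinB; apply: le_trans; rewrite lee_fin.
have -> : (tau ^+ 2 * (total * (slack * mass)) = tau * total)%R.
  by rewrite /tau; field; rewrite !gt_eqF ?expR_gt0.
by rewrite /gap_loss; lra.
Qed.

Let slackE : (slack <= expR (4 * L ^+ 2 / lambda))%R.
Proof.
rewrite ler_expR (_ : 4 * L ^+ 2 / lambda = 4 * t * L)%R; last first.
  by rewrite /energy_ratio; ring.
rewrite ler_wpM2r ?Lmax_ge0//.
have : (0 <= t * (1 / 4 - t))%R by rewrite mulr_ge0// subr_ge0.
by have := t_ge0; lra.
Qed.

(** Since both gains are at least 1, their product minus 1 is at least the sum of the two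
    increments, which the rates turn into the energies at x and at the updated point. *)
Let totalE : (expR (\sum_(j in adjacent i) phi j x) * weight v <= total)%R.
Proof.
rewrite -expRD ler_expR -big_split/=; apply: ler_sum => j jA.
rewrite -{1}(update_id x i) -!M_gain// -mulrDr ler_pM2l ?rate_gt0//.
have /andP[h0 _] := gain_bound j xab; have /andP[h2 _] := gain_bound j vab.
have : (0 <= (gain start j - 1) * (gain v j - 1))%R by rewrite mulr_ge0// subr_ge0.
by rewrite /gains -/start; lra.
Qed.

Lemma gap_loss_ge0 : (0 <= gap_loss)%R.
Proof.
rewrite /gap_loss -addrA; apply: addr_ge0; first by rewrite mulr_ge0 ?expR_ge0.
rewrite subr_ge0 -expR0 ler_expR; apply: mulr_ge0; last exact: Lmax_ge0.
by rewrite mulr_ge0.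
Qed.

Lemma pgda_density_ge_gibbs :
  ((1 - 4 * Num.sqrt gap_loss) * expR (- (4 * L ^+ 2 / lambda)))%:E * gibbs_density G i (x, v)
  <= pgda_density G lambda m k i (x, v).
Proof.
have g0 := gibbs_density_ge0 G i (x, v).
have [F4|F4] := leP (1 - 4 * Num.sqrt gap_loss)%R 0%R.
  apply: (@le_trans _ _ 0); last exact: pgda_density_ge0.
  by rewrite mule_le0_ge0// lee_fin mulr_le0_ge0 ?expR_ge0.
(* In this case sqrt(F) < 1 / 4, so F <= sqrt(F) and the factor 1 - 4 F of [esum_flow_ge] is at
   least 1 - 4 sqrt(F). *)
have F1 : (gap_loss <= Num.sqrt gap_loss)%R.
  rewrite -[leLHS](sqr_sqrtr gap_loss_ge0) expr2 ler_piMr ?sqrtr_ge0//; lra.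
pose E := expR (\sum_(j in adjacent i) phi j x).
have E0 : (0 < E)%R := expR_gt0 _.
rewrite -(@lee_pmul2l _ E%:E)//.
have -> : E%:E * pgda_density G lambda m k i (x, v) =
    \esum_(s in minibatches G i) (prior s * flow i s x v)%:E.
  rewrite /pgda_density patchE mem_set//= -esumZl ?ltW//.
    by apply: eq_esum => s _; rewrite -EFinM pgda_flowE.
  by move=> s _; rewrite lee_fin mulr_ge0 ?minibatch_weight_ge0 ?minibatch_density_ge0.
apply: le_trans esum_flow_ge.
rewrite /gibbs_density patchE mem_set//= -!EFinM lee_fin.
set sq := (1 - 4 * Num.sqrt _)%R.
apply: (@le_trans _ _ (sq * (tau * total))%R); last first.
  by rewrite ler_wpM2r ?mulr_ge0 ?expR_ge0// /sq; lra.
rewrite mulrCA -[leLHS]mulrA ler_pM2l// -/(weight v) -/mass /tau.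
rewrite expRN invfM.
have -> : ((expR (4 * L ^+ 2 / lambda))^-1 * (E * (weight v / mass)) =
  (expR (4 * L ^+ 2 / lambda))^-1 / mass * (E * weight v))%R by ring.
apply: ler_pM => //; rewrite ?mulr_ge0 ?invr_ge0 ?expR_ge0 ?(ltW mass_gt0)//.
by rewrite ler_pM2r ?invr_gt0// lef_pV2 ?posrE ?expR_gt0.
Qed.

End minibatch_bounds.

Lemma powRN_half {R : realType} (rho : R) (d : nat) : 0 <= rho ->
  rho `^ (- (d%:R / 2)) = (Num.sqrt rho ^+ d)^-1.
Proof.
by move=> r0; rewrite powRN mulrC powRrM powR12_sqrt// powR_mulrn// sqrtr_ge0.
Qed.

Theorem theorem4 (R : realType) (n : nat) (hn : (0 < n)%N) (J : finType)
    (G : factor_graph R n J) (lambda : R) (hlambda : 0 < lambda)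
    (m k : nat) (hm : (0 < m)%N) (hk : (0 < k)%N) :
  exists (gibbs pgda : R.-pker (state R n) ~> (state R n)),
    [/\ forall x, Omega G x -> forall B, measurable B ->
          gibbs x B = gibbs_step G x B,
        forall x, Omega G x -> forall B, measurable B ->
          pgda x B = pgda_step G lambda m k x B,
        reversible (target G) pgda,
        stationary (target G) pgda
      & forall rho : R, 1 < rho ->
          (forall (j : J) (i : 'I_n) (x : state R n), Omega G x ->
             analytically_continuable (lo G) (hi G) rho (Mphi G j)
               (fun v => factor_fun G j (update x i v))) ->
          lambda * ln 2 >= 4 * Lmax G ->
          4 * rho `^ (- (m%:R / 2)) <= Num.sqrt rho - 1 ->
          let F := 4 * expR (8 * Lmax G) * rho `^ (- (k%:R / 2))
                     / (Num.sqrt rho - 1)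
                   + expR (16 * Lmax G * rho `^ (- (m%:R / 2))
                             / (Num.sqrt rho - 1)) - 1 in
          (spectral_gap (target G) pgda >=
             ((1 - 4 * Num.sqrt F) * expR (- (4 * Lmax G ^+ 2 / lambda)))%:E
               * spectral_gap (target G) gibbs)%E].

Proof.
have [pgda pgdaE] := pgda_kernel_exists G m hn hlambda hk.
have [gibbs gibbsE] := gibbs_kernel_exists G hn.
have mp := measurable_pgda_density G lambda m hk.
have p0 := pgda_density_ge0 G lambda m hk.
have h0 := pgda_hold_ge0 G m hlambda hk.
have rev : reversible (target G) pgda.
  exact: (site_kernel_reversible (measurable_box (lo G) (hi G)) (@measurable_target_pdf _ _ _ G) (@target_pdf_ge0 _ _ _ G)
    mp p0 (measurable_pgda_hold G lambda m hk) h0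
    (fun x B _ => pgdaE x B) (pgda_balance G m hlambda hk)).
exists gibbs, pgda; split.
- by move=> x xO B mB; rewrite gibbsE gibbs_stepE.
- by move=> x xO B mB; rewrite pgdaE pgda_stepE.
- exact: rev.
- exact: reversible_stationary.
move=> rho rho1 hana hlam hm'; cbv zeta.
have rho0 : 0 <= rho by rewrite ltW// (lt_trans ltr01).
have s1 : 1 < Num.sqrt rho := sigma_gt1 rho1.
have s0 : 0 < Num.sqrt rho := lt_trans ltr01 s1.
(* The condition on m, in the form eps <= 1 of the double interpolation. *)
have rate1 : cheb_rate rho m <= 1.
  move: hm'; rewrite powRN_half// /cheb_rate => h.
  by rewrite invfM mulrA ler_pdivrMr ?mul1r// subr_gt0.
have t_le : energy_ratio G lambda <= 1 / 4.
  rewrite /energy_ratio ler_pdivrMr//.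
  (* As ln 2 <= 1, the condition on lambda gives 4 L <= lambda. *)
  have ln2 : ln 2 <= 1 :> R by apply: (le_trans (le_ln1Dx (x := 1) _)); lra.
  have := ler_wpM2l (ltW hlambda) ln2; lra.
have -> : 4 * expR (8 * Lmax G) * rho `^ (- (k%:R / 2)) / (Num.sqrt rho - 1)
    + expR (16 * Lmax G * rho `^ (- (m%:R / 2)) / (Num.sqrt rho - 1)) - 1 = gap_loss G m k rho.
  rewrite /gap_loss /cheb_rate !powRN_half//.
  have e0 d : Num.sqrt rho ^+ d != 0 by rewrite expf_neq0// gt_eqF.
  have d0 : Num.sqrt rho - 1 != 0 by rewrite subr_eq0 gt_eqF.
  by congr (_ + expR _ - 1); field; rewrite d0 e0.
set c := ((1 - _) * _); apply: spectral_gap_le => x B mB.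
rewrite pgdaE gibbsE; apply: (site_mixture_le mp p0 (measurable_gibbs_density G)
  (gibbs_density_ge0 G) h0) => //.
  have q1 : 1 - 4 * Num.sqrt (gap_loss G m k rho) <= 1 by rewrite gerBl mulr_ge0 ?sqrtr_ge0.
  have e1 : expR (- (4 * Lmax G ^+ 2 / lambda)) <= 1.
    rewrite -expR0 ler_expR oppr_le0; apply: divr_ge0; last exact: ltW.
    by rewrite mulr_ge0// sqr_ge0.
  rewrite /c; have [c0|/ltW c0] := leP (1 - 4 * Num.sqrt (gap_loss G m k rho)) 0.
    by apply: le_trans ler01; rewrite mulr_le0_ge0 ?expR_ge0.
  by rewrite -[leRHS]mulr1 ler_pM ?expR_ge0//.
(* The densities are compared at every real v; outside [a, b] the Gibbs density is 0. *)
move=> i y v yO; have [vab|vab] := pselect (v \in `[lo G, hi G]).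
  exact: pgda_density_ge_gibbs.
rewrite [X in (_ * X)%E](_ : _ = 0%E); last by rewrite /gibbs_density patchE memNset// => -[].
by rewrite mule0.
Qed.
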